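(* Suppose the weight sequence $\mathbf{w}$ has type I and the offspring variable $\xi$ has finite variance. Let $(k_n)$ be any sequence of non-negative integers with $k_n/\sqrt{n}\to0$, and let $v_0$ be a uniformly random vertex of $\mathcal{T}_n$. Then $$d_{\mathrm{TV}}\big(H_{k_n}(\mathcal{T}_n,v_0),\,H_{k_n}(\mathcal{T}^*,u_0)\big)\to0\quad (n\to\infty).$$
   Context: A weight sequence $\mathbf{w}=(\omega_k)_{k\ge0}$ consists of non-negative reals with $\omega_0>0$ and $\omega_k>0$ for some $k\ge2$; $\mathrm{span}(\mathbf{w})=\gcd\{i:\omega_i>0\}$. $\mathcal{T}_n$ is the random plane tree with $n$ vertices drawn with probability proportional to $\prod_{v}\omega_{d^+(v)}$ ($n\equiv1\bmod\mathrm{span}(\mathbf{w})$). With $\phi(z)=\sum_k\omega_kz^k$, radius $\rho_\phi$, $\psi(t)=t\phi'(t)/\phi(t)$, $\nu=\lim_{t\nearrow\rho_\phi}\psi(t)$: type I means $\rho_\phi>0$ and $\nu\ge1$, and then $\tau$ is the unique number with $\psi(\tau)=1$. $\xi$ has law $\Pr{\xi=k}=\tau^k\omega_k/\phi(\tau)$ (mean $1$ in type I), $\mathcal{T}$ is a Galton–Watson tree with offspring law $\xi$, and $\hat\xi$ is size-biased: $\Pr{\hat\xi=k}=k\Pr{\xi=k}$. $\mathcal{T}^*$: spine $u_0,u_1,\dots$ with $u_i$ the parent of $u_{i-1}$; $u_0$ is the root of an independent copy of $\mathcal{T}$; each $u_i$, $i\ge1$, has an independent copy of $\hat\xi$ many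 ordered children, one chosen uniformly at random being $u_{i-1}$, all others roots of independent copies of $\mathcal{T}$. $\mathcal{T}^*$ is pointed at $u_0$. For a plane tree $T$ (or $\mathcal{T}^*$), a vertex $v$ and $k\ge0$: if $v$ has a $k$-th ancestor $v_k$, $H_k(T,v)$ is the fringe subtree of $T$ rooted at $v_k$ (the maximal subtree consisting of $v_k$ and its descendants), viewed as a plane tree pointed at $v$; if $\mathrm{h}_T(v)<k$, $H_k(T,v)=\diamond$ for a fixed placeholder $\diamond$. Total variation distance is over the countable set of finite pointed plane trees together with $\diamond$. *)

(* Defs.v *)
From Stdlib Require Import Reals Lra Lia List Arith ClassicalEpsilon.
Import ListNotations.
Open Scope R_scope.

Definition is_weight_seq (w : nat -> R) : Prop :=
  (forall k, 0 <= w k) /\ 0 < w 0%nat /\ (exists k, (2 <= k)%nat /\ 0 < w k).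

Definition is_span (w : nat -> R) (d : nat) : Prop :=
  (forall i, 0 < w i -> Nat.divide d i) /\
  (forall d', (forall i, 0 < w i -> Nat.divide d' i) -> Nat.divide d' d).

Definition phi_converges (w : nat -> R) (t : R) : Prop :=
  exists l, infinite_sum (fun k => w k * t ^ k) l.

Definition inside_radius (w : nat -> R) (t : R) : Prop :=
  0 < t /\ exists t', t < t' /\ phi_converges w t'.

(* psi(t) = t phi'(t) / phi(t) > c   (for t inside the radius) *)
Definition psi_gt (w : nat -> R) (t c : R) : Prop :=
  exists P D, infinite_sum (fun k => w k * t ^ k) P /\
              infinite_sum (fun k => INR k * w k * t ^ k) D /\
              D / P > c.

(* Type I:  rho_phi > 0  and  nu = lim_{t -> rho_phi-} psi(t) >= 1,
   the latter written as liminf_{t -> rho-} psi(t) >= 1. *)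
Definition typeI (w : nat -> R) : Prop :=
  (exists t, 0 < t /\ phi_converges w t) /\
  (forall e, 0 < e -> exists t0, inside_radius w t0 /\
     forall t, t0 <= t -> inside_radius w t -> psi_gt w t (1 - e)).

(* tau is the number with psi(tau) = 1, phi(tau) = Phi (finite) *)
Definition is_tau (w : nat -> R) (tau Phi : R) : Prop :=
  0 < tau /\ infinite_sum (fun k => w k * tau ^ k) Phi /\
  infinite_sum (fun k => INR k * w k * tau ^ k) Phi.

Definition pxi (w : nat -> R) (tau Phi : R) (k : nat) : R := tau ^ k * w k / Phi.

Definition pxihat (w : nat -> R) (tau Phi : R) (k : nat) : R := INR k * pxi w tau Phi k.

(* xi has finite variance (xi has mean 1) *)
Definition finite_variance (w : nat -> R) (tau Phi : R) : Prop :=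
  exists v, infinite_sum (fun k => (INR k - 1) ^ 2 * pxi w tau Phi k) v.

Inductive tree : Type := Node : list tree -> tree.

Definition children (t : tree) : list tree := match t with Node ts => ts end.

Fixpoint tsize (t : tree) : nat :=
  match t with Node ts => S (fold_right (fun u acc => (tsize u + acc)%nat) 0%nat ts) end.

Definition Rprod (l : list R) : R := fold_right Rmult 1 l.
Definition Rsum (l : list R) : R := fold_right Rplus 0 l.

Fixpoint tprod (f : nat -> R) (t : tree) : R :=
  match t with
  | Node ts => f (length ts) * fold_right (fun u acc => tprod f u * acc) 1 ts
  end.

(* Vertices as paths from the root: list of child indices (0-based). *)
Fixpoint vertices (t : tree) : list (list nat) :=
  match t with
  | Node ts =>
      [] :: concat
        ((fix go (i : nat) (l : list tree) : list (list (list nat)) :=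
            match l with
            | [] => []
            | u :: l' => map (cons i) (vertices u) :: go (S i) l'
            end) 0%nat ts)
  end.

Fixpoint subtree_at (t : tree) (p : list nat) : option tree :=
  match p with
  | [] => Some t
  | i :: p' => match nth_error (children t) i with
               | Some u => subtree_at u p'
               | None => None
               end
  end.

(* Pointed plane trees: a tree together with (the path to) a vertex.
   Outcomes: None = placeholder diamond. *)
Definition outcome : Type := option (tree * list nat).

Definition Hk (k : nat) (t : tree) (v : list nat) : outcome :=
  if Nat.ltb (length v) k then None
  else match subtree_at t (firstn (length v - k) v) with
       | Some s => Some (s, skipn (length v - k) v)
       | None => None (* never happens for a vertex v of t *)
       end.

Fixpoint trees_f (fuel n : nat) {struct fuel} : list tree :=
  match fuel with
  | O => []
  | S f => match n with O => [] | S m => map Node (forests_f f m) end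
  end
with forests_f (fuel m : nat) {struct fuel} : list (list tree) :=
  match fuel with
  | O => []
  | S f => match m with
           | O => [[]]
           | _ => flat_map (fun j => flat_map (fun t => map (cons t) (forests_f f (m - j)))
                                               (trees_f f j)) (seq 1 m)
           end
  end.

Definition trees_of_size (n : nat) : list tree := trees_f (2 * n) n.

Definition ind (P : Prop) : R :=
  if excluded_middle_informative P then 1 else 0.

Definition tweight (w : nat -> R) (t : tree) : R := tprod w t.

Definition Zn (w : nat -> R) (n : nat) : R :=
  Rsum (map (tweight w) (trees_of_size n)).

Definition law_Tn (w : nat -> R) (n k : nat) (x : outcome) : R :=
  Rsum (map (fun t => tweight w t / Zn w n *
                      (Rsum (map (fun v => ind (Hk k t v = x)) (vertices t)) / INR n))
            (trees_of_size n)).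

Definition gw_prob (w : nat -> R) (tau Phi : R) (t : tree) : R := tprod (pxi w tau Phi) t.

(* Probability that the fringe subtree of T* at u_k, pointed at u_0, equals (s, p)
   where length p = k: built along the spine following the construction of T*:
   the vertex u_i (i >= 1) has hat-xi children, u_{i-1} is the j-th one with
   probability 1/d, the others are independent GW trees; u_0 roots a GW tree. *)
Fixpoint star_prob (w : nat -> R) (tau Phi : R) (s : tree) (p : list nat) : R :=
  match p with
  | [] => gw_prob w tau Phi s
  | j :: p' =>
      let ts := children s in
      let d := length ts in
      match nth_error ts j with
      | None => 0
      | Some u =>
          pxihat w tau Phi d * / INR d *
          Rprod (map (gw_prob w tau Phi) (firstn j ts ++ skipn (S j) ts)) *
          star_prob w tau Phi u p'
      end
  end.

Definition law_Tstar (w : nat -> R) (tau Phi : R) (k : nat) (x : outcome) : R :=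
  match x with
  | None => 0
  | Some (s, p) => if Nat.eqb (length p) k then star_prob w tau Phi s p else 0
  end.

(* d_TV(P, Q) <= e, with d_TV(P,Q) = (1/2) sum_x |P(x) - Q(x)| over the
   countable outcome space (sum of nonnegative terms = sup of finite sums). *)
Definition tv_le (P Q : outcome -> R) (e : R) : Prop :=
  forall L : list outcome, NoDup L ->
    / 2 * Rsum (map (fun x => Rabs (P x - Q x)) L) <= e.

(* Main.v *)
(** A vertex [v] at height at least [k] with [H_k(T, v) = (s, x)] is determined by the root of
    the corresponding copy of [s] in [T], so the law of [H_k(T_n, v_0)] at [(s, x)] is [1/n]
    times the expected number of fringe subtrees of [T_n] equal to [s].  By the cycle lemma this
    is [P(T = s) P(S_{n-m} = n-m) / P(S_n = n-1)], where [m] is the size of [s] and [S_j] is a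
    sum of [j] independent copies of [xi], whereas the law of [H_k(T*, u_0)] at [(s, x)] is
    [P(T = s)].  A local limit estimate shows that the ratio is at least [1 - delta] when
    [m <= eta n], and the size-biased tree [H_k(T*, u_0)] has size [O(k^2) = o(n)] in
    probability, by a generating function computation.  A one-sided comparison on a set of mass
    close to one bounds the total variation distance.

    The local limit estimate compares Fourier integrals of powers of the characteristic function
    [chi] of [xi - 1]: [|chi(t)|^N] is at most [exp(-c N t^2)] on [[0, pi/d]], so passing from
    time [n] to time [n - m] changes the integral by [O(m n^{-3/2} + n^{-1})], while the integral
    at time [n] itself is of order [n^{-1/2}].  The weights are truncated at a large [K], which
    does not affect the probabilities in question and makes every sum finite. *)

From Stdlib Require Import Reals Lra Lia Arith ZArith ClassicalEpsilon Classical.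
From Coquelicot Require Import Coquelicot.
From Stdlib Require Import List Permutation.
Require Import Defs.
Import ListNotations.
Open Scope R_scope.

(** * Finite sums over lists *)

(** Both laws have mass at most one, so missing mass on one side forces the error on the other.
    Hence no asymptotic equality in the local limit theorem is needed: a lower bound for P(S_n =
    n-1) and a difference of smaller order suffice. The size estimate rests on the square-root
    singularity of the total progeny. Let z = 1 - 1/M, y = E[z^|T|] and let G be the offspring
    generating function. In y = z G(y) the terms linear in 1 - y cancel, since the mean is one, so 1
    - y = O(M^{-1/2}). Finite variance then gives z G'(y) >= 1 - O(M^{-1/2}), and E[Z_k z^|T|], with
    Z_k the size of generation k, is bounded below by the k-th power of this factor times y. Trees
    of size at most M thus carry size-biased mass 1 - O((k+1) M^{-1/2}), and k_n = o(n^{1/2}) allows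
    M to be a small fixed fraction of n. The span d enters twice: a tree of positive weight has size
    1 modulo d, which places n - m on the lattice of S_{n-m}, and the lattice reduces Fourier
    integrals to [0, pi/d], where |chi| is near one only near 0. *)

Definition lsum {A : Type} (f : A -> R) (L : list A) : R := Rsum (map f L).

Lemma lsum_nil {A} (f : A -> R) : lsum f [] = 0.
Proof. reflexivity. Qed.

Lemma lsum_cons {A} (f : A -> R) x L : lsum f (x :: L) = f x + lsum f L.
Proof. reflexivity. Qed.

Lemma lsum_app {A} (f : A -> R) L1 L2 : lsum f (L1 ++ L2) = lsum f L1 + lsum f L2.
Proof.
  induction L1 as [|x L1 IH]; simpl app; rewrite ?lsum_cons, ?lsum_nil, ?IH; lra.
Qed.

Lemma lsum_ext {A} (f g : A -> R) L :
  (forall x, In x L -> f x = g x) -> lsum f L = lsum g L.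
Proof.
  induction L as [|x L IH]; intros H; [reflexivity|].
  rewrite !lsum_cons, (H x (or_introl eq_refl)), IH; [reflexivity|].
  intros y Hy; apply H; right; exact Hy.
Qed.

Lemma lsum_le {A} (f g : A -> R) L :
  (forall x, In x L -> f x <= g x) -> lsum f L <= lsum g L.
Proof.
  induction L as [|x L IH]; intros H; [apply Rle_refl|].
  rewrite !lsum_cons. apply Rplus_le_compat.
  - apply H; left; reflexivity.
  - apply IH; intros y Hy; apply H; right; exact Hy.
Qed.

Lemma lsum_const0 {A} (L : list A) : lsum (fun _ => 0) L = 0.
Proof. induction L as [|x L IH]; rewrite ?lsum_cons, ?IH; [reflexivity|lra]. Qed.

Lemma lsum_eq0 {A} (f : A -> R) L : (forall x, In x L -> f x = 0) -> lsum f L = 0.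
Proof. intros H; rewrite (lsum_ext f (fun _ => 0) L H); apply lsum_const0. Qed.

Lemma lsum_nonneg {A} (f : A -> R) L : (forall x, In x L -> 0 <= f x) -> 0 <= lsum f L.
Proof. intros H; rewrite <- (lsum_const0 L); apply lsum_le; exact H. Qed.

Lemma lsum_plus {A} (f g : A -> R) L : lsum (fun x => f x + g x) L = lsum f L + lsum g L.
Proof.
  induction L as [|x L IH]; [rewrite !lsum_nil; lra|].
  rewrite !lsum_cons, IH; lra.
Qed.

Lemma lsum_scal {A} c (f : A -> R) L : lsum (fun x => c * f x) L = c * lsum f L.
Proof.
  induction L as [|x L IH]; [rewrite !lsum_nil; lra|].
  rewrite !lsum_cons, IH; lra.
Qed.

Lemma lsum_minus {A} (f g : A -> R) L : lsum (fun x => f x - g x) L = lsum f L - lsum g L.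
Proof.
  induction L as [|x L IH]; [rewrite !lsum_nil; lra|].
  rewrite !lsum_cons, IH; lra.
Qed.

Lemma lsum_abs {A} (f : A -> R) L : Rabs (lsum f L) <= lsum (fun x => Rabs (f x)) L.
Proof.
  induction L as [|x L IH]; [rewrite !lsum_nil, Rabs_R0; lra|].
  rewrite !lsum_cons. eapply Rle_trans; [apply Rabs_triang|]. lra.
Qed.

Lemma lsum_map {A B} (f : B -> R) (g : A -> B) L :
  lsum f (map g L) = lsum (fun x => f (g x)) L.
Proof. unfold lsum; rewrite map_map; reflexivity. Qed.

Lemma lsum_flat_map {A B} (f : B -> R) (g : A -> list B) L :
  lsum f (flat_map g L) = lsum (fun x => lsum f (g x)) L.
Proof.
  induction L as [|x L IH]; [reflexivity|].
  simpl flat_map; rewrite lsum_app, lsum_cons, IH; reflexivity.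
Qed.

Lemma lsum_filter {A} (f : A -> R) b L :
  lsum f (filter b L) = lsum (fun x => if b x then f x else 0) L.
Proof.
  induction L as [|x L IH]; [reflexivity|].
  rewrite lsum_cons; simpl; destruct (b x); rewrite ?lsum_cons, IH; lra.
Qed.

Lemma lsum_swap {A B} (f : A -> B -> R) LA LB :
  lsum (fun a => lsum (f a) LB) LA = lsum (fun b => lsum (fun a => f a b) LA) LB.
Proof.
  induction LA as [|a LA IH].
  - rewrite lsum_nil; symmetry; apply lsum_eq0; intros; reflexivity.
  - rewrite lsum_cons, IH, <- lsum_plus; apply lsum_ext; intros; rewrite lsum_cons; reflexivity.
Qed.

Lemma lsum_perm {A} (f : A -> R) L1 L2 : Permutation L1 L2 -> lsum f L1 = lsum f L2.
Proof.
  induction 1; rewrite ?lsum_cons; lra.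
Qed.

(** Stands in for monotonicity of sums over the countable outcome space. Each entry of [L1] with a
    nonzero value is cancelled against one position of [L2], so repetitions in [L2] do no harm. *)
Lemma lsum_incl {A} (f : A -> R) L1 L2 :
  NoDup L1 -> (forall x, 0 <= f x) -> (forall x, In x L1 -> f x <> 0 -> In x L2) ->
  lsum f L1 <= lsum f L2.
Proof.
  intros Hnd Hf; revert L2; induction L1 as [|x L1 IH]; intros L2 Hi.
  - rewrite lsum_nil; apply lsum_nonneg; auto.
  - inversion Hnd as [|? ? Hx Hnd']; subst.
    rewrite lsum_cons.
    destruct (Req_dec (f x) 0) as [E|E].
    + rewrite E, Rplus_0_l; apply IH; auto; intros y Hy; apply Hi; right; exact Hy.
    + destruct (in_split x L2 (Hi x (or_introl eq_refl) E)) as (A1 & A2 & ->).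
      rewrite lsum_app, lsum_cons.
      assert (H : lsum f L1 <= lsum f (A1 ++ A2)).
      { apply IH; auto; intros y Hy Hy0.
        assert (Hy2 := Hi y (or_intror Hy) Hy0).
        rewrite in_app_iff in *; simpl in Hy2.
        destruct Hy2 as [|[->|]]; auto; contradiction. }
      rewrite lsum_app in H; lra.
Qed.

Lemma lsum_seq_S (f : nat -> R) n : lsum f (seq 0 (S n)) = lsum f (seq 0 n) + f n.
Proof.
  rewrite seq_S, lsum_app, lsum_cons, lsum_nil; simpl; lra.
Qed.

Lemma lsum_seq_0 (f : nat -> R) n :
  lsum f (seq 0 (S n)) = f 0%nat + lsum (fun k => f (S k)) (seq 0 n).
Proof. simpl seq; rewrite lsum_cons, <- seq_shift, lsum_map; reflexivity. Qed.

Lemma lsum_seq_sum_f_R0 (f : nat -> R) n : lsum f (seq 0 (S n)) = sum_f_R0 f n.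
Proof.
  induction n as [|n IH].
  - simpl seq; rewrite lsum_cons, lsum_nil; simpl; lra.
  - rewrite lsum_seq_S, IH; reflexivity.
Qed.

Lemma lsum_seq_extend (f : nat -> R) m n :
  (m <= n)%nat -> (forall k, (m <= k < n)%nat -> f k = 0) ->
  lsum f (seq 0 n) = lsum f (seq 0 m).
Proof.
  intros Hmn Hf; replace n with (m + (n - m))%nat by lia.
  rewrite seq_app, lsum_app, (lsum_eq0 f (seq (0 + m) (n - m))); [lra|].
  intros k Hk; apply in_seq in Hk; apply Hf; lia.
Qed.

Lemma lsum_seq_mono (f : nat -> R) m n :
  (m <= n)%nat -> (forall k, 0 <= f k) -> lsum f (seq 0 m) <= lsum f (seq 0 n).
Proof.
  intros Hmn Hf; replace n with (m + (n - m))%nat by lia.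
  rewrite seq_app, lsum_app.
  assert (0 <= lsum f (seq (0 + m) (n - m))) by (apply lsum_nonneg; auto).
  lra.
Qed.

Lemma NoDup_flat_map {A B} (g : A -> list B) L :
  NoDup L -> (forall x, In x L -> NoDup (g x)) ->
  (forall x y z, In x L -> In y L -> In z (g x) -> In z (g y) -> x = y) ->
  NoDup (flat_map g L).
Proof.
  induction L as [|x L IH]; intros HL Hg Hd; [constructor|].
  inversion HL as [|? ? Hx HL']; subst; simpl.
  apply NoDup_app.
  - apply Hg; left; reflexivity.
  - apply IH; auto.
    + intros y Hy; apply Hg; right; exact Hy.
    + intros y y' z Hy Hy'; apply Hd; right; assumption.
  - intros z Hz Hz'; apply in_flat_map in Hz'; destruct Hz' as (y & Hy & Hz').
    assert (x = y) by (apply (Hd x y z); simpl; auto); subst; contradiction.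
Qed.

Lemma NoDup_map_inj {A B} (f : A -> B) L :
  (forall x y, In x L -> In y L -> f x = f y -> x = y) -> NoDup L -> NoDup (map f L).
Proof.
  induction L as [|x L IH]; intros Hf HL; [constructor|].
  inversion HL as [|? ? Hx HL']; subst; simpl; constructor.
  - rewrite in_map_iff; intros (y & Hy & HyL).
    assert (y = x) by (apply Hf; simpl; auto); subst; contradiction.
  - apply IH; auto; intros y z Hy Hz; apply Hf; right; assumption.
Qed.

Lemma ind_true (P : Prop) : P -> ind P = 1.
Proof. intros H; unfold ind; destruct (excluded_middle_informative P); tauto. Qed.

Lemma ind_false (P : Prop) : ~ P -> ind P = 0.
Proof. intros H; unfold ind; destruct (excluded_middle_informative P); tauto. Qed.

Lemma ind_ge0 (P : Prop) : 0 <= ind P.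
Proof. unfold ind; destruct (excluded_middle_informative P); lra. Qed.

Lemma ind_iff (P Q : Prop) : (P <-> Q) -> ind P = ind Q.
Proof.
  intros H; destruct (classic P).
  - rewrite !ind_true; tauto.
  - rewrite !ind_false; tauto.
Qed.

Lemma lsum_ind_NoDup_le {A} (L : list A) (a : A) : NoDup L -> lsum (fun x => ind (a = x)) L <= 1.
Proof.
  intros HL; replace 1 with (lsum (fun x => ind (a = x)) [a]).
  - apply lsum_incl; auto.
    + intros; apply ind_ge0.
    + intros x _ Hx; left; apply NNPP; intros H; apply Hx, ind_false, H.
  - rewrite lsum_cons, lsum_nil, ind_true; auto; lra.
Qed.

Lemma lsum_ind_NoDup {A} (L : list A) (a : A) :
  NoDup L -> In a L -> lsum (fun x => ind (a = x)) L = 1.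
Proof.
  intros HL Ha; apply Rle_antisym; [apply lsum_ind_NoDup_le; auto|].
  replace 1 with (lsum (fun x => ind (a = x)) [a]).
  - apply lsum_incl.
    + constructor; [simpl; tauto|constructor].
    + intros; apply ind_ge0.
    + intros x [<-|[]] _; exact Ha.
  - rewrite lsum_cons, lsum_nil, ind_true; auto; lra.
Qed.

(** On [G], |P - Q| <= P - Q + 2 del Q, whichever of the two is larger; off [G], |P - Q| <= P + Q.
    The [P] terms add up to the mass of [P] on a duplicate-free list, at most 1, and [Q] has mass at
    most [del] off [G]. The total is at most 1 - (1 - del) + del + 2 del = 4 del, and half of it is
    the bound. *)
Lemma tv_le_of_good_set (P Q : outcome -> R) (G : list outcome) (del : R) :
  (forall x, 0 <= P x) -> (forall x, 0 <= Q x) ->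
  (forall L, NoDup L -> lsum P L <= 1) -> (forall L, NoDup L -> lsum Q L <= 1) ->
  NoDup G -> 1 - del <= lsum Q G -> (forall x, In x G -> (1 - del) * Q x <= P x) ->
  0 <= del -> tv_le P Q (2 * del).
Proof.
  intros HP HQ HP1 HQ1 HG HQG HPG Hdel L HL.
  set (f := fun x => Rabs (P x - Q x)).
  set (L2 := filter (fun x => if excluded_middle_informative (In x G) then false else true) L).
  assert (HL2 : NoDup L2) by (apply NoDup_filter; exact HL).
  assert (Hdisj : forall x, In x L2 -> ~ In x G).
  { intros x Hx; apply filter_In in Hx; destruct Hx as [_ Hx].
    destruct (excluded_middle_informative (In x G)); congruence. }
  assert (HN : NoDup (G ++ L2)).
  { apply NoDup_app; auto; intros x Hx Hx2; apply (Hdisj x Hx2 Hx). }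
  assert (H1 : lsum f L <= lsum f (G ++ L2)).
  { apply lsum_incl; auto.
    - intros; apply Rabs_pos.
    - intros x Hx _; apply in_app_iff.
      destruct (excluded_middle_informative (In x G)) as [E|E]; [left; exact E|right].
      apply filter_In; split; auto.
      destruct (excluded_middle_informative (In x G)); [contradiction|reflexivity]. }
  assert (H2 : lsum f G <= lsum P G - lsum Q G + 2 * del * lsum Q G).
  { rewrite <- lsum_minus, <- lsum_scal, <- lsum_plus; apply lsum_le.
    intros x Hx; unfold f; specialize (HPG x Hx); specialize (HQ x).
    assert (0 <= del * Q x) by (apply Rmult_le_pos; auto).
    unfold Rabs; destruct (Rcase_abs (P x - Q x)); lra. }
  assert (H3 : lsum f L2 <= lsum P L2 + lsum Q L2).
  { rewrite <- lsum_plus; apply lsum_le; intros x _; unfold f.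
    specialize (HP x); specialize (HQ x).
    unfold Rabs; destruct (Rcase_abs (P x - Q x)); lra. }
  assert (HP' := HP1 _ HN); assert (HQ' := HQ1 _ HN).
  rewrite lsum_app in *.
  assert (HQG1 := HQ1 _ HG).
  assert (del * lsum Q G <= del * 1) by (apply Rmult_le_compat_l; auto).
  change (/ 2 * lsum f L <= 2 * del).
  lra.
Qed.

(** * Plane trees and their vertices *)

(** [tree] is nested through [list], so the generated induction principle has no hypothesis about
    the children. *)
Fixpoint tree_forall_ind (P : tree -> Prop)
  (H : forall ts, Forall P ts -> P (Node ts)) (t : tree) : P t :=
  match t with
  | Node ts =>
      H ts ((fix go (l : list tree) : Forall P l :=
               match l with
               | [] => Forall_nil P
               | u :: l' => Forall_cons u (tree_forall_ind P H u) (go l')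
               end) ts)
  end.

Definition fsize (f : list tree) : nat := fold_right (fun u acc => (tsize u + acc)%nat) 0%nat f.

Definition fprod (p : nat -> R) (f : list tree) : R := fold_right (fun u acc => tprod p u * acc) 1 f.

Lemma tsize_Node ts : tsize (Node ts) = S (fsize ts).
Proof. reflexivity. Qed.

Lemma tprod_Node p ts : tprod p (Node ts) = p (length ts) * fprod p ts.
Proof. reflexivity. Qed.

Lemma tsize_pos t : (1 <= tsize t)%nat.
Proof. destruct t; rewrite tsize_Node; lia. Qed.

Lemma fsize_app f1 f2 : fsize (f1 ++ f2) = (fsize f1 + fsize f2)%nat.
Proof. induction f1 as [|u f1 IH]; simpl; [reflexivity|]; rewrite IH; lia. Qed.

Lemma length_le_fsize f : (length f <= fsize f)%nat.
Proof. induction f as [|u f IH]; simpl; [lia|]; assert (H := tsize_pos u); lia. Qed.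

Lemma fprod_app p f1 f2 : fprod p (f1 ++ f2) = fprod p f1 * fprod p f2.
Proof. induction f1 as [|u f1 IH]; simpl; [lra|]; rewrite IH; lra. Qed.

Lemma fprod_Rprod p f : Rprod (map (tprod p) f) = fprod p f.
Proof. induction f as [|u f IH]; simpl; [reflexivity|]; f_equal; exact IH. Qed.

Lemma tprod_nonneg p t : (forall k, 0 <= p k) -> 0 <= tprod p t.
Proof.
  intros Hp; induction t as [ts IH] using tree_forall_ind.
  rewrite tprod_Node; apply Rmult_le_pos; [apply Hp|].
  induction IH; simpl; [lra|apply Rmult_le_pos; assumption].
Qed.

Lemma trees_f_SS fuel m : trees_f (S fuel) (S m) = map Node (forests_f fuel m).
Proof. reflexivity. Qed.

Lemma forests_f_SS fuel m :
  forests_f (S fuel) (S m) =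
  flat_map (fun j => flat_map (fun t => map (cons t) (forests_f fuel (S m - j)))
                       (trees_f fuel j)) (seq 1 (S m)).
Proof. reflexivity. Qed.

Lemma trees_forests_f_sound fuel :
  (forall n t, In t (trees_f fuel n) -> tsize t = n) /\
  (forall m f, In f (forests_f fuel m) -> fsize f = m).
Proof.
  induction fuel as [|fuel [IHt IHf]]; [split; simpl; tauto|split].
  - intros [|m] t; [simpl; tauto|].
    rewrite trees_f_SS, in_map_iff; intros (f & <- & Hf).
    rewrite tsize_Node, (IHf m f Hf); reflexivity.
  - intros [|m] f.
    + simpl; intros [<-|[]]; reflexivity.
    + rewrite forests_f_SS, in_flat_map; intros (j & Hj & Hf).
      apply in_seq in Hj; rewrite in_flat_map in Hf; destruct Hf as (t & Ht & Hf).
      apply in_map_iff in Hf; destruct Hf as (f' & <- & Hf').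
      simpl; rewrite (IHt _ _ Ht); fold (fsize f'); rewrite (IHf _ _ Hf'); lia.
Qed.

(** The bounds 2n and 2m + 1 are preserved by the mutual recursion: opening a node costs one unit of
    fuel and one vertex, and splitting off the head of a forest costs one unit while the tail has at
    least one vertex fewer. *)
Lemma trees_forests_f_complete fuel :
  (forall t, (2 * tsize t <= fuel)%nat -> In t (trees_f fuel (tsize t))) /\
  (forall f, (2 * fsize f + 1 <= fuel)%nat -> In f (forests_f fuel (fsize f))).
Proof.
  induction fuel as [|fuel [IHt IHf]]; split.
  - intros t; assert (H := tsize_pos t); lia.
  - lia.
  - intros [ts]; rewrite tsize_Node, trees_f_SS; intros H.
    apply in_map, IHf; lia.
  - intros [|t f] H.
    + left; reflexivity.
    + assert (Ht := tsize_pos t).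
      change (fsize (t :: f)) with (tsize t + fsize f)%nat in *.
      destruct (tsize t + fsize f)%nat as [|m] eqn:E; [lia|].
      rewrite forests_f_SS, in_flat_map; exists (tsize t); split; [apply in_seq; lia|].
      rewrite in_flat_map; exists t; split; [apply IHt; lia|].
      apply in_map; replace (S m - tsize t)%nat with (fsize f) by lia; apply IHf; lia.
Qed.

Lemma trees_forests_f_NoDup fuel :
  (forall n, NoDup (trees_f fuel n)) /\ (forall m, NoDup (forests_f fuel m)).
Proof.
  induction fuel as [|fuel [IHt IHf]]; [split; constructor|split].
  - intros [|m]; [constructor|].
    rewrite trees_f_SS; apply NoDup_map_inj; auto; congruence.
  - intros [|m]; [repeat constructor; simpl; tauto|].
    rewrite forests_f_SS; apply NoDup_flat_map.
    + apply seq_NoDup.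
    + intros j _; apply NoDup_flat_map; auto.
      * intros t _; apply NoDup_map_inj; auto; congruence.
      * intros t t' f _ _ H H'; apply in_map_iff in H, H'.
        destruct H as (? & <- & _), H' as (? & E & _); congruence.
    + intros j j' f _ _ H H'; apply in_flat_map in H, H'.
      destruct H as (t & Ht & H), H' as (t' & Ht' & H').
      apply in_map_iff in H, H'.
      destruct H as (? & <- & _), H' as (? & E & _); injection E as -> _.
      rewrite <- (proj1 (trees_forests_f_sound fuel) _ _ Ht).
      apply (proj1 (trees_forests_f_sound fuel) _ _ Ht').
Qed.

Lemma in_trees_of_size n t : In t (trees_of_size n) <-> tsize t = n.
Proof.
  split; [apply trees_forests_f_sound|].
  intros <-; apply trees_forests_f_complete; lia.
Qed.

Lemma NoDup_trees_of_size n : NoDup (trees_of_size n).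
Proof. apply trees_forests_f_NoDup. Qed.

(** A named copy of the anonymous inner fixpoint of [vertices], so that induction on the list of
    children with a varying first index is possible. *)
Fixpoint vgo (i : nat) (l : list tree) : list (list (list nat)) :=
  match l with
  | [] => []
  | u :: l' => map (cons i) (vertices u) :: vgo (S i) l'
  end.

Lemma vertices_Node ts : vertices (Node ts) = [] :: concat (vgo 0 ts).
Proof. reflexivity. Qed.

Lemma in_vgo l : forall i v,
  In v (concat (vgo i l)) <->
  exists j u p, nth_error l j = Some u /\ v = (i + j)%nat :: p /\ In p (vertices u).
Proof.
  induction l as [|u l IH]; intros i v; simpl.
  - split; [tauto|]; intros ([|j] & u & p & H & _); discriminate.
  - rewrite in_app_iff, IH, in_map_iff; split.
    + intros [(p & <- & Hp)|(j & u' & p & Hj & -> & Hp)].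
      * exists 0%nat, u, p; repeat split; auto; f_equal; lia.
      * exists (S j), u', p; repeat split; auto; f_equal; lia.
    + intros ([|j] & u' & p & Hj & -> & Hp).
      * left; injection Hj as <-; exists p; split; auto; f_equal; lia.
      * right; exists j, u', p; repeat split; auto; f_equal; lia.
Qed.

Lemma in_vertices_cons ts j p :
  In (j :: p) (vertices (Node ts)) <->
  exists u, nth_error ts j = Some u /\ In p (vertices u).
Proof.
  rewrite vertices_Node; simpl; rewrite in_vgo; split.
  - intros [H|(j' & u & p' & Hj & E & Hp)]; [discriminate|].
    injection E as -> ->; exists u; auto.
  - intros (u & Hj & Hp); right; exists j, u, p; auto.
Qed.

Lemma nil_in_vertices t : In [] (vertices t).
Proof. destruct t; left; reflexivity. Qed.

Lemma NoDup_vertices t : NoDup (vertices t).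
Proof.
  induction t as [ts IH] using tree_forall_ind.
  rewrite vertices_Node; constructor.
  - rewrite in_vgo; intros (j & u & p & _ & E & _); discriminate.
  - generalize 0%nat as i; induction IH as [|u l Hu Hl IHl]; intros i; simpl; [constructor|].
    apply NoDup_app; auto.
    + apply NoDup_map_inj; auto; congruence.
    + intros v Hv; rewrite in_vgo; intros (j & u' & p & _ & -> & _).
      apply in_map_iff in Hv; destruct Hv as (p' & E & _); injection E; lia.
Qed.

Lemma length_vertices t : length (vertices t) = tsize t.
Proof.
  induction t as [ts IH] using tree_forall_ind.
  rewrite vertices_Node, tsize_Node; simpl; f_equal.
  generalize 0%nat as i; induction IH as [|u l Hu Hl IHl]; intros i; simpl; [reflexivity|].
  rewrite length_app, length_map, IHl, Hu; reflexivity.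
Qed.

(** The size bias cancels against the uniform choice of the spine child: [pxihat d / d] is [pxi d].
    The factors along the spine therefore reassemble to the Galton-Watson weight, whatever the
    pointed vertex. *)
Lemma star_prob_eq w tau Phi p : forall s,
  star_prob w tau Phi s p = ind (In p (vertices s)) * gw_prob w tau Phi s.
Proof.
  induction p as [|j p IH]; intros [ts].
  - rewrite (ind_true _ (nil_in_vertices _)); simpl; lra.
  - simpl star_prob; destruct (nth_error ts j) as [u|] eqn:E.
    + rewrite IH.
      rewrite (ind_iff (In (j :: p) (vertices (Node ts))) (In p (vertices u))).
      2:{ rewrite in_vertices_cons; split; [|eauto].
          intros (u' & E' & H); congruence. }
      destruct (nth_error_split _ _ E) as (l1 & l2 & -> & <-).
      rewrite firstn_app, firstn_all, Nat.sub_diag, firstn_O, app_nil_r.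
      (* [simpl] has unfolded [skipn] by one step; it is folded back so that [skipn_app] applies. *)
      change (match l1 ++ u :: l2 with [] => [] | _ :: l => skipn (length l1) l end)
        with (skipn (S (length l1)) (l1 ++ u :: l2)).
      replace (skipn (S (length l1)) (l1 ++ u :: l2)) with l2.
      2:{ rewrite skipn_app, skipn_all2 by lia.
          replace (S (length l1) - length l1)%nat with 1%nat by lia; reflexivity. }
      unfold gw_prob; rewrite fprod_Rprod, tprod_Node, !fprod_app.
      change (fprod (pxi w tau Phi) (u :: l2)) with
        (tprod (pxi w tau Phi) u * fprod (pxi w tau Phi) l2).
      unfold pxihat; field.
      rewrite length_app; simpl length; apply not_0_INR; lia.
    + rewrite ind_false; [lra|].
      rewrite in_vertices_cons; intros (u & E' & _); congruence.
Qed.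

(* [occ s t] is the number of vertices of [t] whose fringe subtree is [s]. *)
Fixpoint occ (s t : tree) : R :=
  match t with
  | Node ts => ind (t = s) + fold_right (fun u acc => occ s u + acc) 0 ts
  end.

Lemma occ_Node s ts : occ s (Node ts) = ind (Node ts = s) + lsum (occ s) ts.
Proof.
  simpl; f_equal; induction ts as [|u ts IH]; [reflexivity|].
  simpl; rewrite lsum_cons, IH; reflexivity.
Qed.

(** * Occurrences of a fringe subtree *)

Lemma Hk_short k t v : (length v < k)%nat -> Hk k t v = None.
Proof. intros H; unfold Hk; apply Nat.ltb_lt in H; rewrite H; reflexivity. Qed.

Lemma Hk_exact k t v : length v = k -> Hk k t v = Some (t, v).
Proof.
  intros <-; unfold Hk; rewrite Nat.ltb_irrefl, Nat.sub_diag; reflexivity.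
Qed.

Lemma Hk_cons k ts i u v :
  nth_error ts i = Some u -> (k <= length v)%nat -> Hk k (Node ts) (i :: v) = Hk k u v.
Proof.
  intros Hu H; unfold Hk; simpl length.
  rewrite (proj2 (Nat.ltb_ge _ _)) by lia; rewrite (proj2 (Nat.ltb_ge _ _)) by lia.
  replace (S (length v) - k)%nat with (S (length v - k)) by lia.
  simpl; rewrite Hu; reflexivity.
Qed.

(** Either the [k]-th ancestor lies in the child [u], where both trees see the same fringe subtree,
    or the vertex has height exactly [k] and its ancestor is the root. The lengths make the two
    cases exclusive. *)
Lemma ind_Hk_cons k ts i u v s p :
  nth_error ts i = Some u -> length p = k ->
  ind (Hk k (Node ts) (i :: v) = Some (s, p)) =
  ind (Node ts = s /\ i :: v = p) + ind (Hk k u v = Some (s, p)).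
Proof.
  intros Hu Hp; destruct (le_lt_dec k (length v)) as [H|H].
  - rewrite (Hk_cons _ _ _ _ _ Hu H), (ind_false (_ /\ _)); [lra|].
    intros [_ <-]; simpl in Hp; lia.
  - rewrite (Hk_short k u v H), (ind_false ((None : outcome) = Some (s, p))) by discriminate.
    rewrite Rplus_0_r; destruct (Nat.eq_dec (length (i :: v)) k) as [E|E].
    + rewrite (Hk_exact _ _ _ E); apply ind_iff; split.
      * intros E'; injection E'; auto.
      * intros [-> ->]; reflexivity.
    + rewrite Hk_short by (simpl in *; lia).
      rewrite !ind_false; [reflexivity|intros [_ <-]; contradiction|discriminate].
Qed.

Lemma count_Hk k s p t :
  In p (vertices s) -> length p = k ->
  lsum (fun v => ind (Hk k t v = Some (s, p))) (vertices t) = occ s t.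
Proof.
  intros Hps Hp; induction t as [ts IH] using tree_forall_ind.
  (* The share of the root is kept spread over all vertices [v], because [p] may be the root or lie
     below any child. It is reassembled at the end, where [p] occurs exactly once among the vertices
     of [s]. *)
  assert (Hgo : forall l i, (forall j, nth_error ts (i + j) = nth_error l j) ->
    Forall (fun t => lsum (fun v => ind (Hk k t v = Some (s, p))) (vertices t) = occ s t) l ->
    lsum (fun v => ind (Hk k (Node ts) v = Some (s, p))) (concat (vgo i l)) =
    lsum (fun v => ind (Node ts = s /\ v = p)) (concat (vgo i l)) + lsum (occ s) l).
  { intros l; induction l as [|u l IHl]; intros i Hi Hl; [simpl; rewrite !lsum_nil; lra|].
    inversion Hl as [|? ? Hu Hl']; subst.
    simpl; rewrite !lsum_app, !lsum_map, lsum_cons, IHl; auto.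
    2:{ intros j; specialize (Hi (S j)); simpl in Hi; rewrite <- Hi; f_equal; lia. }
    assert (Hiu : nth_error ts i = Some u) by (rewrite <- (Nat.add_0_r i), Hi; reflexivity).
    rewrite (lsum_ext _ (fun v => ind (Node ts = s /\ i :: v = p) +
                                  ind (Hk (length p) u v = Some (s, p)))).
    2:{ intros v _; apply ind_Hk_cons; auto. }
    rewrite lsum_plus, Hu; lra. }
  rewrite vertices_Node, lsum_cons, (Hgo ts 0%nat), occ_Node; auto.
  assert (E : ind (Hk k (Node ts) [] = Some (s, p)) = ind (Node ts = s /\ [] = p)).
  { destruct k as [|k].
    - rewrite (Hk_exact 0 _ []) by reflexivity; apply ind_iff; split.
      + intros E'; injection E'; auto.
      + intros [-> ->]; reflexivity.
    - rewrite Hk_short by (simpl; lia).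
      rewrite !ind_false; [reflexivity|intros [_ <-]; discriminate|discriminate]. }
  rewrite E, <- Rplus_assoc; f_equal.
  transitivity (lsum (fun v => ind (Node ts = s /\ v = p)) (vertices (Node ts)));
    [rewrite vertices_Node, lsum_cons; reflexivity|].
  destruct (classic (Node ts = s)) as [Es|Es].
  - rewrite (ind_true _ Es).
    rewrite (lsum_ext _ (fun v => ind (p = v))).
    + apply lsum_ind_NoDup; [apply NoDup_vertices|rewrite Es; exact Hps].
    + intros v _; apply ind_iff; intuition.
  - rewrite (ind_false _ Es); apply lsum_eq0; intros v _; apply ind_false; tauto.
Qed.

(** * Counting forests by the cycle lemma *)

(* [conv p N x] is the probability that [N] independent variables of law [p] sum to [x]. *)
Fixpoint conv (p : nat -> R) (N x : nat) : R :=
  match N with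
  | O => if Nat.eqb x 0 then 1 else 0
  | S N' => lsum (fun k => p k * conv p N' (x - k)) (seq 0 (S x))
  end.

Lemma conv_S p N x : conv p (S N) x = lsum (fun k => p k * conv p N (x - k)) (seq 0 (S x)).
Proof. reflexivity. Qed.

Lemma lsum_triangle (f : nat -> nat -> R) x :
  lsum (fun k => lsum (fun j => f k j) (seq 0 (S (x - k)))) (seq 0 (S x)) =
  lsum (fun j => lsum (fun k => f k j) (seq 0 (S (x - j)))) (seq 0 (S x)).
Proof.
  assert (H : forall g : nat -> nat -> R,
    lsum (fun k => lsum (fun j => g k j) (seq 0 (S (x - k)))) (seq 0 (S x)) =
    lsum (fun k => lsum (fun j => if (k + j <=? x)%nat then g k j else 0) (seq 0 (S x)))
      (seq 0 (S x))).
  { intros g; apply lsum_ext; intros k Hk; apply in_seq in Hk.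
    rewrite (lsum_seq_extend _ (S (x - k)) (S x)).
    - apply lsum_ext; intros j Hj; apply in_seq in Hj.
      rewrite (proj2 (Nat.leb_le _ _)) by lia; reflexivity.
    - lia.
    - intros j Hj; rewrite (proj2 (Nat.leb_gt _ _)) by lia; reflexivity. }
  rewrite (H f), (H (fun j k => f k j)), lsum_swap.
  apply lsum_ext; intros k _; apply lsum_ext; intros j _; rewrite Nat.add_comm; reflexivity.
Qed.

(* By exchangeability each of the [N + 1] summands contributes the same amount to [x]. *)
Lemma conv_exchange p N : forall x,
  INR (S N) * lsum (fun k => INR k * p k * conv p N (x - k)) (seq 0 (S x)) =
  INR x * conv p (S N) x.
Proof.
  induction N as [|N IH]; intros x.
  - simpl INR; rewrite Rmult_1_l, conv_S, !lsum_seq_S, Nat.sub_diag.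
    rewrite !lsum_eq0.
    + simpl; lra.
    + intros k Hk; apply in_seq in Hk; simpl conv.
      rewrite (proj2 (Nat.eqb_neq _ _)) by lia; lra.
    + intros k Hk; apply in_seq in Hk; simpl conv.
      rewrite (proj2 (Nat.eqb_neq _ _)) by lia; lra.
  - set (A := lsum (fun k => INR k * p k * conv p (S N) (x - k)) (seq 0 (S x))).
    (* The target is written as k + (x - k), with k the first summand. The first part gives [A]; for
       the second, the induction hypothesis and an exchange of the two sums give [INR (S N)] times
       [A]. *)
    assert (E1 : INR x * conv p (S (S N)) x =
      A + lsum (fun k => p k * (INR (x - k) * conv p (S N) (x - k))) (seq 0 (S x))).
    { unfold A; rewrite (conv_S p (S N)), <- lsum_scal, <- lsum_plus.
      apply lsum_ext; intros k Hk; apply in_seq in Hk.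
      rewrite minus_INR by lia; ring. }
    assert (E2 : lsum (fun k => p k * (INR (x - k) * conv p (S N) (x - k))) (seq 0 (S x)) =
      INR (S N) * A).
    { rewrite (lsum_ext _ (fun k => INR (S N) * lsum (fun j =>
        INR j * p j * (p k * conv p N (x - k - j))) (seq 0 (S (x - k))))).
      2:{ intros k _; rewrite <- IH, <- Rmult_assoc, (Rmult_comm (p k)), Rmult_assoc; f_equal.
          rewrite <- lsum_scal; apply lsum_ext; intros; ring. }
      rewrite lsum_scal; f_equal.
      rewrite (lsum_triangle (fun k j => INR j * p j * (p k * conv p N (x - k - j)))).
      apply lsum_ext; intros j _; rewrite lsum_scal, conv_S; f_equal.
      apply lsum_ext; intros k _; do 2 f_equal; lia. }
    rewrite E1, E2, (S_INR (S N)); ring.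
Qed.

(** The step shared by the two forest recursions: given that N + 1 summands add up to M - j, the
    first one has mean (M - j) / (N + 1), by exchangeability. The bound [L] is free since the terms
    vanish beyond M - j. *)
Lemma conv_step p N M j L :
  (M - j <= L)%nat ->
  INR (S N) * lsum (fun k => p k *
    (if (k + j <=? M)%nat then INR (k + j) * conv p N (M - (k + j)) else 0)) (seq 0 (S L)) =
  if (j <=? M)%nat then (INR (S N) * INR j + INR (M - j)) * conv p (S N) (M - j) else 0.
Proof.
  intros HL; destruct (Nat.leb_spec j M) as [Hj|Hj].
  - rewrite (lsum_seq_extend _ (S (M - j))) by
      (try lia; intros k Hk; rewrite (proj2 (Nat.leb_gt _ _)) by lia; ring).
    rewrite (lsum_ext _ (fun k => INR j * (p k * conv p N (M - j - k)) +
      INR k * p k * conv p N (M - j - k))).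
    + rewrite lsum_plus, lsum_scal, <- conv_S, Rmult_plus_distr_l, conv_exchange; ring.
    + intros k Hk; apply in_seq in Hk; rewrite (proj2 (Nat.leb_le _ _)) by lia.
      replace (M - (k + j))%nat with (M - j - k)%nat by lia; rewrite plus_INR; ring.
  - rewrite lsum_eq0; [ring|].
    intros k _; rewrite (proj2 (Nat.leb_gt _ _)) by lia; ring.
Qed.

(** [N] counts vertices and [j] counts trees. Deleting the first root, with its k children, leaves a
    forest with one vertex fewer whose first k trees are those children: one step of the depth-first
    walk. Unlike [forests_f], this enumeration turns the cycle lemma into an induction on [N]. *)
Fixpoint forests (N j : nat) : list (list tree) :=
  match N, j with
  | O, O => [[]]
  | O, S _ => []
  | S _, O => []
  | S N', S j' =>
      flat_map (fun k => map (fun f => Node (firstn k f) :: skipn k f) (forests N' (k + j')))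
        (seq 0 (S N'))
  end.

Lemma forests_SS N j : forests (S N) (S j) =
  flat_map (fun k => map (fun f => Node (firstn k f) :: skipn k f) (forests N (k + j)))
    (seq 0 (S N)).
Proof. reflexivity. Qed.

Lemma in_forests N : forall j f, In f (forests N j) <-> length f = j /\ fsize f = N.
Proof.
  induction N as [|N IH]; intros [|j] f.
  - simpl; split; [intros [<-|[]]; auto|].
    intros [H _]; destruct f; [auto|discriminate].
  - simpl; split; [tauto|]; intros [H H']; destruct f as [|t f]; [discriminate|].
    simpl in H'; assert (H2 := tsize_pos t); lia.
  - simpl; split; [tauto|]; intros [H H']; destruct f; discriminate.
  - rewrite forests_SS, in_flat_map; split.
    + intros (k & Hk & Hf); apply in_map_iff in Hf; destruct Hf as (g & <- & Hg).
      apply IH in Hg; destruct Hg as [Hl Hs].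
      assert (E : fsize g = (fsize (firstn k g) + fsize (skipn k g))%nat)
        by (rewrite <- fsize_app, firstn_skipn; reflexivity).
      split; [simpl; rewrite length_skipn; lia|].
      change (tsize (Node (firstn k g)) + fsize (skipn k g) = S N)%nat.
      rewrite tsize_Node; lia.
    + intros [Hl Hs]; destruct f as [|[ts] f]; [discriminate|].
      change (tsize (Node ts) + fsize f = S N)%nat in Hs; rewrite tsize_Node in Hs.
      assert (H := length_le_fsize ts); simpl in Hl.
      exists (length ts); split; [apply in_seq; lia|].
      apply in_map_iff; exists (ts ++ f); split.
      * rewrite firstn_app, skipn_app, firstn_all, skipn_all, Nat.sub_diag; simpl.
        rewrite app_nil_r; reflexivity.
      * apply IH; rewrite length_app, fsize_app; lia.
Qed.

Lemma NoDup_forests N : forall j, NoDup (forests N j).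
Proof.
  induction N as [|N IH]; intros [|j]; try (repeat constructor; simpl; tauto).
  rewrite forests_SS; apply NoDup_flat_map.
  - apply seq_NoDup.
  - intros k _; apply NoDup_map_inj; auto.
    intros f g _ _ E; injection E as E1 E2.
    rewrite <- (firstn_skipn k f), E1, E2; apply firstn_skipn.
  - intros k k' f _ _ H H'; apply in_map_iff in H, H'.
    destruct H as (g & <- & Hg), H' as (g' & E & Hg').
    apply in_forests in Hg, Hg'; injection E as E _.
    apply (f_equal (@length tree)) in E; rewrite !length_firstn in E; lia.
Qed.

Lemma forests_one n : Permutation (map (fun t => [t]) (trees_of_size n)) (forests n 1).
Proof.
  apply NoDup_Permutation.
  - apply NoDup_map_inj; [congruence|apply NoDup_trees_of_size].
  - apply NoDup_forests.
  - intros f; rewrite in_map_iff, in_forests; split.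
    + intros (t & <- & Ht); apply in_trees_of_size in Ht; simpl; split; lia.
    + intros [H1 H2]; destruct f as [|t [|]]; try discriminate.
      exists t; split; auto; apply in_trees_of_size; simpl in H2; lia.
Qed.

Lemma lsum_forests_SS (h : list tree -> R) N j :
  lsum h (forests (S N) (S j)) =
  lsum (fun k => lsum (fun f => h (Node (firstn k f) :: skipn k f)) (forests N (k + j)))
    (seq 0 (S N)).
Proof.
  rewrite forests_SS, lsum_flat_map; apply lsum_ext; intros; rewrite lsum_map; reflexivity.
Qed.

Lemma fprod_graft p k N j f : In f (forests N (k + j)) ->
  fprod p (Node (firstn k f) :: skipn k f) = p k * fprod p f.
Proof.
  intros Hf; apply in_forests in Hf; destruct Hf as [Hf _].
  change (tprod p (Node (firstn k f)) * fprod p (skipn k f) = p k * fprod p f).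
  rewrite tprod_Node, length_firstn, Rmult_assoc, <- fprod_app, firstn_skipn.
  rewrite Nat.min_l by lia; reflexivity.
Qed.

(** The Otter-Dwass formula: j independent trees have N vertices in total with probability (j / N)
    P(S_N = N - j). Deleting the first root gives a recursion in N, which [conv_step] solves. The
    factor N stays on the left so that N = 0 needs no division. *)
Lemma forests_weight p N : forall j,
  INR N * lsum (fprod p) (forests N j) =
  if (j <=? N)%nat then INR j * conv p N (N - j) else 0.
Proof.
  induction N as [|N IH]; intros [|j].
  - simpl; lra.
  - simpl; lra.
  - simpl; rewrite lsum_nil; lra.
  - rewrite lsum_forests_SS.
    rewrite (lsum_ext _ (fun k => p k * lsum (fprod p) (forests N (k + j)))).
    2:{ intros k _; rewrite <- lsum_scal; apply lsum_ext; intros f Hf.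
        apply (fprod_graft _ _ _ _ _ Hf). }
    destruct N as [|N].
    + rewrite lsum_seq_S; simpl seq; rewrite lsum_nil; destruct j as [|j]; simpl.
      * rewrite !lsum_cons, !lsum_nil; simpl; lra.
      * rewrite lsum_nil; lra.
    (* The induction hypothesis only determines the forest weights times [INR (S N)], so the goal is
       multiplied by that factor as well. *)
    + apply (Rmult_eq_reg_l (INR (S N))); [|apply not_0_INR; lia].
      rewrite <- Rmult_assoc, (Rmult_comm (INR (S N))), Rmult_assoc, <- lsum_scal.
      rewrite (lsum_ext _ (fun k => p k *
        (if (k + j <=? S N)%nat then INR (k + j) * conv p (S N) (S N - (k + j)) else 0))).
      2:{ intros k _; rewrite <- IH; ring. }
      rewrite conv_step by lia.
      change (S j <=? S (S N))%nat with (j <=? S N)%nat.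
      change (S (S N) - S j)%nat with (S N - j)%nat.
      destruct (Nat.leb_spec j (S N)); [|ring].
      rewrite minus_INR by lia; rewrite (S_INR (S N)), (S_INR j); ring.
Qed.

Definition head_is (s : tree) (f : list tree) : R :=
  match f with [] => 0 | t :: _ => ind (t = s) end.

Lemma forests_head_weight p s N j :
  lsum (fun f => fprod p f * head_is s f) (forests (S N) (S j)) =
  if (tsize s <=? S N)%nat then tprod p s * lsum (fprod p) (forests (S N - tsize s) j) else 0.
Proof.
  destruct (Nat.leb_spec (tsize s) (S N)) as [Hs|Hs].
  - set (b := fun f : list tree =>
      if excluded_middle_informative (hd_error f = Some s) then true else false).
    transitivity (lsum (fprod p) (filter b (forests (S N) (S j)))).
    { rewrite lsum_filter; apply lsum_ext; intros [|t f] _; unfold b, head_is, ind; simpl.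
      - destruct (excluded_middle_informative (None = Some s)); [discriminate|lra].
      - destruct (excluded_middle_informative (Some t = Some s)),
          (excluded_middle_informative (t = s)); try congruence; lra. }
    rewrite (lsum_perm _ _ (map (cons s) (forests (S N - tsize s) j))).
    + rewrite lsum_map, <- lsum_scal; apply lsum_ext; reflexivity.
    + apply NoDup_Permutation.
      * apply NoDup_filter, NoDup_forests.
      * apply NoDup_map_inj; [congruence|apply NoDup_forests].
      * intros f; rewrite filter_In, in_forests, in_map_iff; unfold b; split.
        -- intros [[Hl Hsz] Hb]; destruct f as [|t f]; [discriminate|].
           destruct (excluded_middle_informative _) as [E|]; [|discriminate].
           injection E as ->; exists f; split; auto.
           apply in_forests; change (tsize s + fsize f = S N)%nat in Hsz; simpl in Hl; lia.
        -- intros (g & <- & Hg); apply in_forests in Hg; destruct Hg as [Hl Hsz].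
           change (fsize (s :: g)) with (tsize s + fsize g)%nat; simpl length.
           destruct (excluded_middle_informative _) as [E|E]; [|simpl in E; congruence].
           repeat split; lia.
  - apply lsum_eq0; intros [|t f] Hf; [simpl; lra|].
    unfold head_is; rewrite ind_false; [lra|intros ->].
    apply in_forests in Hf; destruct Hf as [_ Hf].
    change (tsize s + fsize f = S N)%nat in Hf; lia.
Qed.

Definition marked_weight p s N j :=
  lsum (fun f => fprod p f * lsum (occ s) f) (forests N j).

(** Grafting a new root creates exactly one new fringe subtree, the one at that root, and keeps all
    others. The marked weight thus obeys the unmarked recursion with a source term. *)
Lemma marked_weight_SS p s N j :
  marked_weight p s (S N) (S j) =
  lsum (fun k => p k * marked_weight p s N (k + j)) (seq 0 (S N)) +
  lsum (fun f => fprod p f * head_is s f) (forests (S N) (S j)).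
Proof.
  unfold marked_weight; rewrite !lsum_forests_SS, <- lsum_plus.
  apply lsum_ext; intros k _; rewrite <- lsum_scal, <- lsum_plus.
  apply lsum_ext; intros f Hf; rewrite (fprod_graft _ _ _ _ _ Hf).
  rewrite lsum_cons, occ_Node.
  change (head_is s (Node (firstn k f) :: skipn k f)) with (ind (Node (firstn k f) = s)).
  replace (lsum (occ s) f) with (lsum (occ s) (firstn k f) + lsum (occ s) (skipn k f))
    by (rewrite <- lsum_app, firstn_skipn; reflexivity).
  ring.
Qed.

(** No denominator survives. With M = N - |s|, the marked copy of [s] acts as one extra leaf among M
    other outdegrees; the cycle lemma gives a factor j / (M + 1), and the leaf has M + 1 possible
    positions. Formally, induction on [N], with [forests_weight] supplying the source term. *)
Lemma marked_weight_eq p s N : forall j,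
  marked_weight p s N j =
  if (tsize s <=? N)%nat then
    (if (j <=? S (N - tsize s))%nat
     then tprod p s * (INR j * conv p (N - tsize s) (S (N - tsize s) - j)) else 0)
  else 0.
Proof.
  assert (Hpos := tsize_pos s).
  induction N as [|N IH]; intros [|j].
  - rewrite (proj2 (Nat.leb_gt _ _)) by lia; unfold marked_weight; simpl.
    rewrite lsum_cons, !lsum_nil; ring.
  - rewrite (proj2 (Nat.leb_gt _ _)) by lia; reflexivity.
  - unfold marked_weight; simpl forests; rewrite lsum_nil; change (INR 0) with 0.
    repeat match goal with |- context [if ?b then _ else _] => destruct b end; ring.
  - rewrite marked_weight_SS, forests_head_weight.
    destruct (Nat.leb_spec (tsize s) (S N)) as [Hs|Hs].
    2:{ rewrite lsum_eq0; [ring|]; intros k _; rewrite IH.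
        rewrite (proj2 (Nat.leb_gt _ _)) by lia; ring. }
    change (S j <=? S (S N - tsize s))%nat with (j <=? S N - tsize s)%nat.
    change (S (S N - tsize s) - S j)%nat with (S N - tsize s - j)%nat.
    destruct (Nat.eq_dec (tsize s) (S N)) as [E|E].
    (* Here [s] uses up all vertices, so smaller forests contribute nothing and only the head term
       is left. *)
    + rewrite E, Nat.sub_diag, lsum_eq0.
      2:{ intros k _; rewrite IH, (proj2 (Nat.leb_gt _ _)) by lia; ring. }
      destruct j as [|j]; simpl; rewrite ?lsum_cons, ?lsum_nil; simpl; ring.
    + destruct (S N - tsize s)%nat as [|M] eqn:EM; [lia|].
      assert (E' : (N - tsize s = M)%nat) by lia.
      rewrite (lsum_ext _ (fun k => tprod p s * (p k *
        (if (k + j <=? S M)%nat then INR (k + j) * conv p M (S M - (k + j)) else 0)))).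
      2:{ intros k _; rewrite IH, (proj2 (Nat.leb_le (tsize s) N)) by lia; rewrite E'.
          destruct (k + j <=? S M)%nat; ring. }
      rewrite lsum_scal.
      assert (HM : INR (S M) <> 0) by (apply not_0_INR; lia).
      apply (Rmult_eq_reg_l (INR (S M))); [|exact HM].
      rewrite Rmult_plus_distr_l.
      rewrite <- (Rmult_assoc (INR (S M)) (tprod p s) (lsum (fprod p) _)).
      rewrite (Rmult_comm (INR (S M)) (tprod p s)), !Rmult_assoc, forests_weight.
      rewrite <- (Rmult_assoc (INR (S M)) (tprod p s)), (Rmult_comm (INR (S M)) (tprod p s)).
      rewrite Rmult_assoc, conv_step by lia.
      destruct (Nat.leb_spec j (S M)); [|ring].
      rewrite minus_INR by lia; rewrite (S_INR j); ring.
Qed.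

Lemma trees_weight p n : (1 <= n)%nat ->
  INR n * lsum (tprod p) (trees_of_size n) = conv p n (n - 1).
Proof.
  intros Hn; transitivity (INR n * lsum (fprod p) (forests n 1)).
  - f_equal; rewrite <- (lsum_perm _ _ _ (forests_one n)), lsum_map.
    apply lsum_ext; intros t _; simpl; ring.
  - rewrite forests_weight, (proj2 (Nat.leb_le _ _) Hn); simpl; ring.
Qed.

Lemma trees_occ_weight p s n : (tsize s <= n)%nat ->
  lsum (fun t => tprod p t * occ s t) (trees_of_size n) =
  tprod p s * conv p (n - tsize s) (n - tsize s).
Proof.
  intros Hs; transitivity (marked_weight p s n 1).
  - unfold marked_weight; rewrite <- (lsum_perm _ _ _ (forests_one n)), lsum_map.
    apply lsum_ext; intros t _; rewrite lsum_cons, lsum_nil; simpl; ring.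
  - rewrite marked_weight_eq, (proj2 (Nat.leb_le _ _) Hs).
    replace (S (n - tsize s) - 1)%nat with (n - tsize s)%nat by lia; simpl; ring.
Qed.

(** Exponential tilting: the outdegrees of a tree with m vertices sum to m - 1. The extra [tau] on
    the left avoids the exponent m - 1. *)
Lemma tprod_pxi w tau Phi t : tau <> 0 -> Phi <> 0 ->
  tprod (pxi w tau Phi) t * tau = tprod w t * (tau / Phi) ^ tsize t.
Proof.
  intros Ht HP; induction t as [ts IH] using tree_forall_ind.
  (* In a forest the outdegrees sum to the number of vertices minus the number of trees, which
     explains the factor [tau ^ length ts]. *)
  assert (Hf : fprod (pxi w tau Phi) ts * tau ^ length ts = fprod w ts * (tau / Phi) ^ fsize ts).
  { induction IH as [|u l Hu Hl IHl]; [simpl; ring|].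
    change (tprod (pxi w tau Phi) u * fprod (pxi w tau Phi) l * (tau * tau ^ length l) =
      tprod w u * fprod w l * (tau / Phi) ^ (tsize u + fsize l)).
    rewrite pow_add.
    transitivity ((tprod (pxi w tau Phi) u * tau) * (fprod (pxi w tau Phi) l * tau ^ length l));
      [ring|].
    rewrite Hu, IHl; ring. }
  rewrite !tprod_Node, tsize_Node; unfold pxi at 1.
  transitivity (w (length ts) * (tau / Phi) * (fprod (pxi w tau Phi) ts * tau ^ length ts)).
  - field; exact HP.
  - rewrite Hf; simpl; ring.
Qed.

(** Tilting multiplies the weights of all trees of size [n] by one constant [c], which cancels in
    the normalisation. *)
Lemma law_Tn_rescale w tau Phi n k x : 0 < tau -> 0 < Phi ->
  law_Tn w n k x = law_Tn (pxi w tau Phi) n k x.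
Proof.
  intros Ht HP.
  set (c := (tau / Phi) ^ n / tau).
  assert (Hc : c <> 0).
  { unfold c, Rdiv; apply Rmult_integral_contrapositive_currified.
    - apply pow_nonzero, Rmult_integral_contrapositive_currified; [lra|].
      apply Rinv_neq_0_compat; lra.
    - apply Rinv_neq_0_compat; lra. }
  assert (E : forall t, In t (trees_of_size n) ->
    tweight (pxi w tau Phi) t = c * tweight w t).
  { intros t Hn; apply in_trees_of_size in Hn.
    apply (Rmult_eq_reg_r tau); [|lra].
    unfold tweight; rewrite tprod_pxi by lra; rewrite Hn; unfold c; field; lra. }
  assert (EZ : Zn (pxi w tau Phi) n = c * Zn w n).
  { unfold Zn; fold (lsum (tweight (pxi w tau Phi)) (trees_of_size n)).
    fold (lsum (tweight w) (trees_of_size n)).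
    rewrite (lsum_ext _ _ _ E); apply lsum_scal. }
  unfold law_Tn; rewrite EZ.
  match goal with |- Rsum (map ?f _) = Rsum (map ?g _) =>
    change (lsum f (trees_of_size n) = lsum g (trees_of_size n)) end.
  apply lsum_ext; intros t Hn; rewrite (E t Hn); f_equal.
  unfold Rdiv; rewrite Rinv_mult, Rmult_assoc, (Rmult_comm c), Rmult_assoc.
  rewrite (Rmult_comm (/ c)), Rmult_assoc, Rinv_l by exact Hc; ring.
Qed.

(** * The law of the pointed fringe subtree of the conditioned tree *)

Lemma law_Tn_Some p n k s v :
  conv p n (n - 1) <> 0 -> (tsize s <= n)%nat -> In v (vertices s) -> length v = k ->
  law_Tn p n k (Some (s, v)) =
  tprod p s * conv p (n - tsize s) (n - tsize s) / conv p n (n - 1).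
Proof.
  intros Hq Hs Hv Hlen; assert (Hn : (1 <= n)%nat) by (assert (H := tsize_pos s); lia).
  assert (HnR : INR n <> 0) by (apply not_0_INR; lia).
  assert (HZ := trees_weight p n Hn).
  change (lsum (tprod p) (trees_of_size n)) with (Zn p n) in HZ.
  assert (HZ0 : Zn p n <> 0) by (intros E; apply Hq; rewrite <- HZ, E; ring).
  rewrite <- HZ, <- trees_occ_weight by exact Hs.
  transitivity (lsum (fun t => / (INR n * Zn p n) * (tprod p t * occ s t)) (trees_of_size n)).
  - unfold law_Tn.
    match goal with |- Rsum (map ?f _) = _ => change (Rsum (map f (trees_of_size n))) with
      (lsum f (trees_of_size n)) end.
    apply lsum_ext; intros t _.
    change (Rsum (map (fun v0 => ind (Hk k t v0 = Some (s, v))) (vertices t))) with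
      (lsum (fun v0 => ind (Hk k t v0 = Some (s, v))) (vertices t)).
    rewrite count_Hk by assumption; unfold tweight; field; auto.
  - rewrite lsum_scal; field; auto.
Qed.

Lemma law_Tn_nonneg p n k x : (forall i, 0 <= p i) -> 0 <= law_Tn p n k x.
Proof.
  intros Hp; unfold law_Tn.
  match goal with |- 0 <= Rsum (map ?f _) => change (0 <= lsum f (trees_of_size n)) end.
  apply lsum_nonneg; intros t _.
  assert (HZ : 0 <= Zn p n).
  { change (0 <= lsum (tweight p) (trees_of_size n)); apply lsum_nonneg.
    intros; apply tprod_nonneg, Hp. }
  (* [Zn p n] or [INR n] may be zero; the convention / 0 = 0 keeps the sign. *)
  assert (Hi : forall r, 0 <= r -> 0 <= / r).
  { intros r [Hr|<-]; [left; apply Rinv_0_lt_compat, Hr|rewrite Rinv_0; lra]. }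
  repeat apply Rmult_le_pos; auto using tprod_nonneg, pos_INR.
  change (0 <= lsum (fun v => ind (Hk k t v = x)) (vertices t)).
  apply lsum_nonneg; intros; apply ind_ge0.
Qed.

(** An inequality suffices for the comparison of laws and, with / 0 = 0, it also covers the
    degenerate cases [Zn p n = 0] and [n = 0]. *)
Lemma law_Tn_mass_le_1 p n k L : (forall i, 0 <= p i) -> NoDup L -> lsum (law_Tn p n k) L <= 1.
Proof.
  intros Hp HL.
  assert (Hi : forall r, 0 <= r -> 0 <= / r).
  { intros r [Hr|<-]; [left; apply Rinv_0_lt_compat, Hr|rewrite Rinv_0; lra]. }
  assert (HZ : 0 <= Zn p n).
  { change (0 <= lsum (tweight p) (trees_of_size n)); apply lsum_nonneg.
    intros; apply tprod_nonneg, Hp. }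
  assert (Hd : forall r, r / r <= 1).
  { intros r; destruct (Req_dec r 0) as [->|H]; [unfold Rdiv; lra|].
    unfold Rdiv; rewrite Rinv_r by exact H; lra. }
  apply Rle_trans with (lsum (fun t => tweight p t / Zn p n * 1) (trees_of_size n)).
  - unfold law_Tn; change (fun x => Rsum (map (fun t => tweight p t / Zn p n *
      (Rsum (map (fun v => ind (Hk k t v = x)) (vertices t)) / INR n)) (trees_of_size n)))
      with (fun x => lsum (fun t => tweight p t / Zn p n *
      (lsum (fun v => ind (Hk k t v = x)) (vertices t) / INR n)) (trees_of_size n)).
    rewrite lsum_swap; apply lsum_le; intros t Ht; rewrite lsum_scal.
    apply Rmult_le_compat_l.
    { apply Rmult_le_pos; auto; apply tprod_nonneg, Hp. }
    apply Rle_trans with (INR n / INR n); [|apply Hd].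
    unfold Rdiv; rewrite (lsum_ext _ (fun x => / INR n *
      lsum (fun v => ind (Hk k t v = x)) (vertices t))) by (intros; ring).
    rewrite lsum_scal, Rmult_comm; apply Rmult_le_compat_r; [apply Hi, pos_INR|].
    (* After the exchange each vertex [v] contributes at most one, since its single outcome occurs
       at most once in [L]. *)
    rewrite lsum_swap.
    apply in_trees_of_size in Ht; rewrite <- Ht, <- length_vertices.
    clear Ht; induction (vertices t) as [|v vs IH]; [simpl; rewrite lsum_nil; lra|].
    rewrite lsum_cons; simpl length; rewrite S_INR.
    assert (H := lsum_ind_NoDup_le L (Hk k t v) HL); lra.
  - rewrite (lsum_ext _ (fun t => / Zn p n * tweight p t)) by (intros; unfold Rdiv; ring).
    rewrite lsum_scal, Rmult_comm; apply Hd.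
Qed.

(** * Critical offspring laws *)

Record critical_law (p : nat -> R) (v : R) : Prop := {
  law_nonneg : forall k, 0 <= p k;
  law_zero : 0 < p 0%nat;
  law_branching : exists k, (2 <= k)%nat /\ 0 < p k;
  law_mass : infinite_sum p 1;
  law_mean : infinite_sum (fun k => INR k * p k) 1;
  law_var : infinite_sum (fun k => (INR k - 1) ^ 2 * p k) v }.

Lemma infinite_sum_partial_le f l K :
  (forall k, 0 <= f k) -> infinite_sum f l -> lsum f (seq 0 (S K)) <= l.
Proof.
  intros Hf Hl; apply Rnot_lt_le; intros H.
  destruct (Hl (lsum f (seq 0 (S K)) - l)) as [N HN]; [lra|].
  specialize (HN (max N K) (Nat.le_max_l _ _)).
  rewrite <- lsum_seq_sum_f_R0 in HN.
  assert (H2 := lsum_seq_mono f (S K) (S (max N K)) ltac:(lia) Hf).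
  unfold Rdist in HN; apply Rabs_def2 in HN; lra.
Qed.

Lemma infinite_sum_partial_ge f l e :
  (forall k, 0 <= f k) -> infinite_sum f l -> 0 < e ->
  exists K0, forall K, (K0 <= K)%nat -> l - e <= lsum f (seq 0 (S K)).
Proof.
  intros Hf Hl He; destruct (Hl e He) as [N HN]; exists N; intros K HK.
  specialize (HN K HK); rewrite <- lsum_seq_sum_f_R0 in HN.
  unfold Rdist in HN; apply Rabs_def2 in HN; lra.
Qed.

Lemma law_mean_nonneg p v : critical_law p v -> forall k, 0 <= INR k * p k.
Proof. intros H k; apply Rmult_le_pos; [apply pos_INR|apply (law_nonneg _ _ H)]. Qed.

Lemma law_var_nonneg p v : critical_law p v -> forall k, 0 <= (INR k - 1) ^ 2 * p k.
Proof. intros H k; apply Rmult_le_pos; [apply pow2_ge_0|apply (law_nonneg _ _ H)]. Qed.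

Lemma law_partial_le p v K : critical_law p v ->
  lsum p (seq 0 (S K)) <= 1 /\ lsum (fun k => INR k * p k) (seq 0 (S K)) <= 1 /\
  lsum (fun k => (INR k - 1) ^ 2 * p k) (seq 0 (S K)) <= v.
Proof.
  intros H; split; [|split]; apply infinite_sum_partial_le.
  - apply H.
  - apply H.
  - apply (law_mean_nonneg p v H).
  - apply H.
  - apply (law_var_nonneg p v H).
  - apply H.
Qed.

Lemma law_partial_ge p v e : critical_law p v -> 0 < e ->
  exists K0, forall K, (K0 <= K)%nat ->
  1 - e <= lsum p (seq 0 (S K)) /\ 1 - e <= lsum (fun k => INR k * p k) (seq 0 (S K)) /\
  v - e <= lsum (fun k => (INR k - 1) ^ 2 * p k) (seq 0 (S K)).
Proof.
  intros H He.
  destruct (infinite_sum_partial_ge p 1 e) as [K1 H1]; try apply H; auto.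
  destruct (infinite_sum_partial_ge _ _ e (law_mean_nonneg p v H) (law_mean p v H) He) as [K2 H2].
  destruct (infinite_sum_partial_ge _ _ e (law_var_nonneg p v H) (law_var p v H) He) as [K3 H3].
  exists (K1 + K2 + K3)%nat; intros K HK; repeat split; [apply H1|apply H2|apply H3]; lia.
Qed.

(** The atom at 0 has distance one from the mean and already contributes [p 0]. *)
Lemma law_var_pos p v : critical_law p v -> 0 < v.
Proof.
  intros H; destruct (law_partial_le p v 0 H) as (_ & _ & Hv).
  simpl seq in Hv; rewrite lsum_cons, lsum_nil in Hv; simpl in Hv.
  assert (H0 := law_zero p v H); lra.
Qed.

(** * Generation sizes of Galton-Watson trees *)

Fixpoint lists_of {A} (L : list A) (j : nat) : list (list A) :=
  match j with
  | O => [[]]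
  | S j' => flat_map (fun a => map (cons a) (lists_of L j')) L
  end.

Lemma in_lists_of {A} (L : list A) j : forall l,
  In l (lists_of L j) <-> length l = j /\ Forall (fun a => In a L) l.
Proof.
  induction j as [|j IH]; intros l; simpl.
  - split; [intros [<-|[]]; auto|]; intros [H _]; destruct l; [auto|discriminate].
  - rewrite in_flat_map; split.
    + intros (a & Ha & Hl); apply in_map_iff in Hl; destruct Hl as (l' & <- & Hl').
      apply IH in Hl'; destruct Hl' as [<- Hl']; split; [reflexivity|constructor; auto].
    + intros [Hlen Hl]; destruct l as [|a l]; [discriminate|].
      inversion Hl; subst; exists a; split; auto.
      apply in_map, IH; split; auto.
Qed.

Lemma NoDup_lists_of {A} (L : list A) j : NoDup L -> NoDup (lists_of L j).
Proof.
  intros HL; induction j as [|j IH]; simpl; [repeat constructor; simpl; tauto|].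
  apply NoDup_flat_map; auto.
  - intros a _; apply NoDup_map_inj; auto; congruence.
  - intros a b l _ _ H H'; apply in_map_iff in H, H'.
    destruct H as (? & <- & _), H' as (? & E & _); congruence.
Qed.

Lemma lsum_lists_of_prod (f : nat -> R) L j :
  lsum (fprod f) (lists_of L j) = lsum (tprod f) L ^ j.
Proof.
  induction j as [|j IH]; simpl; [rewrite lsum_cons, lsum_nil; simpl; ring|].
  rewrite lsum_flat_map, <- IH, Rmult_comm, <- lsum_scal.
  apply lsum_ext; intros t _; rewrite lsum_map, Rmult_comm, <- lsum_scal; reflexivity.
Qed.

(** The product rule: one of j coordinates is marked by [b], and the other j - 1 are summed
    freely. *)
Lemma lsum_lists_of_prod_sum (f : nat -> R) (b : tree -> R) L j :
  lsum (fun l => fprod f l * lsum b l) (lists_of L j) =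
  INR j * lsum (tprod f) L ^ pred j * lsum (fun t => tprod f t * b t) L.
Proof.
  induction j as [|j IH]; [simpl; rewrite lsum_cons, !lsum_nil; ring|].
  simpl lists_of; rewrite lsum_flat_map.
  transitivity (lsum (fun t => lsum (tprod f) L ^ j * (tprod f t * b t) +
    (INR j * lsum (tprod f) L ^ pred j * lsum (fun t => tprod f t * b t) L) * tprod f t) L).
  - apply lsum_ext; intros t _.
    rewrite lsum_map, <- IH, <- lsum_lists_of_prod.
    rewrite (lsum_ext _ (fun l => tprod f t * b t * fprod f l +
      tprod f t * (fprod f l * lsum b l))).
    + rewrite lsum_plus, !lsum_scal; ring.
    + intros l _; rewrite lsum_cons.
      change (fprod f (t :: l)) with (tprod f t * fprod f l); ring.
  - rewrite lsum_plus, !lsum_scal, S_INR; destruct j as [|j]; simpl pred; [simpl; ring|].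
    simpl pow; ring.
Qed.

(* Trees of height less than [r] all of whose outdegrees are at most [D]. *)
Fixpoint btrees (D r : nat) : list tree :=
  match r with
  | O => []
  | S r' => map Node (flat_map (lists_of (btrees D r')) (seq 0 (S D)))
  end.

Lemma NoDup_btrees D r : NoDup (btrees D r).
Proof.
  induction r as [|r IH]; [constructor|].
  change (NoDup (map Node (flat_map (lists_of (btrees D r)) (seq 0 (S D))))).
  apply NoDup_map_inj; [congruence|].
  apply NoDup_flat_map; [apply seq_NoDup|intros; apply NoDup_lists_of, IH|].
  intros i j l _ _ H H'; apply in_lists_of in H, H'; lia.
Qed.

Lemma in_btrees D r : forall t, (tsize t <= D)%nat -> (tsize t <= r)%nat -> In t (btrees D r).
Proof.
  induction r as [|r IH]; intros [ts]; rewrite tsize_Node; intros HD Hr; [lia|].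
  change (In (Node ts) (map Node (flat_map (lists_of (btrees D r)) (seq 0 (S D))))).
  assert (Hl := length_le_fsize ts).
  apply in_map, in_flat_map; exists (length ts); split; [apply in_seq; lia|].
  apply in_lists_of; split; auto.
  apply Forall_forall; intros t Ht.
  assert (tsize t <= fsize ts)%nat.
  { clear - Ht; induction ts as [|u ts IHts]; [destruct Ht|].
    simpl; fold (fsize ts); destruct Ht as [->|Ht]; [lia|]; specialize (IHts Ht); lia. }
  apply IH; lia.
Qed.

Lemma lsum_btrees_S (h : tree -> R) D r :
  lsum h (btrees D (S r)) =
  lsum (fun j => lsum (fun ts => h (Node ts)) (lists_of (btrees D r) j)) (seq 0 (S D)).
Proof.
  change (btrees D (S r)) with (map Node (flat_map (lists_of (btrees D r)) (seq 0 (S D)))).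
  rewrite lsum_map, lsum_flat_map; reflexivity.
Qed.

(** * Generating functions for tree sizes and generation sizes *)

Definition hcount (k : nat) (t : tree) : R :=
  lsum (fun v => if Nat.eqb (length v) k then 1 else 0) (vertices t).

Lemma hcount_nonneg k t : 0 <= hcount k t.
Proof.
  apply lsum_nonneg; intros; destruct (Nat.eqb _ _); lra.
Qed.

Lemma hcount_0 t : hcount 0 t = 1.
Proof.
  destruct t as [ts]; unfold hcount; rewrite vertices_Node, lsum_cons, lsum_eq0; [simpl; lra|].
  intros v Hv; apply in_vgo in Hv; destruct Hv as (j & u & q & _ & -> & _); reflexivity.
Qed.

Lemma hcount_S k ts : hcount (S k) (Node ts) = lsum (hcount k) ts.
Proof.
  unfold hcount at 1; rewrite vertices_Node, lsum_cons; simpl (Nat.eqb _ _).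
  rewrite Rplus_0_l; generalize 0%nat as i; induction ts as [|u ts IH]; intros i; [reflexivity|].
  simpl vgo; simpl concat; rewrite lsum_app, lsum_cons, IH, lsum_map; reflexivity.
Qed.

Definition genpoly (f : nat -> R) (D : nat) (y : R) : R := lsum (fun j => f j * y ^ j) (seq 0 (S D)).

(** The derivative of [genpoly]; at j = 0 the factor [INR j] makes the value of [pred]
    irrelevant. *)
Definition dgenpoly (f : nat -> R) (D : nat) (y : R) : R :=
  lsum (fun j => f j * (INR j * y ^ pred j)) (seq 0 (S D)).

Definition bmass (f : nat -> R) (D r : nat) : R := lsum (tprod f) (btrees D r).

(** For [f = p] this is the mass which the size-biased tree pointed at height [k] gives to
    [btrees D r], as every pointing carries the Galton-Watson weight. For [f = z p] each tree gets
    an additional [z ^ tsize]. *)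
Definition bgen (f : nat -> R) (D k r : nat) : R :=
  lsum (fun t => tprod f t * hcount k t) (btrees D r).

Lemma bmass_S f D r : bmass f D (S r) = genpoly f D (bmass f D r).
Proof.
  unfold bmass at 1; rewrite lsum_btrees_S; apply lsum_ext; intros j _.
  rewrite (lsum_ext _ (fun ts => f j * fprod f ts)).
  - rewrite lsum_scal, lsum_lists_of_prod; reflexivity.
  - intros ts Hts; apply in_lists_of in Hts; rewrite tprod_Node, (proj1 Hts); reflexivity.
Qed.

Lemma bgen_0 f D r : bgen f D 0 r = bmass f D r.
Proof. apply lsum_ext; intros; rewrite hcount_0; ring. Qed.

(** A vertex at height k + 1 lies below exactly one child of the root: that child carries the mark,
    and the others give the derivative factor. *)
Lemma bgen_S f D k r : bgen f D (S k) (S r) = dgenpoly f D (bmass f D r) * bgen f D k r.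
Proof.
  unfold bgen at 1; rewrite lsum_btrees_S.
  unfold dgenpoly; rewrite Rmult_comm, <- lsum_scal; apply lsum_ext; intros j _.
  rewrite (lsum_ext _ (fun ts => f j * (fprod f ts * lsum (hcount k) ts))).
  - rewrite lsum_scal, lsum_lists_of_prod_sum; unfold bgen, bmass; ring.
  - intros ts Hts; apply in_lists_of in Hts.
    rewrite tprod_Node, hcount_S, (proj1 Hts); ring.
Qed.

Lemma bmass_nonneg f D r : (forall k, 0 <= f k) -> 0 <= bmass f D r.
Proof. intros Hf; apply lsum_nonneg; intros; apply tprod_nonneg, Hf. Qed.

Lemma bgen_nonneg f D k r : (forall j, 0 <= f j) -> 0 <= bgen f D k r.
Proof.
  intros Hf; apply lsum_nonneg; intros; apply Rmult_le_pos;
    [apply tprod_nonneg, Hf|apply hcount_nonneg].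
Qed.

Lemma genpoly_mono f D x y : (forall k, 0 <= f k) -> 0 <= x <= y -> genpoly f D x <= genpoly f D y.
Proof.
  intros Hf Hxy; apply lsum_le; intros j _; apply Rmult_le_compat_l; auto.
  apply pow_incr; exact Hxy.
Qed.

Lemma dgenpoly_mono f D x y : (forall k, 0 <= f k) -> 0 <= x <= y -> dgenpoly f D x <= dgenpoly f D y.
Proof.
  intros Hf Hxy; apply lsum_le; intros j _; apply Rmult_le_compat_l; auto.
  apply Rmult_le_compat_l; [apply pos_INR|]; apply pow_incr; exact Hxy.
Qed.

Lemma bmass_incr f D r : (forall k, 0 <= f k) -> bmass f D r <= bmass f D (S r).
Proof.
  intros Hf; induction r as [|r IH].
  - unfold bmass at 1; simpl; rewrite lsum_nil; apply bmass_nonneg, Hf.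
  - rewrite (bmass_S f D r), (bmass_S f D (S r)); apply genpoly_mono; auto.
    split; auto using bmass_nonneg.
Qed.

Lemma bmass_le_add f D r i : (forall k, 0 <= f k) -> bmass f D r <= bmass f D (r + i).
Proof.
  intros Hf; induction i as [|i IH]; [rewrite Nat.add_0_r; lra|].
  rewrite Nat.add_succ_r; assert (H := bmass_incr f D (r + i) Hf); lra.
Qed.

Lemma bmass_le_1 f D r : (forall k, 0 <= f k) -> lsum f (seq 0 (S D)) <= 1 -> bmass f D r <= 1.
Proof.
  intros Hf H1; induction r as [|r IH].
  - unfold bmass; simpl; rewrite lsum_nil; lra.
  - rewrite bmass_S; apply Rle_trans with (genpoly f D 1).
    + apply genpoly_mono; auto using bmass_nonneg.
    + unfold genpoly; rewrite (lsum_ext _ f) by (intros; rewrite pow1; ring); exact H1.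
Qed.

(** The mean size of a generation is at most one: every level contributes a derivative factor at a
    point of [0, 1], bounded by the truncated mean. *)
Lemma bgen_le_1 f D k : (forall j, 0 <= f j) -> lsum f (seq 0 (S D)) <= 1 ->
  lsum (fun j => INR j * f j) (seq 0 (S D)) <= 1 -> forall r, bgen f D k r <= 1.
Proof.
  intros Hf H1 H2; induction k as [|k IH]; intros r.
  - rewrite bgen_0; apply bmass_le_1; auto.
  - destruct r as [|r]; [unfold bgen; simpl; rewrite lsum_nil; lra|].
    rewrite bgen_S.
    assert (Hd : dgenpoly f D (bmass f D r) <= 1).
    { apply Rle_trans with (dgenpoly f D 1).
      - apply dgenpoly_mono; auto using bmass_nonneg, bmass_le_1.
      - unfold dgenpoly; rewrite (lsum_ext _ (fun j => INR j * f j)); auto.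
        intros; rewrite pow1; ring. }
    assert (Hd0 : 0 <= dgenpoly f D (bmass f D r)).
    { apply lsum_nonneg; intros; repeat apply Rmult_le_pos; auto using pos_INR, pow_le, bmass_nonneg. }
    assert (H0 := bgen_nonneg f D k r Hf); specialize (IH r); nra.
Qed.

(** The k derivative factors are taken at increasing values of [bmass], all at least the one at
    depth [r]. *)
Lemma bgen_lower f D r : (forall j, 0 <= f j) -> forall k,
  dgenpoly f D (bmass f D r) ^ k * bmass f D r <= bgen f D k (r + k).
Proof.
  intros Hf k; induction k as [|k IH].
  - rewrite bgen_0, Nat.add_0_r; simpl; lra.
  - rewrite Nat.add_succ_r, bgen_S; simpl; rewrite Rmult_assoc.
    apply Rmult_le_compat.
    + apply lsum_nonneg; intros; repeat apply Rmult_le_pos; auto using pos_INR, pow_le, bmass_nonneg.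
    + apply Rmult_le_pos; [apply pow_le|apply bmass_nonneg, Hf].
      apply lsum_nonneg; intros; repeat apply Rmult_le_pos; auto using pos_INR, pow_le, bmass_nonneg.
    + apply dgenpoly_mono; auto using bmass_nonneg, bmass_le_add.
    + exact IH.
Qed.

(* A bounded increasing sequence has arbitrarily small increments; this replaces passing to
   the fixed point of [genpoly f D]. *)
Lemma bmass_small_increment f D e :
  (forall k, 0 <= f k) -> lsum f (seq 0 (S D)) <= 1 -> 0 < e ->
  exists r, bmass f D (S r) <= bmass f D r + e.
Proof.
  intros Hf H1 He; apply NNPP; intros Hn.
  assert (H : forall r, INR r * e <= bmass f D r).
  { induction r as [|r IH]; [simpl; rewrite Rmult_0_l; apply bmass_nonneg, Hf|].
    assert (bmass f D r + e < bmass f D (S r)).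
    { apply Rnot_le_lt; intros Hle; apply Hn; exists r; exact Hle. }
    rewrite S_INR; lra. }
  destruct (INR_unbounded (/ e)) as [r Hr].
  specialize (H r); assert (Hb := bmass_le_1 f D r Hf H1).
  apply (Rmult_lt_compat_r e) in Hr; [|exact He]; rewrite Rinv_l in Hr; lra.
Qed.

(** Bernoulli's inequality with a quadratic gain, an equality at j = 2. The gain is what later
    forces 1 - y to have the order of a square root. *)
Lemma pow_1_minus_lower u j : 0 <= u <= 1 ->
  1 - INR j * u + (if (2 <=? j)%nat then u ^ 2 else 0) <= (1 - u) ^ j.
Proof.
  intros Hu; induction j as [|j IH]; [simpl; lra|].
  rewrite S_INR; destruct j as [|[|j]]; [simpl; lra|simpl; nra|].
  simpl (_ <=? _)%nat in *; cbv iota in *.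
  change ((1 - u) ^ S (S (S j))) with ((1 - u) * (1 - u) ^ S (S j)).
  assert (H : (1 - u) * (1 - INR (S (S j)) * u + u ^ 2) <= (1 - u) * (1 - u) ^ S (S j))
    by (apply Rmult_le_compat_l; lra).
  assert (1 <= INR (S (S j))) by (rewrite S_INR; assert (Hp := pos_INR (S j)); lra).
  assert (0 <= u ^ 2 * (INR (S (S j)) - u)) by (apply Rmult_le_pos; nra).
  nra.
Qed.

Lemma pow_ge_1_minus x a k : 0 <= a -> 0 <= x -> 1 - a <= x -> 1 - INR k * a <= x ^ k.
Proof.
  intros Ha Hx Hax; induction k as [|k IH]; [simpl; lra|].
  rewrite S_INR; simpl; assert (H := pow_le x k Hx); assert (Hk := pos_INR k).
  destruct (Rle_lt_dec 0 (1 - INR k * a)); [|assert (0 <= x * x ^ k) by nra; nra].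
  destruct (Rle_lt_dec a 1); [|nra].
  assert ((1 - a) * (1 - INR k * a) <= x * x ^ k) by (apply Rmult_le_compat; lra).
  assert (0 <= INR k * a * a) by (repeat apply Rmult_le_pos; auto); nra.
Qed.

(** Bernoulli's inequality gives (1 + 1/M)^M >= 2, and its product with (1 - 1/M)^M is at most
    one. *)
Lemma pow_inv_le_half M : (1 <= M)%nat -> (1 - / INR M) ^ M <= / 2.
Proof.
  intros HM; assert (HM0 : 1 <= INR M) by (apply (le_INR 1); exact HM).
  assert (Hi : 0 < / INR M <= 1).
  { split; [apply Rinv_0_lt_compat; lra|rewrite <- Rinv_1; apply Rinv_le_contravar; lra]. }
  assert (H2 : 2 <= (1 + / INR M) ^ M).
  { replace 2 with (1 + INR M * / INR M) by (field; lra).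
    apply poly; lra. }
  assert (H3 : (1 - / INR M) ^ M * (1 + / INR M) ^ M <= 1).
  { rewrite <- Rpow_mult_distr, <- (pow1 M); apply pow_incr; rewrite pow1; split; nra. }
  assert (H4 : 0 <= (1 - / INR M) ^ M) by (apply pow_le; lra).
  nra.
Qed.

(** A factor [z] per vertex turns the tree weight into the size generating function. *)
Lemma tprod_scal p z t : tprod (fun k => z * p k) t = tprod p t * z ^ tsize t.
Proof.
  induction t as [ts IH] using tree_forall_ind.
  rewrite !tprod_Node, tsize_Node; simpl pow.
  assert (E : fprod (fun k => z * p k) ts = fprod p ts * z ^ fsize ts).
  { induction IH as [|u l Hu Hl IHl]; [simpl; ring|].
    change (tprod (fun k => z * p k) u * fprod (fun k => z * p k) l =
      tprod p u * fprod p l * z ^ (tsize u + fsize l)).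
    rewrite pow_add, Hu, IHl; ring. }
  rewrite E; ring.
Qed.

(** With z = 1 - 1/M, u = 1 - y is shown to be O(M^{-1/2}), each derivative factor to be at least 1
    - O(M^{-1/2}), and so the z-weighted mass of generation k to be at least 1 - O((k+1) M^{-1/2}).
    Trees larger than M count at most half in that weighted mass, which bounds their share. *)
Lemma generation_mass_lower p v : critical_law p v ->
  exists C, 0 < C /\ forall M k, (2 <= M)%nat -> exists L : list tree,
    NoDup L /\ (forall t, In t L -> (tsize t <= M)%nat) /\
    1 - C * (INR k + 1) / sqrt (INR M) <= lsum (fun t => tprod p t * hcount k t) L.
Proof.
  intros Hlaw; assert (Hp := law_nonneg p v Hlaw); assert (Hv := law_var_pos p v Hlaw).
  destruct (law_branching p v Hlaw) as (k2 & Hk2 & Hc).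
  (* [c] is the curvature supplied by a single atom k2 >= 2, and [s] is the constant in
     [u <= s * q], obtained from [u ^ 2 <= 6 / c * e]. *)
  set (c := p k2) in *; set (s := sqrt (6 / c)).
  assert (Hs : 0 <= s) by apply sqrt_pos.
  assert (Hs2 : s * s = 6 / c).
  { apply sqrt_sqrt; apply Rmult_le_pos; [lra|left; apply Rinv_0_lt_compat, Hc]. }
  (* Chosen to dominate 2 (k a + u) / q with a = 2 e + 2 v u, e <= q, u <= s q and q = M^{-1/2}; the
     leading 2 comes from the halving argument. *)
  exists (4 + 4 * v * s + 2 * s); split; [nra|]; intros M k HM.
  assert (HM2 : 2 <= INR M) by (apply (le_INR 2); exact HM).
  set (e := / INR M).
  assert (He : 0 < e <= / 2).
  { unfold e; split; [apply Rinv_0_lt_compat; lra|apply Rinv_le_contravar; lra]. }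
  set (z := 1 - e).
  destruct (law_partial_ge p v e Hlaw (proj1 He)) as [K0 HK0].
  (* Large enough that the truncated mass and mean lose at most [e], and that the atom [k2] is
     included. *)
  set (D := (K0 + k2)%nat).
  destruct (HK0 D) as (HD1 & HD2 & _); [unfold D; lia|].
  destruct (law_partial_le p v D Hlaw) as (HD1' & HD2' & HD3').
  set (f := fun j => z * p j).
  assert (Hf : forall j, 0 <= f j) by (intros; unfold f, z; apply Rmult_le_pos; [lra|auto]).
  assert (Hf1 : lsum f (seq 0 (S D)) <= 1) by (unfold f; rewrite lsum_scal; unfold z; nra).
  destruct (bmass_small_increment f D e Hf Hf1 (proj1 He)) as [r Hr].
  set (y := bmass f D r) in *; set (u := 1 - y).
  assert (Hy0 : 0 <= y) by (apply bmass_nonneg, Hf).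
  assert (Hy1 : y <= 1) by (apply bmass_le_1; auto).
  assert (Hu : 0 <= u <= 1) by (unfold u; lra).
  assert (Eyu : y = 1 - u) by (unfold u; ring).
  assert (Hgen : z * (1 - e - u + c * u ^ 2) <= y + e).
  { eapply Rle_trans; [|exact Hr]; rewrite bmass_S; fold y.
    unfold genpoly, f; rewrite (lsum_ext _ (fun j => z * (p j * y ^ j))) by (intros; ring).
    rewrite lsum_scal; apply Rmult_le_compat_l; [unfold z; lra|].
    apply Rle_trans with (lsum (fun j => p j + (- u) * (INR j * p j) +
      (if Nat.eqb j k2 then c * u ^ 2 else 0)) (seq 0 (S D))).
    - rewrite !lsum_plus, lsum_scal.
      assert (E : lsum (fun j => if Nat.eqb j k2 then c * u ^ 2 else 0) (seq 0 (S D)) >= c * u ^ 2).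
      { rewrite (lsum_ext _ (fun j => c * u ^ 2 * ind (k2 = j))).
        - rewrite lsum_scal, lsum_ind_NoDup; [lra|apply seq_NoDup|apply in_seq; unfold D; lia].
        - intros j _; destruct (Nat.eqb_spec j k2).
          + rewrite ind_true; auto; ring.
          + rewrite ind_false; [ring|congruence]. }
      nra.
    - apply lsum_le; intros j _; rewrite Eyu.
      assert (H := pow_1_minus_lower u j Hu); specialize (Hp j).
      assert (H2 : p j * (1 - INR j * u + (if (2 <=? j)%nat then u ^ 2 else 0)) <= p j * (1 - u) ^ j)
        by (apply Rmult_le_compat_l; auto).
      destruct (Nat.eqb_spec j k2) as [->|_].
      + rewrite (proj2 (Nat.leb_le _ _) Hk2) in H2; unfold c; lra.
      + destruct (2 <=? j)%nat; [assert (0 <= p j * u ^ 2) by (apply Rmult_le_pos; auto; nra)|]; lra. }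
  (* In [Hgen] the terms -u on both sides cancel, because the mean is one; what remains is c u^2 (1
     - e) <= 3 e, with e <= 1/2. *)
  assert (Hu2 : u ^ 2 <= 6 / c * e).
  { unfold z in Hgen.
    assert (H : c / 2 * u ^ 2 <= 3 * e).
    { assert (0 <= c * u ^ 2) by (apply Rmult_le_pos; nra).
      assert (e * (c * u ^ 2) <= / 2 * (c * u ^ 2)) by (apply Rmult_le_compat_r; lra).
      nra. }
    apply (Rmult_le_reg_l (c / 2)); [lra|].
    replace (c / 2 * (6 / c * e)) with (3 * e) by (field; lra); exact H. }
  set (q := / sqrt (INR M)).
  assert (Hsq : 1 <= sqrt (INR M)) by (rewrite <- sqrt_1; apply sqrt_le_1; lra).
  assert (Hq : 0 < q <= 1).
  { unfold q; split; [apply Rinv_0_lt_compat; lra|rewrite <- Rinv_1; apply Rinv_le_contravar; lra]. }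
  assert (Hq2 : q * q = e).
  { unfold q, e; rewrite <- Rinv_mult, sqrt_sqrt by lra; reflexivity. }
  assert (Huq : u <= s * q).
  { apply Rsqr_incr_0; [unfold Rsqr|lra|nra].
    replace (s * q * (s * q)) with (s * s * (q * q)) by ring; rewrite Hs2, Hq2; lra. }
  assert (Hd : 1 - (2 * e + 2 * v * u) <= dgenpoly f D y).
  { unfold dgenpoly, f.
    rewrite (lsum_ext _ (fun j => z * (p j * (INR j * y ^ pred j)))) by (intros; ring).
    rewrite lsum_scal.
    assert (H : 1 - e - 2 * v * u <= lsum (fun j => p j * (INR j * y ^ pred j)) (seq 0 (S D))).
    { apply Rle_trans with (lsum (fun j => INR j * p j +
        (- (2 * u)) * ((INR j - 1) ^ 2 * p j)) (seq 0 (S D))).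
      - rewrite lsum_plus, lsum_scal; nra.
      - apply lsum_le; intros j _; rewrite Eyu; specialize (Hp j).
        (* By Bernoulli the loss is j (j - 1) u, and j (j - 1) <= 2 (j - 1)^2 for j >= 1, so that
           summation over [p] produces the variance. *)
        assert (H : INR j - 2 * u * (INR j - 1) ^ 2 <= INR j * (1 - u) ^ pred j).
        { destruct j as [|j]; [simpl; nra|]; simpl pred.
          assert (H := pow_1_minus_lower u j Hu).
          assert (H' : 1 - INR j * u <= (1 - u) ^ j).
          { destruct (2 <=? j)%nat; [assert (0 <= u ^ 2) by nra|]; lra. }
          assert (Hj := pos_INR j); rewrite S_INR.
          assert ((INR j + 1) * (1 - INR j * u) <= (INR j + 1) * (1 - u) ^ j)
            by (apply Rmult_le_compat_l; lra).
          assert (INR j <= INR j * INR j).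
          { destruct j as [|j]; [simpl; lra|]; rewrite S_INR in *; assert (Hj' := pos_INR j); nra. }
          assert (0 <= u * (INR j * INR j - INR j)) by (apply Rmult_le_pos; lra).
          nra. }
        apply (Rmult_le_compat_l (p j)) in H; auto; lra. }
    unfold z; assert (0 <= 2 * v * u) by (apply Rmult_le_pos; lra).
    assert ((1 - e) * (1 - e - 2 * v * u) <= (1 - e) *
      lsum (fun j => p j * (INR j * y ^ pred j)) (seq 0 (S D))) by (apply Rmult_le_compat_l; lra).
    nra. }
  assert (Hd0 : 0 <= dgenpoly f D y).
  { apply lsum_nonneg; intros j _; apply Rmult_le_pos; [apply Hf|]; apply Rmult_le_pos; auto using pos_INR, pow_le. }
  set (H := bgen f D k (r + k)).
  set (a := 2 * e + 2 * v * u) in *.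
  assert (Ha : 0 <= a) by (unfold a; assert (0 <= v * u) by (apply Rmult_le_pos; lra); lra).
  assert (HH : 1 - INR k * a - u <= H).
  { assert (H1 := bgen_lower f D r Hf k); fold y in H1; fold H in H1.
    assert (H2 := pow_ge_1_minus _ a k Ha Hd0 Hd).
    assert (H3 : 0 <= H) by (apply bgen_nonneg, Hf).
    assert (Hka : 0 <= INR k * a) by (apply Rmult_le_pos; auto using pos_INR).
    destruct (Rle_lt_dec (INR k * a) 1); [|lra].
    assert ((1 - INR k * a) * y <= dgenpoly f D y ^ k * y) by (apply Rmult_le_compat_r; auto).
    rewrite Eyu in *; nra. }
  set (L := filter (fun t => Nat.leb (tsize t) M) (btrees D (r + k))).
  exists L; split; [apply NoDup_filter, NoDup_btrees|split].
  { intros t Ht; apply filter_In in Ht; apply Nat.leb_le, Ht. }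
  set (F := lsum (fun t => tprod p t * hcount k t) L).
  (* Trees of size at most [M] count fully and the others at most half, and the unweighted total is
     at most one, so H <= F + (1 - F) / 2. *)
  assert (HF : H <= F * / 2 + / 2).
  { assert (H1 := bgen_le_1 p D k Hp HD1' HD2' (r + k)).
    apply Rle_trans with (F * / 2 + bgen p D k (r + k) * / 2); [|lra].
    unfold H, F, bgen, L; rewrite lsum_filter.
    rewrite !(Rmult_comm _ (/ 2)), <- !lsum_scal, <- lsum_plus.
    apply lsum_le; intros t _; unfold f; rewrite tprod_scal.
    assert (Ht : 0 <= tprod p t * hcount k t)
      by (apply Rmult_le_pos; [apply tprod_nonneg, Hp|apply hcount_nonneg]).
    assert (Hz : 0 <= z <= 1) by (unfold z; lra).
    destruct (Nat.leb_spec (tsize t) M).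
    - assert (z ^ tsize t <= 1) by (rewrite <- (pow1 (tsize t)); apply pow_incr; lra).
      nra.
    - assert (z ^ tsize t <= / 2).
      { replace (tsize t) with (M + (tsize t - M))%nat by lia; rewrite pow_add.
        assert (z ^ M <= / 2) by (apply pow_inv_le_half; lia).
        assert (z ^ (tsize t - M) <= 1)
          by (rewrite <- (pow1 (tsize t - M)); apply pow_incr; lra).
        assert (0 <= z ^ (tsize t - M)) by (apply pow_le; lra).
        assert (0 <= z ^ M) by (apply pow_le; lra).
        nra. }
      nra. }
  assert (Hk := pos_INR k).
  assert (Hfin : 2 * (INR k * a + u) <= (4 + 4 * v * s + 2 * s) * (INR k + 1) * q).
  { assert (e <= q) by nra.
    assert (v * u <= v * (s * q)) by (apply Rmult_le_compat_l; lra).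
    assert (a <= (2 + 2 * v * s) * q) by (unfold a; nra).
    assert (INR k * a <= INR k * ((2 + 2 * v * s) * q)) by (apply Rmult_le_compat_l; lra).
    assert (0 <= v * s) by (apply Rmult_le_pos; lra).
    assert (0 <= INR k * (s * q)) by (repeat apply Rmult_le_pos; lra).
    assert (0 <= v * s * q) by (repeat apply Rmult_le_pos; lra).
    nra. }
  unfold Rdiv; fold q; lra.
Qed.

(** * The law of the pointed fringe subtree of the spine tree *)

Lemma law_Tstar_nonneg w tau Phi k x :
  (forall j, 0 <= pxi w tau Phi j) -> 0 <= law_Tstar w tau Phi k x.
Proof.
  intros Hp; destruct x as [[s q]|]; simpl; [|lra].
  destruct (Nat.eqb _ _); [|lra]; rewrite star_prob_eq.
  apply Rmult_le_pos; [apply ind_ge0|apply tprod_nonneg, Hp].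
Qed.

Definition pointings (k : nat) (L : list tree) : list outcome :=
  flat_map (fun t => map (fun q => Some (t, q))
    (filter (fun q => Nat.eqb (length q) k) (vertices t))) L.

Lemma in_pointings k L s q :
  In (Some (s, q)) (pointings k L) <-> In s L /\ In q (vertices s) /\ length q = k.
Proof.
  unfold pointings; rewrite in_flat_map; split.
  - intros (t & Ht & H); apply in_map_iff in H; destruct H as (q' & E & Hq).
    injection E as -> ->; apply filter_In in Hq; rewrite Nat.eqb_eq in Hq; tauto.
  - intros (Hs & Hq & Hk); exists s; split; auto; apply in_map_iff; exists q; split; auto.
    apply filter_In; rewrite Nat.eqb_eq; auto.
Qed.

Lemma NoDup_pointings k L : NoDup L -> NoDup (pointings k L).
Proof.
  intros HL; apply NoDup_flat_map; auto.
  - intros t _; apply NoDup_map_inj; [congruence|apply NoDup_filter, NoDup_vertices].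
  - intros t t' x _ _ H H'; apply in_map_iff in H, H'.
    destruct H as (? & <- & _), H' as (? & E & _); congruence.
Qed.

Lemma law_Tstar_pointings w tau Phi k L :
  lsum (law_Tstar w tau Phi k) (pointings k L) =
  lsum (fun t => tprod (pxi w tau Phi) t * hcount k t) L.
Proof.
  unfold pointings; rewrite lsum_flat_map; apply lsum_ext; intros t _.
  unfold hcount; rewrite lsum_map, lsum_filter, <- lsum_scal; apply lsum_ext; intros q Hq.
  simpl; destruct (Nat.eqb _ _); [|ring].
  rewrite star_prob_eq, (ind_true _ Hq); unfold gw_prob; ring.
Qed.

(** A finite list mentions only trees of bounded size, so up to outcomes of probability zero it is
    contained in the pointings of some [btrees B B], whose mass is a [bgen]. *)
Lemma law_Tstar_mass_le_1 w tau Phi v k L :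
  critical_law (pxi w tau Phi) v -> NoDup L -> lsum (law_Tstar w tau Phi k) L <= 1.
Proof.
  intros Hlaw HL; assert (Hp := law_nonneg _ _ Hlaw).
  assert (HB : exists B, forall s q, In (Some (s, q)) L -> (tsize s <= B)%nat).
  { clear HL; induction L as [|x L [B IH]]; [exists 0%nat; simpl; tauto|].
    destruct x as [[s' q']|].
    - exists (max (tsize s') B); intros s q [E|H].
      + injection E as -> ->; lia.
      + specialize (IH s q H); lia.
    - exists B; intros s q [E|H]; [discriminate|eauto]. }
  destruct HB as [B HB].
  apply Rle_trans with (lsum (law_Tstar w tau Phi k) (pointings k (btrees B B))).
  - apply lsum_incl; auto.
    + intros; apply law_Tstar_nonneg, Hp.
    + intros [[s q]|] Hx H0; [|contradiction H0; reflexivity].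
      simpl in H0; destruct (Nat.eqb_spec (length q) k) as [E|]; [|contradiction H0; reflexivity].
      apply in_pointings; repeat split; auto.
      * apply in_btrees; eauto.
      * apply NNPP; intros Hq; apply H0; rewrite star_prob_eq, ind_false; auto; ring.
  - rewrite law_Tstar_pointings.
    destruct (law_partial_le _ _ B Hlaw) as (H1 & H2 & _).
    apply bgen_le_1; auto.
Qed.

(** * The characteristic function *)

(** Since sin^2(k t / 2) = (1 - cos(k t)) / 2, this measures how far the phases of the atoms are
    from that of the atom 0. *)
Definition sin2sum (p : nat -> R) (K : nat) (t : R) : R :=
  lsum (fun k => p k * sin (INR k * t / 2) ^ 2) (seq 0 (S K)).

Lemma sin2sum_mono p K K' t : (forall k, 0 <= p k) -> (K <= K')%nat ->
  sin2sum p K t <= sin2sum p K' t.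
Proof.
  intros Hp HK; apply lsum_seq_mono; [lia|].
  intros k; apply Rmult_le_pos; auto using pow2_ge_0.
Qed.

Lemma sin2sum_nonneg p K t : (forall k, 0 <= p k) -> 0 <= sin2sum p K t.
Proof.
  intros Hp; apply lsum_nonneg; intros; apply Rmult_le_pos; auto using pow2_ge_0.
Qed.

(** One constant and one truncation serve for all [t]. This is a quantitative Bezout relation that
    avoids explicit coefficients. *)
Definition sin_dominated (p : nat -> R) (e : nat) : Prop :=
  exists C K0, 0 <= C /\ forall t, sin (INR e * t / 2) ^ 2 <= C * sin2sum p K0 t.

Lemma sin2_add_le a b : sin (a + b) ^ 2 <= 2 * sin a ^ 2 + 2 * sin b ^ 2.
Proof.
  rewrite sin_plus; assert (Ha := sin2_cos2 a); assert (Hb := sin2_cos2 b); unfold Rsqr in *.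
  set (x := sin a * cos b); set (y := cos a * sin b).
  assert (x ^ 2 <= sin a ^ 2).
  { unfold x; rewrite Rpow_mult_distr; assert (cos b ^ 2 <= 1) by nra.
    assert (0 <= sin a ^ 2) by apply pow2_ge_0; nra. }
  assert (y ^ 2 <= sin b ^ 2).
  { unfold y; rewrite Rpow_mult_distr; assert (cos a ^ 2 <= 1) by nra.
    assert (0 <= sin b ^ 2) by apply pow2_ge_0; nra. }
  assert (0 <= (x - y) ^ 2) by apply pow2_ge_0; nra.
Qed.

(** The sign [sg] is 1 or -1, so sums and differences of natural numbers are treated at once. *)
Lemma sin_dominated_comb p e e1 e2 sg : (forall k, 0 <= p k) ->
  sg ^ 2 = 1 -> INR e = INR e1 + sg * INR e2 ->
  sin_dominated p e1 -> sin_dominated p e2 -> sin_dominated p e.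
Proof.
  intros Hp Hsg He (C1 & K1 & HC1 & H1) (C2 & K2 & HC2 & H2).
  exists (2 * C1 + 2 * C2), (K1 + K2)%nat; split; [lra|]; intros t.
  specialize (H1 t); specialize (H2 t).
  assert (M1 := sin2sum_mono p K1 (K1 + K2) t Hp ltac:(lia)).
  assert (M2 := sin2sum_mono p K2 (K1 + K2) t Hp ltac:(lia)).
  replace (INR e * t / 2) with (INR e1 * t / 2 + sg * (INR e2 * t / 2)) by (rewrite He; field).
  assert (H := sin2_add_le (INR e1 * t / 2) (sg * (INR e2 * t / 2))).
  assert (E : sin (sg * (INR e2 * t / 2)) ^ 2 = sin (INR e2 * t / 2) ^ 2).
  { assert (Hs : sg = 1 \/ sg = -1).
    { destruct (Rle_lt_dec 0 sg); [left|right]; nra. }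
    destruct Hs as [-> | ->]; [rewrite Rmult_1_l; reflexivity|].
    replace (-1 * (INR e2 * t / 2)) with (- (INR e2 * t / 2)) by ring.
    rewrite sin_neg; ring. }
  rewrite E in H.
  assert (C1 * sin2sum p K1 t <= C1 * sin2sum p (K1 + K2) t) by (apply Rmult_le_compat_l; auto).
  assert (C2 * sin2sum p K2 t <= C2 * sin2sum p (K1 + K2) t) by (apply Rmult_le_compat_l; auto).
  lra.
Qed.

Lemma sin_dominated_0 p : sin_dominated p 0.
Proof.
  exists 0, 0%nat; split; [lra|]; intros t; simpl INR.
  replace (0 * t / 2) with 0 by field; rewrite sin_0; lra.
Qed.

Lemma sin_dominated_mul p e m : (forall k, 0 <= p k) ->
  sin_dominated p e -> sin_dominated p (m * e).
Proof.
  intros Hp He; induction m as [|m IH]; [apply sin_dominated_0|].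
  apply (sin_dominated_comb p _ e (m * e) 1); auto; [ring|].
  simpl Nat.mul; rewrite plus_INR; ring.
Qed.

Lemma sin_dominated_support p k : (forall j, 0 <= p j) -> 0 < p k -> sin_dominated p k.
Proof.
  intros Hp Hk; exists (/ p k), k; split; [left; apply Rinv_0_lt_compat, Hk|]; intros t.
  apply (Rmult_le_reg_l (p k)); auto.
  rewrite <- Rmult_assoc, Rinv_r, Rmult_1_l by lra.
  unfold sin2sum; rewrite lsum_seq_S.
  assert (0 <= lsum (fun k => p k * sin (INR k * t / 2) ^ 2) (seq 0 k)).
  { apply lsum_nonneg; intros; apply Rmult_le_pos; auto using pow2_ge_0. }
  lra.
Qed.

(* The integers [e] with [sin_dominated p e] form a subgroup containing the support of [p];
   its least positive element divides the support, hence divides the span. *)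
Lemma sin_dominated_span p d : (forall k, 0 <= p k) -> (exists k, (2 <= k)%nat /\ 0 < p k) ->
  is_span p d -> sin_dominated p d.
Proof.
  intros Hp (k2 & Hk2 & Hpk2) [_ Hd].
  assert (Hmin : exists e, (0 < e)%nat /\ sin_dominated p e /\
    forall e', (0 < e')%nat -> sin_dominated p e' -> (e <= e')%nat).
  { assert (H : forall n e, (e <= n)%nat -> (0 < e)%nat -> sin_dominated p e ->
      exists e, (0 < e)%nat /\ sin_dominated p e /\
      forall e', (0 < e')%nat -> sin_dominated p e' -> (e <= e')%nat).
    { induction n as [|n IH]; intros e Hen He0 He; [lia|].
      destruct (classic (exists e', (0 < e' < e)%nat /\ sin_dominated p e')) as [(e' & He' & Hd')|Hno].
      - apply (IH e'); auto; lia.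
      - exists e; repeat split; auto; intros e' H0 H1; apply Nat.nlt_ge; intros Hlt.
        apply Hno; exists e'; auto. }
    apply (H k2 k2); auto; [lia|apply sin_dominated_support; auto]. }
  destruct Hmin as (e & He0 & He & Hmin).
  destruct (Hd e) as [m Hm].
  - intros i Hi; apply Nat.Lcm0.mod_divide.
    destruct (Nat.eq_dec (i mod e) 0) as [|Hne]; auto; exfalso.
    assert (Hlt := Nat.mod_upper_bound i e ltac:(lia)).
    assert (Hdm := Nat.div_mod_eq i e).
    assert (Hsd : sin_dominated p (i mod e)).
    { apply (sin_dominated_comb p _ i (i / e * e) (-1)); auto; [ring| | |].
      - assert (E : INR i = INR (i / e * e) + INR (i mod e)).
        { rewrite <- plus_INR, Nat.mul_comm, <- Hdm; reflexivity. }
        lra.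
      - apply sin_dominated_support; auto.
      - apply sin_dominated_mul; auto. }
    specialize (Hmin _ (proj1 (Nat.neq_0_lt_0 _) Hne) Hsd); lia.
  - rewrite Hm; apply sin_dominated_mul; auto.
Qed.

(** From sin x >= x - x^3 / 6 and x <= 2, so that x^2 / 6 <= 2 / 3. *)
Lemma sin_ge_third x : 0 <= x <= PI / 2 -> x / 3 <= sin x.
Proof.
  intros [H0 H1]; assert (HP := PI_4); assert (HP0 := PI_RGT_0).
  destruct (sin_bound x 0 H0 ltac:(lra)) as [H _].
  unfold sin_approx, sin_term in H; simpl in H.
  assert (x * x <= 4) by nra.
  assert (x * (x * x) <= x * 4) by (apply Rmult_le_compat_l; lra).
  assert (E : - (1) * 1 * (x * (x * (x * 1)) / (1 + 1 + 1 + 1 + 1 + 1)) = - (x * (x * x)) / 6) by field.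
  lra.
Qed.

(** The squared modulus equals the squared mass minus 4 p_k p_l sin^2((th_k - th_l) / 2) summed over
    pairs k < l; only the pairs containing the atom 0 are kept. The induction adds one atom at a
    time. *)
Lemma trig_sum_mod (p th : nat -> R) K : (forall k, 0 <= p k) ->
  lsum (fun k => p k * cos (th k)) (seq 0 (S K)) ^ 2 +
  lsum (fun k => p k * sin (th k)) (seq 0 (S K)) ^ 2 <=
  lsum p (seq 0 (S K)) ^ 2 -
  4 * p 0%nat * lsum (fun k => p k * sin ((th k - th 0%nat) / 2) ^ 2) (seq 0 (S K)).
Proof.
  intros Hp; induction K as [|K IH].
  - simpl seq; rewrite !lsum_cons, !lsum_nil.
    replace ((th 0%nat - th 0%nat) / 2) with 0 by field; rewrite sin_0.
    assert (H := sin2_cos2 (th 0%nat)); unfold Rsqr in H; nra.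
  - rewrite !(lsum_seq_S _ (S K)).
    set (A := lsum (fun k => p k * cos (th k)) (seq 0 (S K))) in *.
    set (B := lsum (fun k => p k * sin (th k)) (seq 0 (S K))) in *.
    set (P := lsum p (seq 0 (S K))) in *.
    set (T := lsum (fun k => p k * sin ((th k - th 0%nat) / 2) ^ 2) (seq 0 (S K))) in *.
    set (a := th (S K)) in *; set (x := p (S K)) in *.
    assert (Hx : 0 <= x) by (unfold x; auto).
    assert (E : A * cos a + B * sin a <= P - 2 * p 0%nat * sin ((a - th 0%nat) / 2) ^ 2).
    { unfold A, B, P; rewrite !(Rmult_comm (lsum _ _)), <- !lsum_scal, <- lsum_plus.
      rewrite !lsum_seq_0.
      assert (E0 : cos a * (p 0%nat * cos (th 0%nat)) + sin a * (p 0%nat * sin (th 0%nat)) =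
        p 0%nat - 2 * p 0%nat * sin ((a - th 0%nat) / 2) ^ 2).
      { transitivity (p 0%nat * cos (2 * ((a - th 0%nat) / 2))).
        - replace (2 * ((a - th 0%nat) / 2)) with (a - th 0%nat) by field.
          rewrite cos_minus; ring.
        - rewrite cos_2a_sin; ring. }
      rewrite E0.
      assert (H : lsum (fun k => cos a * (p (S k) * cos (th (S k))) +
        sin a * (p (S k) * sin (th (S k)))) (seq 0 K) <= lsum (fun k => p (S k)) (seq 0 K)).
      { apply lsum_le; intros k _.
        replace (cos a * (p (S k) * cos (th (S k))) + sin a * (p (S k) * sin (th (S k))))
          with (p (S k) * cos (a - th (S k))) by (rewrite cos_minus; ring).
        assert (Hc := COS_bound (a - th (S k))); specialize (Hp (S k)); nra. }
      lra. }
    assert (Hxy : x * (A * cos a + B * sin a) <=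
      x * (P - 2 * p 0%nat * sin ((a - th 0%nat) / 2) ^ 2)) by (apply Rmult_le_compat_l; auto).
    assert (H1 := sin2_cos2 a); unfold Rsqr in H1.
    assert (E2 : (A + x * cos a) ^ 2 + (B + x * sin a) ^ 2 =
      A ^ 2 + B ^ 2 + 2 * (x * (A * cos a + B * sin a)) + x ^ 2 * (sin a * sin a + cos a * cos a))
      by ring.
    rewrite E2, H1; lra.
Qed.

Definition cis (t : R) : C := (cos t, sin t).

(* The characteristic function of [xi - 1], truncated to [xi <= K]. *)
Definition chi (p : nat -> R) (K : nat) (t : R) : C :=
  (lsum (fun k => p k * cos ((INR k - 1) * t)) (seq 0 (S K)),
   lsum (fun k => p k * sin ((INR k - 1) * t)) (seq 0 (S K))).

Lemma Cmod_cis t : Cmod (cis t) = 1.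
Proof.
  unfold Cmod, cis; simpl; assert (H := sin2_cos2 t); unfold Rsqr in H.
  replace (cos t * (cos t * 1) + sin t * (sin t * 1)) with 1 by lra; apply sqrt_1.
Qed.

Lemma chi_mod_sq p v K t : critical_law p v ->
  Cmod (chi p K t) ^ 2 <= 1 - 4 * p 0%nat * sin2sum p K t.
Proof.
  intros Hlaw; assert (Hp := law_nonneg p v Hlaw).
  rewrite Cmod2_alt; unfold chi, Re, Im; cbv beta iota delta [fst snd].
  assert (H := trig_sum_mod p (fun k => (INR k - 1) * t) K Hp); cbv beta in H.
  rewrite (lsum_ext (fun k => p k * sin (((INR k - 1) * t - (INR 0 - 1) * t) / 2) ^ 2)
    (fun k => p k * sin (INR k * t / 2) ^ 2)) in H.
  2:{ intros k _; replace (((INR k - 1) * t - (INR 0 - 1) * t) / 2) with (INR k * t / 2)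
        by (change (INR 0) with 0; field); reflexivity. }
  fold (sin2sum p K t) in H.
  destruct (law_partial_le p v K Hlaw) as (H1 & _).
  assert (0 <= lsum p (seq 0 (S K))) by (apply lsum_nonneg; auto).
  assert (lsum p (seq 0 (S K)) ^ 2 <= 1) by nra.
  lra.
Qed.

Lemma chi_mod_le_1 p v K t : critical_law p v -> Cmod (chi p K t) <= 1.
Proof.
  intros Hlaw; assert (H := chi_mod_sq p v K t Hlaw).
  assert (Hp := law_nonneg p v Hlaw).
  assert (0 <= p 0%nat * sin2sum p K t) by (apply Rmult_le_pos; auto using sin2sum_nonneg).
  assert (Hge := Cmod_ge_0 (chi p K t)); nra.
Qed.

Lemma span_pos p v d : critical_law p v -> is_span p d -> (1 <= d)%nat.
Proof.
  intros Hlaw [Hd _]; destruct (law_branching p v Hlaw) as (k & Hk & Hpk).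
  destruct (Hd k Hpk) as [m Hm]; destruct d; [lia|lia].
Qed.

(** For t <= pi/d the angle d t / 2 stays in [0, pi/2], where the sine is bounded below linearly, so
    |chi|^2 <= 1 - 2 c t^2. The constants do not depend on [K], which will grow with n. *)
Lemma chi_gaussian_bound p v d : critical_law p v -> is_span p d ->
  exists c K0, 0 < c /\ forall K t N, (K0 <= K)%nat -> 0 <= t <= PI / INR d ->
    Cmod (chi p K t) ^ N <= exp (- (c * INR N * t ^ 2)).
Proof.
  intros Hlaw Hd; assert (Hp := law_nonneg p v Hlaw).
  assert (Hd1 := span_pos p v d Hlaw Hd).
  destruct (sin_dominated_span p d Hp (law_branching p v Hlaw) Hd) as (C & K0 & HC & Hdom).
  (* Here 72 = 2 * 36: the 36 comes from sin(d t / 2) >= t / 6 and the 2 from passing from |chi|^2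
     to |chi|; C + 1 avoids dividing by zero. *)
  set (c := 4 * p 0%nat / (72 * (C + 1))).
  assert (Hp0 := law_zero p v Hlaw).
  assert (Hc : 0 < c) by (unfold c; apply Rdiv_lt_0_compat; lra).
  exists c, K0; split; auto; intros K t N HK Ht.
  assert (Hd1' : 1 <= INR d) by (apply (le_INR 1); exact Hd1).
  assert (Hsin : t ^ 2 / 36 <= sin (INR d * t / 2) ^ 2).
  { assert (H : INR d * t / 2 / 3 <= sin (INR d * t / 2)).
    { apply sin_ge_third; split; [nra|].
      apply (Rmult_le_reg_r (2 / INR d)); [apply Rdiv_lt_0_compat; lra|].
      replace (INR d * t / 2 * (2 / INR d)) with t by (field; lra).
      replace (PI / 2 * (2 / INR d)) with (PI / INR d) by (field; lra); apply Ht. }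
    assert (t / 6 <= INR d * t / 2 / 3) by nra.
    nra. }
  assert (Hsq : Cmod (chi p K t) ^ 2 <= 1 - 2 * c * t ^ 2).
  { eapply Rle_trans; [apply (chi_mod_sq p v K t Hlaw)|].
    assert (Hm := sin2sum_mono p K0 K t Hp HK); specialize (Hdom t).
    assert (H0 := sin2sum_nonneg p K0 t Hp).
    assert (H1 : t ^ 2 / 36 <= (C + 1) * sin2sum p K t) by nra.
    assert (H2 : t ^ 2 / 36 / (C + 1) <= sin2sum p K t).
    { apply (Rmult_le_reg_l (C + 1)); [lra|].
      replace ((C + 1) * (t ^ 2 / 36 / (C + 1))) with (t ^ 2 / 36) by (field; lra); exact H1. }
    assert (H3 : 2 * c * t ^ 2 = 4 * p 0%nat * (t ^ 2 / 36 / (C + 1))) by (unfold c; field; lra).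
    rewrite H3; assert (4 * p 0%nat * (t ^ 2 / 36 / (C + 1)) <= 4 * p 0%nat * sin2sum p K t)
      by (apply Rmult_le_compat_l; lra).
    lra. }
  assert (H1 : Cmod (chi p K t) <= exp (- (c * t ^ 2))).
  { assert (He := exp_pos (- (c * t ^ 2))); assert (H0 := Cmod_ge_0 (chi p K t)).
    assert (Hexp : 1 - 2 * c * t ^ 2 <= exp (- (c * t ^ 2)) ^ 2).
    { replace (exp (- (c * t ^ 2)) ^ 2) with (exp (- (2 * c * t ^ 2))).
      - assert (H := exp_ineq1_le (- (2 * c * t ^ 2))); lra.
      - transitivity (exp (- (c * t ^ 2)) * exp (- (c * t ^ 2))); [|ring].
        rewrite <- exp_plus; f_equal; ring. }
    nra. }
  replace (exp (- (c * INR N * t ^ 2))) with (exp (- (c * t ^ 2)) ^ N).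
  - apply pow_incr; split; auto using Cmod_ge_0.
  - induction N as [|N IH]; [simpl; rewrite Rmult_0_r, Rmult_0_l, Ropp_0, exp_0; reflexivity|].
    rewrite S_INR.
    change (exp (- (c * t ^ 2)) ^ S N) with (exp (- (c * t ^ 2)) * exp (- (c * t ^ 2)) ^ N).
    rewrite IH, <- exp_plus; f_equal; ring.
Qed.

(** * Fourier inversion *)

Definition contC (f : R -> C) : Prop :=
  forall t, continuous (fun s => Re (f s)) t /\ continuous (fun s => Im (f s)) t.

Lemma continuous_lsum {A} (f : A -> R -> R) L t :
  (forall a, continuous (f a) t) -> continuous (fun s => lsum (fun a => f a s) L) t.
Proof.
  intros Hf; induction L as [|a L IH].
  - apply continuous_ext with (fun _ => 0); [intros; reflexivity|apply continuous_const].
  - apply continuous_ext with (fun s => plus (f a s) (lsum (fun b => f b s) L)).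
    + intros; rewrite lsum_cons; reflexivity.
    + apply (continuous_plus (V := R_NormedModule)); auto.
Qed.

Lemma continuous_lin_trig c t :
  continuous (fun s => cos (c * s)) t /\ continuous (fun s => sin (c * s)) t.
Proof.
  split; apply (ex_derive_continuous (V := R_NormedModule)); auto_derive; auto.
Qed.

Lemma contC_mult f g : contC f -> contC g -> contC (fun t => (f t * g t)%C).
Proof.
  intros Hf Hg t; destruct (Hf t) as [Hf1 Hf2], (Hg t) as [Hg1 Hg2]; split.
  - apply continuous_ext with (fun s => minus (mult (Re (f s)) (Re (g s))) (mult (Im (f s)) (Im (g s)))).
    + intros; rewrite re_mult; reflexivity.
    + apply (continuous_minus (V := R_NormedModule)); apply (continuous_mult (K := R_AbsRing)); auto.
  - apply continuous_ext with (fun s => plus (mult (Re (f s)) (Im (g s))) (mult (Im (f s)) (Re (g s)))).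
    + intros; rewrite im_mult; reflexivity.
    + apply (continuous_plus (V := R_NormedModule)); apply (continuous_mult (K := R_AbsRing)); auto.
Qed.

Lemma contC_pow f N : contC f -> contC (fun t => (f t ^ N)%C).
Proof.
  intros Hf; induction N as [|N IH].
  - intros t; split; apply continuous_const.
  - apply (contC_mult f (fun t => (f t ^ N)%C)); auto.
Qed.

Lemma contC_cis c : contC (fun t => cis (c * t)).
Proof. intros t; apply continuous_lin_trig. Qed.

Lemma contC_chi p K : contC (chi p K).
Proof.
  intros t; split.
  - apply (continuous_lsum (fun k s => p k * cos ((INR k - 1) * s))); intros k.
    apply (continuous_mult (K := R_AbsRing) (fun _ => p k) (fun s => cos ((INR k - 1) * s)));
      [apply continuous_const|exact (proj1 (continuous_lin_trig _ t))].
  - apply (continuous_lsum (fun k s => p k * sin ((INR k - 1) * s))); intros k.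
    apply (continuous_mult (K := R_AbsRing) (fun _ => p k) (fun s => sin ((INR k - 1) * s)));
      [apply continuous_const|exact (proj2 (continuous_lin_trig _ t))].
Qed.

Definition fint (p : nat -> R) (K N : nat) (y t : R) : R := Re (chi p K t ^ N * cis (y * t))%C.

Lemma continuous_fint p K N y t : continuous (fint p K N y) t.
Proof.
  exact (proj1 (contC_mult (fun t => (chi p K t ^ N)%C) (fun t => cis (y * t))
    (contC_pow _ N (contC_chi p K)) (contC_cis y) t)).
Qed.

Lemma ex_RInt_cont (f : R -> R) a b : (forall t, continuous f t) -> ex_RInt f a b.
Proof. intros Hf; apply (ex_RInt_continuous (V := R_CompleteNormedModule)); auto. Qed.

Lemma RInt_lsum {A} (f : A -> R -> R) L a b : (forall i t, continuous (f i) t) ->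
  RInt (fun t => lsum (fun i => f i t) L) a b = lsum (fun i => RInt (f i) a b) L.
Proof.
  intros Hf; induction L as [|i L IH].
  - rewrite lsum_nil; rewrite (RInt_ext _ (fun _ => 0)) by (intros; reflexivity).
    rewrite RInt_const; apply Rmult_0_r.
  - rewrite lsum_cons, <- IH.
    rewrite <- (RInt_plus (V := R_CompleteNormedModule)).
    + apply RInt_ext; intros; rewrite lsum_cons; reflexivity.
    + apply ex_RInt_cont, Hf.
    + apply ex_RInt_cont; intros t; apply continuous_lsum; auto.
Qed.

Lemma fint_S p K N y t :
  fint p K (S N) y t =
  lsum (fun k => p k * fint p K N (y + (INR k - 1)) t) (seq 0 (S K)).
Proof.
  unfold fint; rewrite Cpow_S.
  set (Z := (chi p K t ^ N)%C).
  rewrite (lsum_ext _ (fun k => Re Z * cos (y * t) * (p k * cos ((INR k - 1) * t))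
    + (- (Re Z * sin (y * t))) * (p k * sin ((INR k - 1) * t))
    + (- (Im Z * sin (y * t))) * (p k * cos ((INR k - 1) * t))
    + (- (Im Z * cos (y * t))) * (p k * sin ((INR k - 1) * t)))).
  - rewrite !lsum_plus, !lsum_scal, !re_mult, im_mult.
    change (lsum (fun k => p k * cos ((INR k - 1) * t)) (seq 0 (S K))) with (Re (chi p K t)).
    change (lsum (fun k => p k * sin ((INR k - 1) * t)) (seq 0 (S K))) with (Im (chi p K t)).
    change (Re (cis (y * t))) with (cos (y * t)); change (Im (cis (y * t))) with (sin (y * t)); ring.
  - intros k _; rewrite re_mult.
    change (Re (cis ((y + (INR k - 1)) * t))) with (cos ((y + (INR k - 1)) * t)).
    change (Im (cis ((y + (INR k - 1)) * t))) with (sin ((y + (INR k - 1)) * t)).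
    rewrite Rmult_plus_distr_r, cos_plus, sin_plus; ring.
Qed.

(** Extension by zero to negative targets, so that the recursion in x - k avoids truncated
    subtraction. *)
Definition convZ (p : nat -> R) (N : nat) (x : Z) : R :=
  if (x <? 0)%Z then 0 else conv p N (Z.to_nat x).

(** On the lattice of multiples of d the integrand has period 2 pi / d and its real part is even, so
    half a period suffices. Truncation is harmless, as atoms above [K >= x] cannot take part in a
    sum equal to [x]. The induction peels off one factor [chi]; at N = 0 it is the orthogonality of
    cosines. *)
Lemma fourier_inversion p v d K N : critical_law p v -> is_span p d -> forall x : Z,
  (Z.of_nat d | x)%Z -> (x <= Z.of_nat K)%Z ->
  RInt (fint p K N (- (IZR x - INR N))) 0 (PI / INR d) = PI / INR d * convZ p N x.
Proof.
  intros Hlaw Hd; assert (Hd1 := span_pos p v d Hlaw Hd).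
  assert (Hd0 : INR d <> 0) by (apply not_0_INR; lia).
  induction N as [|N IH]; intros x Hdx HxK.
  - rewrite (RInt_ext _ (fun t => cos (IZR x * t))).
    2:{ intros t _; unfold fint, cis; simpl Cpow; rewrite Cmult_1_l; unfold Re; simpl.
        rewrite <- cos_neg; f_equal; ring. }
    unfold convZ; destruct (Z.eq_dec x 0) as [->|Hx].
    + rewrite (RInt_ext _ (fun _ => 1)) by (intros; rewrite Rmult_0_l, cos_0; reflexivity).
      rewrite RInt_const; simpl; unfold scal; simpl; unfold mult; simpl; ring.
    + assert (Hx' : IZR x <> 0) by (apply not_0_IZR; exact Hx).
      replace (if (x <? 0)%Z then 0 else conv p 0 (Z.to_nat x)) with 0.
      2:{ destruct (Z.ltb_spec x 0); [reflexivity|].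
          simpl; rewrite (proj2 (Nat.eqb_neq _ _)); [reflexivity|lia]. }
      rewrite Rmult_0_r; apply is_RInt_unique.
      replace 0 with (minus (sin (IZR x * (PI / INR d)) / IZR x) (sin (IZR x * 0) / IZR x)) at 2.
      * apply (is_RInt_derive (V := R_CompleteNormedModule) (fun t => sin (IZR x * t) / IZR x)).
        -- intros t _; auto_derive; auto; field; auto.
        -- intros t _; exact (proj1 (continuous_lin_trig (IZR x) t)).
      * rewrite Rmult_0_r, sin_0; destruct Hdx as [m ->].
        rewrite (sin_eq_0_1 (IZR (m * Z.of_nat d) * (PI / INR d))).
        -- unfold minus, plus, opp; simpl; field; auto.
        -- exists m; rewrite mult_IZR, <- INR_IZR_INZ; field; auto.
  - transitivity (lsum (fun k => PI / INR d * (p k * convZ p N (x - Z.of_nat k))) (seq 0 (S K))).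
    + rewrite (RInt_ext _ _ _ _ (fun t _ => fint_S p K N _ t)).
      rewrite (RInt_lsum (fun k t => p k * fint p K N (- (IZR x - INR (S N)) + (INR k - 1)) t)).
      2:{ intros; apply (continuous_mult (K := R_AbsRing));
          [apply continuous_const|apply continuous_fint]. }
      apply lsum_ext; intros k Hk; apply in_seq in Hk.
      rewrite (RInt_scal (V := R_CompleteNormedModule) (fint p K N _))
        by apply ex_RInt_cont, continuous_fint.
      change (p k * RInt (fint p K N (- (IZR x - INR (S N)) + (INR k - 1))) 0 (PI / INR d) =
        PI / INR d * (p k * convZ p N (x - Z.of_nat k))).
      (* Only for p k > 0 is k, and hence x - k, a multiple of d; atoms of mass zero are discarded
         first. *)
      destruct (law_nonneg p v Hlaw k) as [Hk0|E]; [|rewrite <- E; ring].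
      replace (- (IZR x - INR (S N)) + (INR k - 1)) with (- (IZR (x - Z.of_nat k) - INR N)).
      2:{ rewrite minus_IZR, <- INR_IZR_INZ, S_INR; ring. }
      rewrite IH; [ring| |lia].
      apply Z.divide_sub_r; auto.
      destruct (proj1 Hd k Hk0) as [m ->]; exists (Z.of_nat m); lia.
    + rewrite lsum_scal; f_equal; unfold convZ at 2.
      destruct (Z.ltb_spec x 0) as [Hx|Hx].
      * apply lsum_eq0; intros k _; unfold convZ; rewrite (proj2 (Z.ltb_lt _ _)) by lia; ring.
      * rewrite conv_S, (lsum_seq_extend _ (S (Z.to_nat x))).
        -- apply lsum_ext; intros k Hk; apply in_seq in Hk; unfold convZ.
           rewrite (proj2 (Z.ltb_ge _ _)) by lia; do 2 f_equal; lia.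
        -- lia.
        -- intros k Hk; unfold convZ; rewrite (proj2 (Z.ltb_lt _ _)) by lia; ring.
Qed.

Lemma fourier_conv p v d K N x y : critical_law p v -> is_span p d ->
  Nat.divide d x -> (x <= K)%nat -> y = INR N - INR x ->
  RInt (fint p K N y) 0 (PI / INR d) = PI / INR d * conv p N x.
Proof.
  intros Hlaw Hd [m Hm] HxK ->.
  replace (INR N - INR x) with (- (IZR (Z.of_nat x) - INR N)) by (rewrite <- INR_IZR_INZ; ring).
  rewrite (fourier_inversion p v d); auto; [|exists (Z.of_nat m); lia|lia].
  unfold convZ; rewrite (proj2 (Z.ltb_ge _ _)), Nat2Z.id by lia; reflexivity.
Qed.

(** * Local limit estimates *)

Lemma exp_mono x y : x <= y -> exp x <= exp y.
Proof. intros [H | ->]; [left; apply exp_increasing, H|lra]. Qed.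

Lemma Rabs_sin_le x : Rabs (sin x) <= Rabs x.
Proof.
  assert (H : forall y, 0 < y -> Rabs (sin y) <= y).
  { intros y Hy; assert (H1 := sin_lt_x y Hy); apply Rabs_le; split; [|lra].
    destruct (Rle_lt_dec y 1) as [H2|H2]; [|assert (H3 := SIN_bound y); lra].
    assert (HP := PI2_1); assert (0 < sin y) by (apply sin_gt_0; lra); lra. }
  destruct (Rtotal_order x 0) as [Hx|[->|Hx]].
  - rewrite <- (Rabs_Ropp (sin x)), <- sin_neg, <- (Rabs_Ropp x).
    rewrite (Rabs_right (- x)) by lra; apply H; lra.
  - rewrite sin_0; lra.
  - rewrite (Rabs_right x) by lra; apply H; lra.
Qed.

(** [h] is any upper bound for min(1, |x|). Finite variance gives no third moment: small arguments
    use the cubic remainder, large ones may cost only a multiple of x^2. *)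
Lemma sin_taylor x h : Rabs x <= h \/ 1 <= h -> Rabs (sin x - x) <= 2 * x ^ 2 * h.
Proof.
  assert (H : forall y, 0 <= y -> y <= h \/ 1 <= h -> Rabs (sin y - y) <= 2 * y ^ 2 * h).
  { intros y Hy Hh; assert (HP := PI2_1).
    destruct (Rle_lt_dec y 1) as [H1|H1].
    - destruct (sin_bound y 0 Hy ltac:(lra)) as [Hl _].
      unfold sin_approx, sin_term in Hl; simpl in Hl.
      assert (E : - (1) * 1 * (y * (y * (y * 1)) / (1 + 1 + 1 + 1 + 1 + 1)) = - (y * y * y) / 6) by field.
      assert (Hu : sin y <= y).
      { destruct Hy as [Hy|<-]; [left; apply sin_lt_x, Hy|rewrite sin_0; lra]. }
      assert (y * y * y <= y * y * h) by (apply Rmult_le_compat_l; nra).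
      assert (0 <= y * y * y) by (repeat apply Rmult_le_pos; auto).
      apply Rabs_le; simpl; lra.
    - assert (Hb := SIN_bound y); assert (1 <= h) by lra.
      assert (y * y * 1 <= y * y * h) by (apply Rmult_le_compat_l; nra).
      apply Rabs_le; simpl; split; nra. }
  intros Hh; destruct (Rle_lt_dec 0 x) as [Hx|Hx].
  - rewrite (Rabs_right x) in Hh by lra; apply H; auto.
  - rewrite (Rabs_left x) in Hh by lra.
    replace (2 * x ^ 2 * h) with (2 * (- x) ^ 2 * h) by ring.
    rewrite <- Rabs_Ropp; replace (- (sin x - x)) with (sin (- x) - - x) by (rewrite sin_neg; ring).
    apply H; auto; lra.
Qed.

Lemma cos_taylor x h : Rabs x <= h \/ 1 <= h -> Rabs (cos x - 1 + x ^ 2 / 2) <= 2 * x ^ 2 * h.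
Proof.
  intros Hh; set (y := x / 2).
  replace (cos x - 1 + x ^ 2 / 2) with (2 * (y ^ 2 - sin y ^ 2)).
  2:{ replace x with (2 * y) at 1 by (unfold y; field); rewrite cos_2a_sin; unfold y; field. }
  replace (2 * x ^ 2 * h) with (2 * (4 * (y ^ 2 * h))) by (unfold y; field).
  rewrite Rabs_mult, (Rabs_right 2) by lra; apply Rmult_le_compat_l; [lra|].
  assert (Hs := Rabs_sin_le y).
  assert (Ha := Rabs_pos y).
  assert (Hsq : sin y ^ 2 <= y ^ 2) by
    (rewrite <- (pow2_abs y), <- (pow2_abs (sin y)); apply pow_incr; split; auto using Rabs_pos).
  rewrite Rabs_right by lra.
  assert (Hy2 : 0 <= y ^ 2) by apply pow2_ge_0.
  assert (Hs2 : 0 <= sin y ^ 2) by apply pow2_ge_0.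
  destruct (Rle_lt_dec 1 h) as [H1|H1]; [nra|].
  destruct Hh as [Hh|Hh]; [|lra].
  assert (Hyh : Rabs y <= h).
  { unfold y, Rdiv; rewrite Rabs_mult, (Rabs_right (/ 2)) by lra; assert (H0 := Rabs_pos x); lra. }
  assert (Ht := sin_taylor y 1 (or_intror (Rle_refl 1))).
  replace (y ^ 2 - sin y ^ 2) with ((y - sin y) * (y + sin y)) by ring.
  eapply Rle_trans; [apply Rle_abs|]; rewrite Rabs_mult.
  assert (H2 : Rabs (y + sin y) <= 2 * h).
  { eapply Rle_trans; [apply Rabs_triang|]; lra. }
  rewrite <- Rabs_Ropp in Ht; replace (- (sin y - y)) with (y - sin y) in Ht by ring.
  apply Rle_trans with (2 * y ^ 2 * 1 * (2 * h)); [|lra].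
  apply Rmult_le_compat; auto using Rabs_pos.
Qed.

Lemma Cmod_le_Re_Im z : Cmod z <= Rabs (Re z) + Rabs (Im z).
Proof.
  assert (H := Cmod2_alt z); assert (H1 := Rabs_pos (Re z)); assert (H2 := Rabs_pos (Im z)).
  rewrite <- (pow2_abs (Re z)), <- (pow2_abs (Im z)) in H.
  assert (H3 := Cmod_ge_0 z); apply Rsqr_incr_0; unfold Rsqr; nra.
Qed.

Lemma Cmod_pow_diff a b n : Cmod a <= 1 -> Cmod b <= 1 ->
  Cmod (a ^ n - b ^ n)%C <= INR n * Cmod (a - b)%C.
Proof.
  intros Ha Hb; induction n as [|n IH].
  - simpl; replace (1 - 1)%C with (RtoC 0) by ring; rewrite Cmod_0; lra.
  - rewrite S_INR, !Cpow_S.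
    replace (a * a ^ n - b * b ^ n)%C with (a * (a ^ n - b ^ n) + (a - b) * b ^ n)%C by ring.
    eapply Rle_trans; [apply Cmod_triangle|]; rewrite !Cmod_mult, Cmod_pow.
    assert (H1 := Cmod_ge_0 (a ^ n - b ^ n)%C); assert (H2 := Cmod_ge_0 (a - b)%C).
    assert (H3 : Cmod b ^ n <= 1) by (rewrite <- (pow1 n); apply pow_incr; auto using Cmod_ge_0).
    assert (Cmod a * Cmod (a ^ n - b ^ n)%C <= 1 * Cmod (a ^ n - b ^ n)%C)
      by (apply Rmult_le_compat_r; auto).
    assert (Cmod (a - b)%C * Cmod b ^ n <= Cmod (a - b)%C * 1) by (apply Rmult_le_compat_l; auto).
    lra.
Qed.

Lemma Cmod_cis_minus_1 t : 0 <= t -> Cmod (cis t - 1)%C <= 2 * t.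
Proof.
  intros Ht; eapply Rle_trans; [apply Cmod_le_Re_Im|].
  change (Re (cis t - 1)%C) with (cos t + - (1)); change (Im (cis t - 1)%C) with (sin t + - 0).
  assert (H1 := Rabs_sin_le t); rewrite (Rabs_right t) in H1 by lra.
  replace (sin t + - 0) with (sin t) by ring.
  assert (H2 : Rabs (cos t + - (1)) <= t).
  { replace t with (2 * (t / 2)) at 1 by field; rewrite cos_2a_sin.
    assert (H := Rabs_sin_le (t / 2)); rewrite (Rabs_right (t / 2)) in H by lra.
    assert (Hb := SIN_bound (t / 2)).
    assert (Hc : Rabs (sin (t / 2)) <= 1) by (apply Rabs_le; lra).
    replace (1 - 2 * sin (t / 2) * sin (t / 2) + - (1)) with
      (- (2 * (sin (t / 2) * sin (t / 2)))) by ring.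
    rewrite Rabs_Ropp, !Rabs_mult, (Rabs_right 2) by lra.
    assert (H0 := Rabs_pos (sin (t / 2))); nra. }
  lra.
Qed.

Definition truncated_at (p : nat -> R) (v : R) (K : nat) (e : R) : Prop :=
  1 - e <= lsum p (seq 0 (S K)) /\ 1 - e <= lsum (fun k => INR k * p k) (seq 0 (S K)) /\
  v - e <= lsum (fun k => (INR k - 1) ^ 2 * p k) (seq 0 (S K)).

(** The moments of order 0, 1 and 2 produce 1, 0 and -v t^2 / 2. For t <= 4 the truncation costs e
    in the mass, 8 e in the variance and 4 e in the mean, 13 e in all. *)
Lemma chi_expansion p v K e t (h : nat -> R) : critical_law p v -> truncated_at p v K e ->
  0 <= t <= 4 -> (forall k, Rabs ((INR k - 1) * t) <= h k \/ 1 <= h k) ->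
  Cmod (chi p K t - RtoC (1 - v * t ^ 2 / 2))%C <=
  4 * t ^ 2 * lsum (fun k => (INR k - 1) ^ 2 * p k * h k) (seq 0 (S K)) + 13 * e.
Proof.
  intros Hlaw (T1 & T2 & T3) Ht Hh; assert (Hp := law_nonneg p v Hlaw).
  destruct (law_partial_le p v K Hlaw) as (U1 & U2 & U3).
  set (P := lsum p (seq 0 (S K))) in *.
  set (M := lsum (fun k => INR k * p k) (seq 0 (S K))) in *.
  set (V := lsum (fun k => (INR k - 1) ^ 2 * p k) (seq 0 (S K))) in *.
  set (S0 := lsum (fun k => (INR k - 1) ^ 2 * p k * h k) (seq 0 (S K))).
  eapply Rle_trans; [apply Cmod_le_Re_Im|].
  assert (HR : Rabs (Re (chi p K t - RtoC (1 - v * t ^ 2 / 2))%C) <= 2 * t ^ 2 * S0 + 9 * e).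
  { change (Re (chi p K t - RtoC (1 - v * t ^ 2 / 2))%C) with
      (lsum (fun k => p k * cos ((INR k - 1) * t)) (seq 0 (S K)) + - (1 - v * t ^ 2 / 2)).
    replace (lsum (fun k => p k * cos ((INR k - 1) * t)) (seq 0 (S K)) + - (1 - v * t ^ 2 / 2)) with
      (lsum (fun k => p k * (cos ((INR k - 1) * t) - 1 + ((INR k - 1) * t) ^ 2 / 2)) (seq 0 (S K))
       + ((P - 1) + t ^ 2 / 2 * (v - V))).
    2:{ rewrite (lsum_ext (fun k => p k * (cos ((INR k - 1) * t) - 1 + ((INR k - 1) * t) ^ 2 / 2))
          (fun k => p k * cos ((INR k - 1) * t) - p k + t ^ 2 / 2 * ((INR k - 1) ^ 2 * p k)))
          by (intros; field).
        rewrite lsum_plus, lsum_minus, lsum_scal; fold P; fold V; field. }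
    eapply Rle_trans; [apply Rabs_triang|]; apply Rplus_le_compat.
    - eapply Rle_trans; [apply lsum_abs|]; unfold S0; rewrite <- lsum_scal.
      apply lsum_le; intros k _; rewrite Rabs_mult, (Rabs_right (p k)) by (apply Rle_ge; auto).
      assert (H := cos_taylor _ _ (Hh k)); apply (Rmult_le_compat_l (p k)) in H; auto.
      eapply Rle_trans; [exact H|right; ring].
    - assert (0 <= t ^ 2 / 2 * (v - V)) by (apply Rmult_le_pos; nra).
      assert (t ^ 2 / 2 * (v - V) <= 8 * e) by (apply Rmult_le_compat; nra).
      apply Rabs_le; lra. }
  assert (HI : Rabs (Im (chi p K t - RtoC (1 - v * t ^ 2 / 2))%C) <= 2 * t ^ 2 * S0 + 4 * e).
  { change (Im (chi p K t - RtoC (1 - v * t ^ 2 / 2))%C) with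
      (lsum (fun k => p k * sin ((INR k - 1) * t)) (seq 0 (S K)) + - 0).
    replace (lsum (fun k => p k * sin ((INR k - 1) * t)) (seq 0 (S K)) + - 0) with
      (lsum (fun k => p k * (sin ((INR k - 1) * t) - (INR k - 1) * t)) (seq 0 (S K))
       + t * (M - P)).
    2:{ rewrite (lsum_ext (fun k => p k * (sin ((INR k - 1) * t) - (INR k - 1) * t))
          (fun k => p k * sin ((INR k - 1) * t) + t * p k + (- t) * (INR k * p k)))
          by (intros; ring).
        rewrite !lsum_plus, !lsum_scal; fold P; fold M; ring. }
    eapply Rle_trans; [apply Rabs_triang|]; apply Rplus_le_compat.
    - eapply Rle_trans; [apply lsum_abs|]; unfold S0; rewrite <- lsum_scal.
      apply lsum_le; intros k _; rewrite Rabs_mult, (Rabs_right (p k)) by (apply Rle_ge; auto).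
      assert (H := sin_taylor _ _ (Hh k)); apply (Rmult_le_compat_l (p k)) in H; auto.
      eapply Rle_trans; [exact H|right; ring].
    - rewrite Rabs_mult, (Rabs_right t) by lra.
      apply Rmult_le_compat; [lra|apply Rabs_pos|lra|apply Rabs_le; lra]. }
  lra.
Qed.

Lemma chi_minus_1 p v K e t : critical_law p v -> truncated_at p v K e -> 0 <= t <= 4 ->
  Cmod (chi p K t - 1)%C <= 5 * v * t ^ 2 + 13 * e.
Proof.
  intros Hlaw HT Ht.
  assert (H := chi_expansion p v K e t (fun _ => 1) Hlaw HT Ht (fun _ => or_intror (Rle_refl 1))).
  rewrite (lsum_ext (fun k => (INR k - 1) ^ 2 * p k * 1) (fun k => (INR k - 1) ^ 2 * p k)) in H
    by (intros; ring).
  destruct (law_partial_le p v K Hlaw) as (_ & _ & U3).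
  assert (Hv := law_var_pos p v Hlaw); assert (Ht2 : 0 <= t ^ 2) by apply pow2_ge_0.
  replace (chi p K t - 1)%C with
    ((chi p K t - RtoC (1 - v * t ^ 2 / 2)) + RtoC (- (v * t ^ 2 / 2)))%C.
  2:{ rewrite RtoC_minus, RtoC_opp; ring. }
  eapply Rle_trans; [apply Cmod_triangle|].
  rewrite Cmod_R, Rabs_Ropp, Rabs_right by (apply Rle_ge; nra).
  assert (4 * t ^ 2 * lsum (fun k => (INR k - 1) ^ 2 * p k) (seq 0 (S K)) <= 4 * t ^ 2 * v)
    by (apply Rmult_le_compat_l; lra).
  nra.
Qed.

(** Atoms up to [K1] are charged a cubic remainder, larger ones only their share [e1] of the
    variance: the usual splitting that makes the error o(t^2). *)
Lemma chi_second_order p v K K1 e e1 t : critical_law p v ->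
  truncated_at p v K e -> truncated_at p v K1 e1 -> (1 <= K1 <= K)%nat -> 0 <= t <= 4 ->
  Cmod (chi p K t - RtoC (1 - v * t ^ 2 / 2))%C <=
  4 * t ^ 2 * (INR K1 * t * v + e1) + 13 * e.
Proof.
  intros Hlaw HT (_ & _ & HT1) HK Ht.
  set (h := fun k => if (k <=? K1)%nat then INR K1 * t else 1).
  assert (HK1 : 1 <= INR K1) by (apply (le_INR 1); lia).
  assert (Hh : forall k, Rabs ((INR k - 1) * t) <= h k \/ 1 <= h k).
  { intros k; unfold h; destruct (Nat.leb_spec k K1) as [Hk|Hk]; [left|right; lra].
    rewrite Rabs_mult, (Rabs_right t) by lra; apply Rmult_le_compat_r; [lra|].
    assert (Hk0 := pos_INR k); apply le_INR in Hk; apply Rabs_le; lra. }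
  eapply Rle_trans; [apply (chi_expansion p v K e t h Hlaw HT Ht Hh)|].
  apply Rplus_le_compat_r, Rmult_le_compat_l; [nra|].
  destruct (law_partial_le p v K Hlaw) as (_ & _ & U3).
  set (x := fun k => (INR k - 1) ^ 2 * p k) in *.
  assert (Hx : forall k, 0 <= x k) by apply (law_var_nonneg p v Hlaw).
  apply Rle_trans with (lsum (fun k => INR K1 * t * x k + (x k -
    (if (k <=? K1)%nat then x k else 0))) (seq 0 (S K))).
  - apply lsum_le; intros k _; fold (x k); unfold h; specialize (Hx k).
    assert (0 <= INR K1 * t * x k) by (apply Rmult_le_pos; [apply Rmult_le_pos; lra|exact Hx]).
    destruct (k <=? K1)%nat; lra.
  - rewrite lsum_plus, lsum_minus, lsum_scal.
    rewrite (lsum_seq_extend (fun k => if (k <=? K1)%nat then x k else 0) (S K1) (S K)).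
    + rewrite (lsum_ext (fun k => if (k <=? K1)%nat then x k else 0) x).
      * assert (INR K1 * t * lsum x (seq 0 (S K)) <= INR K1 * t * v)
          by (apply Rmult_le_compat_l; [nra|auto]); lra.
      * intros k Hk; apply in_seq in Hk; rewrite (proj2 (Nat.leb_le _ _)) by lia; reflexivity.
    + lia.
    + intros k Hk; rewrite (proj2 (Nat.leb_gt _ _)) by lia; reflexivity.
Qed.

Lemma continuous_gauss al t : continuous (fun s => s * exp (- (al * s ^ 2))) t.
Proof. apply (ex_derive_continuous (V := R_NormedModule)); auto_derive; auto. Qed.

(** The factor t provides an explicit antiderivative, so no Gaussian integral is ever evaluated. *)
Lemma RInt_gauss_le al a b : 0 < al ->
  RInt (fun t => t * exp (- (al * t ^ 2))) a b <= / (2 * al).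
Proof.
  intros Hal.
  rewrite (is_RInt_unique (V := R_CompleteNormedModule) _ _ _
    (minus (- exp (- (al * b ^ 2)) / (2 * al)) (- exp (- (al * a ^ 2)) / (2 * al)))).
  - assert (Ha : exp (- (al * a ^ 2)) <= 1).
    { rewrite <- exp_0; apply exp_mono.
      assert (0 <= al * a ^ 2) by (apply Rmult_le_pos; [lra|apply pow2_ge_0]); lra. }
    assert (Hb := exp_pos (- (al * b ^ 2))).
    unfold minus, plus, opp; simpl.
    replace (- exp (- (al * (b * (b * 1)))) / (2 * al) + - (- exp (- (al * (a * (a * 1)))) / (2 * al)))
      with ((exp (- (al * a ^ 2)) - exp (- (al * b ^ 2))) * / (2 * al)) by (simpl; field; lra).
    rewrite <- (Rmult_1_l (/ (2 * al))) at 2; apply Rmult_le_compat_r; [|lra].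
    left; apply Rinv_0_lt_compat; lra.
  - apply (is_RInt_derive (V := R_CompleteNormedModule) (fun t => - exp (- (al * t ^ 2)) / (2 * al))).
    + intros t _; auto_derive; auto.
      change (t * (t * 1)) with (t ^ 2); field; lra.
    + intros t _; apply continuous_gauss.
Qed.

Lemma Rabs_RInt_le (f g : R -> R) a b : a <= b ->
  (forall t, continuous f t) -> (forall t, continuous g t) ->
  (forall t, a <= t <= b -> Rabs (f t) <= g t) -> Rabs (RInt f a b) <= RInt g a b.
Proof.
  intros Hab Hf Hg H.
  apply (norm_RInt_le (V := R_NormedModule) f g a b); auto.
  - apply (RInt_correct (V := R_CompleteNormedModule)), ex_RInt_cont, Hf.
  - apply (RInt_correct (V := R_CompleteNormedModule)), ex_RInt_cont, Hg.
Qed.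

Lemma RInt_ge_const (f : R -> R) a b m : a <= b -> (forall t, continuous f t) ->
  (forall t, a <= t <= b -> m <= f t) -> m * (b - a) <= RInt f a b.
Proof.
  intros Hab Hf H.
  replace (m * (b - a)) with (RInt (fun _ => m) a b).
  - apply RInt_le; auto using ex_RInt_cont.
    + apply ex_RInt_const.
    + intros t Ht; apply H; lra.
  - rewrite RInt_const; unfold scal; simpl; unfold mult; simpl; ring.
Qed.

Lemma sqrt_unbounded Q : exists N, forall n, (N <= n)%nat -> Q <= sqrt (INR n).
Proof.
  destruct (INR_unbounded (Q ^ 2)) as [N HN]; exists N; intros n Hn.
  apply le_INR in Hn; apply Rle_trans with (Rabs Q); [apply Rle_abs|].
  rewrite <- sqrt_Rsqr_abs; apply sqrt_le_1_alt; unfold Rsqr; simpl in HN; lra.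
Qed.

Lemma PI_div_bounds d : (1 <= d)%nat -> 0 < PI / INR d <= 4.
Proof.
  intros Hd; assert (H1 : 1 <= INR d) by (apply (le_INR 1); exact Hd).
  assert (HP := PI_4); assert (HP0 := PI_RGT_0); split; [apply Rdiv_lt_0_compat; lra|].
  apply (Rmult_le_reg_r (INR d)); [lra|].
  replace (PI / INR d * INR d) with PI by (field; lra); nra.
Qed.

Lemma truncation_exists p v e B : critical_law p v -> 0 < e ->
  exists K, (B <= K)%nat /\ truncated_at p v K e.
Proof.
  intros Hlaw He; destruct (law_partial_ge p v e Hlaw He) as [K0 HK0].
  exists (K0 + B)%nat; split; [lia|apply HK0; lia].
Qed.

(** With x = t n^{1/2}, half of the exponent absorbs one power of x, since x exp(-c x^2 / 4) is
    bounded. A factor t is thus traded for n^{-1/2}. *)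
Lemma gauss_absorb c n t : 0 < c -> 0 < n -> 0 <= t ->
  t ^ 2 * exp (- (c / 2 * n * t ^ 2)) <=
  (1 + 4 / c) / sqrt n * (t * exp (- (c / 4 * n * t ^ 2))).
Proof.
  intros Hc Hn Ht; assert (Hs := sqrt_lt_R0 n Hn).
  assert (Hss : sqrt n * sqrt n = n) by (apply sqrt_sqrt; lra).
  set (s := sqrt n) in *; set (E := exp (- (c / 4 * n * t ^ 2))).
  replace (exp (- (c / 2 * n * t ^ 2))) with (E * E)
    by (unfold E; rewrite <- exp_plus; f_equal; field).
  assert (HE : 0 < E) by apply exp_pos.
  set (x := t * s).
  assert (Hx : 0 <= x) by (apply Rmult_le_pos; lra).
  assert (HxE : x * E <= 1 + 4 / c).
  { assert (Hc4 : 0 < 4 / c) by (apply Rdiv_lt_0_compat; lra).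
    assert (H1 : (1 + c / 4 * x ^ 2) * E <= 1).
    { apply Rle_trans with (exp (c / 4 * x ^ 2) * E).
      - apply Rmult_le_compat_r; [lra|apply exp_ineq1_le].
      - unfold E; rewrite <- exp_plus; right; rewrite <- exp_0; f_equal.
        unfold x; rewrite <- Hss; ring. }
    assert (H2 : x <= (1 + 4 / c) * (1 + c / 4 * x ^ 2)).
    { replace ((1 + 4 / c) * (1 + c / 4 * x ^ 2)) with (1 + 4 / c + c / 4 * x ^ 2 + x ^ 2)
        by (field; lra).
      assert (0 <= c / 4 * x ^ 2) by (apply Rmult_le_pos; [lra|apply pow2_ge_0]).
      nra. }
    apply (Rmult_le_compat_r E) in H2; [|lra].
    apply (Rmult_le_compat_l (1 + 4 / c)) in H1; lra. }
  replace (t ^ 2 * (E * E)) with (/ s * (t * E) * (x * E)) by (unfold x; field; lra).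
  replace ((1 + 4 / c) / s * (t * E)) with (/ s * (t * E) * (1 + 4 / c)) by (field; lra).
  apply Rmult_le_compat_l; auto.
  apply Rmult_le_pos; [left; apply Rinv_0_lt_compat; lra|apply Rmult_le_pos; lra].
Qed.

(** The common factor chi^N is taken out; the rest is chi^m e^{it} - 1 = (chi^m - 1) e^{it} +
    (e^{it} - 1), and the first difference telescopes. *)
Lemma fint_diff p v K t N m : critical_law p v -> 0 <= t ->
  Rabs (fint p K (N + m) 1 t - fint p K N 0 t) <=
  Cmod (chi p K t) ^ N * (INR m * Cmod (chi p K t - 1)%C + 2 * t).
Proof.
  intros Hlaw Ht; unfold fint; set (z := chi p K t).
  replace (Re (z ^ (N + m) * cis (1 * t))%C - Re (z ^ N * cis (0 * t))%C) with
    (Re (z ^ N * ((z ^ m - 1) * cis t + (cis t - 1)))%C).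
  2:{ replace (cis (0 * t)) with (RtoC 1)
        by (unfold cis, RtoC; rewrite Rmult_0_l, cos_0, sin_0; reflexivity).
      rewrite Rmult_1_l, Cpow_add_r.
      replace (z ^ N * z ^ m * cis t)%C with
        ((z ^ N * ((z ^ m - 1) * cis t + (cis t - 1))) + z ^ N * 1)%C by ring.
      rewrite re_plus; ring. }
  eapply Rle_trans; [apply re_le_Cmod|].
  rewrite Cmod_mult, Cmod_pow; apply Rmult_le_compat_l; [apply pow_le, Cmod_ge_0|].
  eapply Rle_trans; [apply Cmod_triangle|]; rewrite Cmod_mult, Cmod_cis, Rmult_1_r.
  apply Rplus_le_compat; [|apply Cmod_cis_minus_1, Ht].
  assert (H := Cmod_pow_diff z 1 m (chi_mod_le_1 p v K t Hlaw)).
  rewrite Cpow_1_l in H; apply H; rewrite Cmod_1; lra.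
Qed.

Lemma conv_time_regularity p v d : critical_law p v -> is_span p d ->
  exists C, 0 < C /\ forall n m, (1 <= m)%nat -> (2 * m <= n)%nat ->
    Nat.divide d (n - 1) -> Nat.divide d (n - m) ->
    Rabs (conv p n (n - 1) - conv p (n - m) (n - m)) <=
    C * (INR m / (INR n * sqrt (INR n)) + / INR n).
Proof.
  intros Hlaw Hd; assert (Hd1 := span_pos p v d Hlaw Hd).
  destruct (chi_gaussian_bound p v d Hlaw Hd) as (c & K0 & Hc & Hgauss).
  assert (Hv := law_var_pos p v Hlaw).
  set (b := PI / INR d) in *; assert (Hb := PI_div_bounds d Hd1); fold b in Hb.
  set (B := 1 + 4 / c).
  assert (HB : 0 < B) by (unfold B; assert (0 < 4 / c) by (apply Rdiv_lt_0_compat; lra); lra).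
  (* [C1] and 4 / c result from integrating the t^2 and t terms against the Gaussian bound; 52 is 4
     * 13, the interval length times the truncation error. *)
  set (C1 := 10 * v * B / c); set (C2 := 4 / c + 52).
  assert (HC1 : 0 < C1) by (unfold C1; apply Rdiv_lt_0_compat; [nra|lra]).
  assert (HC2 : 0 < C2) by (unfold C2; assert (0 < 4 / c) by (apply Rdiv_lt_0_compat; lra); lra).
  exists ((C1 + C2) / b); split; [apply Rdiv_lt_0_compat; lra|].
  intros n m Hm Hnm Hdn Hdm.
  assert (Hm' : 1 <= INR m) by (apply (le_INR 1); exact Hm).
  assert (Hn' : 2 * INR m <= INR n) by (apply le_INR in Hnm; rewrite mult_INR in Hnm; simpl in Hnm; lra).
  set (N := (n - m)%nat) in *; assert (EN : (n = N + m)%nat) by (unfold N; lia).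
  assert (HN' : INR n / 2 <= INR N) by (unfold N; rewrite minus_INR by lia; lra).
  (* The truncation error enters multiplied by m <= n, and must stay of order 1 / n. *)
  set (e := / (INR n ^ 2)).
  assert (He : 0 < e) by (apply Rinv_0_lt_compat; nra).
  destruct (truncation_exists p v e (K0 + n) Hlaw He) as (K & HK & HT).
  assert (HS := sqrt_lt_R0 (INR n) ltac:(lra)).
  set (sn := sqrt (INR n)) in *.
  set (g := fun t => (5 * v * INR m * B / sn + 2) * (t * exp (- (c / 4 * INR n * t ^ 2))) + 13 * INR m * e).
  assert (Hg : forall t, continuous g t).
  { intros t; apply (ex_derive_continuous (V := R_NormedModule)); unfold g; auto_derive; auto. }
  assert (Hpt : forall t, 0 <= t <= b ->
    Rabs (fint p K n 1 t - fint p K N 0 t) <= g t).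
  { intros t Ht; rewrite EN at 1.
    eapply Rle_trans; [apply (fint_diff p v); auto; lra|].
    assert (H1 := chi_minus_1 p v K e t Hlaw HT ltac:(lra)).
    assert (H2 := Hgauss K t N ltac:(lia) Ht).
    set (X := Cmod (chi p K t) ^ N) in *.
    assert (HX0 : 0 <= X) by (apply pow_le, Cmod_ge_0).
    assert (HX1 : X <= 1).
    { unfold X; rewrite <- (pow1 N); apply pow_incr; split; [apply Cmod_ge_0|apply (chi_mod_le_1 p v), Hlaw]. }
    assert (H3 : X <= exp (- (c / 2 * INR n * t ^ 2))).
    { eapply Rle_trans; [exact H2|]; apply exp_mono.
      assert (c * (INR n / 2) * t ^ 2 <= c * INR N * t ^ 2).
      { apply Rmult_le_compat_r; [apply pow2_ge_0|]; apply Rmult_le_compat_l; lra. }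
      lra. }
    assert (H4 := gauss_absorb c (INR n) t Hc ltac:(lra) (proj1 Ht)); fold B sn in H4.
    assert (H5 : exp (- (c / 2 * INR n * t ^ 2)) <= exp (- (c / 4 * INR n * t ^ 2))).
    { apply exp_mono; assert (0 <= c * INR n * t ^ 2)
        by (apply Rmult_le_pos; [nra|apply pow2_ge_0]); lra. }
    set (G := exp (- (c / 4 * INR n * t ^ 2))) in *.
    set (F := exp (- (c / 2 * INR n * t ^ 2))) in *.
    apply Rle_trans with (X * (INR m * (5 * v * t ^ 2 + 13 * e) + 2 * t)).
    { apply Rmult_le_compat_l; auto; apply Rplus_le_compat_r, Rmult_le_compat_l; lra. }
    replace (X * (INR m * (5 * v * t ^ 2 + 13 * e) + 2 * t)) with
      (5 * v * INR m * (t ^ 2 * X) + 2 * (t * X) + 13 * INR m * e * X) by ring.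
    assert (Q1 : t ^ 2 * X <= B / sn * (t * G)).
    { eapply Rle_trans; [|exact H4]; apply Rmult_le_compat_l; [apply pow2_ge_0|exact H3]. }
    assert (Q2 : t * X <= t * G) by (apply Rmult_le_compat_l; lra).
    assert (Q3 : 13 * INR m * e * X <= 13 * INR m * e * 1) by (apply Rmult_le_compat_l; nra).
    assert (Q4 : 5 * v * INR m * (t ^ 2 * X) <= 5 * v * INR m * (B / sn * (t * G)))
      by (apply Rmult_le_compat_l; [nra|exact Q1]).
    unfold g; fold G.
    replace ((5 * v * INR m * B / sn + 2) * (t * G)) with
      (5 * v * INR m * (B / sn * (t * G)) + 2 * (t * G)) by (field; lra).
    lra. }
  assert (HI : RInt g 0 b <= C1 * (INR m / (INR n * sn)) + C2 * / INR n).
  { unfold g.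
    rewrite (RInt_plus (V := R_CompleteNormedModule)
      (fun t => (5 * v * INR m * B / sn + 2) * (t * exp (- (c / 4 * INR n * t ^ 2))))
      (fun _ => 13 * INR m * e)).
    2:{ apply ex_RInt_cont; intros t; apply (ex_derive_continuous (V := R_NormedModule)); auto_derive; auto. }
    2:{ apply ex_RInt_const. }
    rewrite (RInt_scal (V := R_CompleteNormedModule)
      (fun t => t * exp (- (c / 4 * INR n * t ^ 2)))).
    2:{ apply ex_RInt_cont, continuous_gauss. }
    rewrite RInt_const; unfold plus, scal; simpl; unfold mult; simpl.
    assert (HG := RInt_gauss_le (c / 4 * INR n) 0 b ltac:(nra)); simpl in HG.
    match goal with |- ?x * ?I + _ <= _ => set (I0 := I) in *; set (A := x) end.
    assert (HA : 0 <= A).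
    { unfold A; assert (0 <= 5 * v * INR m * B / sn); [|lra].
      apply Rmult_le_pos; [|left; apply Rinv_0_lt_compat, HS].
      repeat apply Rmult_le_pos; lra. }
    assert (Q1 : A * I0 <= A * / (2 * (c / 4 * INR n))) by (apply Rmult_le_compat_l; auto).
    assert (Q2 : A * / (2 * (c / 4 * INR n)) = C1 * (INR m / (INR n * sn)) + 4 / c * / INR n).
    { unfold A, C1; field; repeat split; lra. }
    assert (Q3 : (b - 0) * (13 * INR m * e) <= 52 * / INR n).
    { assert (INR m * e <= / INR n).
      { replace (/ INR n) with (INR n * e) by (unfold e; field; lra).
        apply Rmult_le_compat_r; lra. }
      assert (0 <= INR m * e) by nra.
      nra. }
    unfold C2; lra. }
  assert (HF : Rabs (b * conv p n (n - 1) - b * conv p N N) <= RInt g 0 b).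
  { unfold b; rewrite <- (fourier_conv p v d K n (n - 1) 1); auto; try lia.
    2:{ rewrite minus_INR by lia; simpl; ring. }
    rewrite <- (fourier_conv p v d K N N 0); auto; try lia; try ring.
    fold b.
    change (RInt (fint p K n 1) 0 b - RInt (fint p K N 0) 0 b) with
      (minus (RInt (fint p K n 1) 0 b) (RInt (fint p K N 0) 0 b)).
    rewrite <- (RInt_minus (V := R_CompleteNormedModule)) by (apply ex_RInt_cont, continuous_fint).
    apply Rabs_RInt_le; auto; [lra|].
    intros t; apply (continuous_minus (V := R_NormedModule)); apply continuous_fint. }
  replace (b * conv p n (n - 1) - b * conv p N N) with (b * (conv p n (n - 1) - conv p N N)) in HF by ring.
  rewrite Rabs_mult, (Rabs_right b) in HF by lra.
  apply (Rmult_le_reg_l b); [lra|].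
  replace (b * ((C1 + C2) / b * (INR m / (INR n * sn) + / INR n))) with
    ((C1 + C2) * (INR m / (INR n * sn) + / INR n)) by (field; lra).
  assert (0 <= INR m / (INR n * sn)).
  { apply Rmult_le_pos; [lra|left; apply Rinv_0_lt_compat; nra]. }
  assert (0 < / INR n) by (apply Rinv_0_lt_compat; lra).
  nra.
Qed.

(** chi^n is replaced by the power of a real number at cost n |chi - a|, and the phase e^{it} costs
    at most 2 t. *)
Lemma fint_lower p v K n t r : critical_law p v -> 0 <= t -> 0 <= 1 - v * t ^ 2 / 2 ->
  INR n * Cmod (chi p K t - RtoC (1 - v * t ^ 2 / 2))%C + 2 * t <= r ->
  (1 - v * t ^ 2 / 2) ^ n - r <= fint p K n 1 t.
Proof.
  intros Hlaw Ht Ha Hr; unfold fint; rewrite Rmult_1_l; set (z := chi p K t) in *.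
  set (a := 1 - v * t ^ 2 / 2) in *.
  assert (Hv := law_var_pos p v Hlaw); assert (Ht2 : 0 <= v * t ^ 2) by (apply Rmult_le_pos; [lra|apply pow2_ge_0]).
  assert (Ha1 : Cmod (RtoC a) <= 1) by (rewrite Cmod_R, Rabs_right by lra; unfold a; lra).
  assert (Hz : Cmod z <= 1) by apply (chi_mod_le_1 p v K t Hlaw).
  assert (H1 := Cmod_pow_diff z a n Hz Ha1).
  assert (H2 : Cmod (z ^ n * (cis t - 1))%C <= 2 * t).
  { rewrite Cmod_mult, Cmod_pow.
    assert (Cmod z ^ n <= 1) by (rewrite <- (pow1 n); apply pow_incr; auto using Cmod_ge_0).
    assert (H3 := Cmod_cis_minus_1 t Ht); assert (H4 := Cmod_ge_0 (cis t - 1)%C).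
    assert (0 <= Cmod z ^ n) by (apply pow_le, Cmod_ge_0); nra. }
  replace (z ^ n * cis t)%C with (RtoC (a ^ n) + ((z ^ n - RtoC a ^ n) + z ^ n * (cis t - 1)))%C.
  2:{ rewrite RtoC_pow; ring. }
  rewrite re_plus, re_RtoC, re_plus.
  assert (H3 := re_le_Cmod (z ^ n - RtoC a ^ n)%C); assert (H4 := re_le_Cmod (z ^ n * (cis t - 1))%C).
  apply Rabs_le_between in H3, H4; lra.
Qed.

(** With sn = n^{1/2}, the integral is split at al / sn and A / sn. The first piece is at least (1/2
    - sg) al / sn, the second loses at most sg per unit length, and the Gaussian tail is at most al
    / (8 sn). Together at least (al/2 - al/8 - al/8) / sn remains. *)
Lemma conv_lower p v d : critical_law p v -> is_span p d ->
  exists c1 N1, 0 < c1 /\ forall n, (N1 <= n)%nat -> Nat.divide d (n - 1) ->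
    c1 / sqrt (INR n) <= conv p n (n - 1).
Proof.
  intros Hlaw Hd; assert (Hd1 := span_pos p v d Hlaw Hd).
  destruct (chi_gaussian_bound p v d Hlaw Hd) as (c & K0 & Hc & Hgauss).
  assert (Hv := law_var_pos p v Hlaw).
  set (b := PI / INR d) in *; assert (Hb := PI_div_bounds d Hd1); fold b in Hb.
  (* Ensures al^2 v <= 1, so that n v t^2 / 2 <= 1/2 on the first piece. *)
  set (al := / (1 + v)).
  assert (Hal : 0 < al <= 1).
  { unfold al; split; [apply Rinv_0_lt_compat; lra|rewrite <- Rinv_1; apply Rinv_le_contravar; lra]. }
  assert (Halv : al ^ 2 * v <= 1).
  { assert (al * (1 + v) = 1) by (unfold al; field; lra); nra. }
  (* Makes the tail constant 1 / (2 c A) at most al / 8; [sg] is then fixed by A sg = al / 8. *)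
  set (A := 4 / (c * al) + 1).
  assert (HA : 1 < A) by (unfold A; assert (0 < 4 / (c * al)) by (apply Rdiv_lt_0_compat; nra); lra).
  assert (HA2 : / (2 * c * A) <= al / 8).
  { apply (Rmult_le_reg_l (2 * c * A)); [nra|]; rewrite Rinv_r by nra.
    unfold A; replace (2 * c * (4 / (c * al) + 1) * (al / 8)) with (1 + c * al / 4) by (field; lra).
    nra. }
  set (sg := al / (8 * A)).
  assert (Hsg : 0 < sg) by (unfold sg; apply Rdiv_lt_0_compat; lra).
  assert (HAsg : A * sg = al / 8) by (unfold sg; field; lra).
  set (e1 := sg / (16 * A ^ 2)).
  assert (He1 : 0 < e1) by (unfold e1; apply Rdiv_lt_0_compat; nra).
  destruct (truncation_exists p v e1 1 Hlaw He1) as (K1 & HK1 & HT1).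
  (* The summands ensure, in order, sn >= 1, A / sn <= b, a cubic error at most sg / 4, 2 t <= sg /
     4, and 1 - v t^2 / 2 >= 0. [K1] is fixed before n, unlike [K] below. *)
  destruct (sqrt_unbounded (1 + A / b + 16 * A ^ 3 * INR K1 * v / sg + 8 * A / sg + A * (1 + v))) as [N1 HN1].
  exists (al / (4 * b)), N1; split; [apply Rdiv_lt_0_compat; lra|].
  intros n Hn Hdn; specialize (HN1 n Hn).
  set (sn := sqrt (INR n)) in *.
  assert (T1 : 0 < A / b) by (apply Rdiv_lt_0_compat; lra).
  assert (T2 : 0 <= 16 * A ^ 3 * INR K1 * v / sg).
  { apply Rmult_le_pos; [|left; apply Rinv_0_lt_compat, Hsg].
    assert (0 <= A ^ 3) by (apply pow_le; lra); assert (Hk := pos_INR K1).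
    repeat apply Rmult_le_pos; lra. }
  assert (T3 : 0 < 8 * A / sg) by (apply Rdiv_lt_0_compat; lra).
  assert (T4 : 0 < A * (1 + v)) by nra.
  assert (Hsn : 1 <= sn) by lra.
  assert (Hn0 : 0 < INR n).
  { destruct (Rle_lt_dec (INR n) 0) as [H|H]; auto.
    unfold sn in Hsn; rewrite sqrt_neg_0 in Hsn by exact H; lra. }
  assert (Hsn2 : sn * sn = INR n) by (apply sqrt_sqrt; lra).
  assert (Hn1 : (1 <= n)%nat) by (destruct n; [simpl in Hn0; lra|lia]).
  (* Then 13 n e = sg / 4, the last of four equal shares of [sg]. *)
  set (e := sg / (52 * INR n)).
  assert (He : 0 < e) by (unfold e; apply Rdiv_lt_0_compat; lra).
  destruct (truncation_exists p v e (K0 + n + K1) Hlaw He) as (K & HK & HT).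
  set (f := fint p K n 1).
  assert (Hf : forall t, continuous f t) by apply continuous_fint.
  assert (HAb : A / sn <= b).
  { apply (Rmult_le_reg_r (sn / b)); [apply Rdiv_lt_0_compat; lra|].
    replace (A / sn * (sn / b)) with (A / b) by (field; lra).
    replace (b * (sn / b)) with sn by (field; lra); lra. }
  assert (Hsmall : forall t, 0 <= t <= A / sn ->
    0 <= 1 - v * t ^ 2 / 2 /\ (1 - v * t ^ 2 / 2) ^ n - sg <= f t).
  { intros t Ht.
    assert (Hts : t * sn <= A).
    { destruct Ht as [_ Ht2]; apply (Rmult_le_compat_r sn) in Ht2; [|lra].
      replace (A / sn * sn) with A in Ht2 by (field; lra); exact Ht2. }
    assert (Hts0 : 0 <= t * sn) by (apply Rmult_le_pos; lra).
    assert (Ht1 : t * (1 + v) <= 1).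
    { apply (Rmult_le_reg_r sn); [lra|].
      apply Rle_trans with (A * (1 + v)); [|lra].
      replace (t * (1 + v) * sn) with (t * sn * (1 + v)) by ring.
      apply Rmult_le_compat_r; lra. }
    assert (Ha : 0 <= 1 - v * t ^ 2 / 2).
    { assert (t <= 1) by nra. assert (v * t <= 1) by nra.
      replace (v * t ^ 2) with (v * t * t) by ring. nra. }
    split; [exact Ha|].
    apply (fint_lower p v); auto; [lra|].
    assert (H := chi_second_order p v K K1 e e1 t Hlaw HT HT1 ltac:(lia) ltac:(lra)).
    apply Rle_trans with (INR n * (4 * t ^ 2 * (INR K1 * t * v + e1) + 13 * e) + 2 * t).
    { apply Rplus_le_compat_r, Rmult_le_compat_l; [lra|exact H]. }
    replace (INR n * (4 * t ^ 2 * (INR K1 * t * v + e1) + 13 * e)) with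
      (4 * (t * sn) ^ 2 * (INR K1 * t * v) + 4 * (t * sn) ^ 2 * e1 + 13 * (INR n * e))
      by (rewrite <- Hsn2; ring).
    assert (Hts2 : (t * sn) ^ 2 <= A ^ 2) by (apply pow_incr; lra).
    assert (Q1 : 4 * (t * sn) ^ 2 * e1 <= sg / 4).
    { replace (sg / 4) with (4 * A ^ 2 * e1) by (unfold e1; field; nra).
      apply Rmult_le_compat_r; lra. }
    assert (Q2 : 13 * (INR n * e) = sg / 4) by (unfold e; field; lra).
    assert (Q3 : 2 * t <= sg / 4).
    { apply (Rmult_le_reg_r (4 * sn / sg)); [apply Rdiv_lt_0_compat; lra|].
      replace (sg / 4 * (4 * sn / sg)) with sn by (field; lra).
      replace (2 * t * (4 * sn / sg)) with (8 * (t * sn) / sg) by (field; lra).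
      apply Rle_trans with (8 * A / sg); [|lra].
      apply Rmult_le_compat_r; [left; apply Rinv_0_lt_compat, Hsg|lra]. }
    assert (Hk := pos_INR K1).
    assert (Q4 : 4 * (t * sn) ^ 2 * (INR K1 * t * v) <= sg / 4).
    { apply (Rmult_le_reg_r (4 * sn / sg)); [apply Rdiv_lt_0_compat; lra|].
      replace (sg / 4 * (4 * sn / sg)) with sn by (field; lra).
      replace (4 * (t * sn) ^ 2 * (INR K1 * t * v) * (4 * sn / sg)) with
        (16 * (t * sn) ^ 3 * (INR K1 * v / sg)) by (field; lra).
      assert (Hts3 : (t * sn) ^ 3 <= A ^ 3) by (apply pow_incr; lra).
      apply Rle_trans with (16 * A ^ 3 * (INR K1 * v / sg)).
      - apply Rmult_le_compat_r; [|lra].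
        apply Rmult_le_pos; [apply Rmult_le_pos; lra|left; apply Rinv_0_lt_compat, Hsg].
      - replace (16 * A ^ 3 * (INR K1 * v / sg)) with (16 * A ^ 3 * INR K1 * v / sg) by (field; lra).
        lra. }
    lra. }
  assert (Hi : 0 < / sn) by (apply Rinv_0_lt_compat; lra).
  assert (HalA : al / sn <= A / sn) by (apply Rmult_le_compat_r; lra).
  assert (I1 : (/ 2 - sg) * (al / sn - 0) <= RInt f 0 (al / sn)).
  { apply RInt_ge_const; auto; [unfold Rdiv; nra|].
    intros t Ht; destruct (Hsmall t ltac:(lra)) as [Ha Hl].
    assert (Hts : t * sn <= al).
    { destruct Ht as [_ Ht2]; apply (Rmult_le_compat_r sn) in Ht2; [|lra].
      replace (al / sn * sn) with al in Ht2 by (field; lra); exact Ht2. }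
    assert (Hts0 : 0 <= t * sn) by (apply Rmult_le_pos; lra).
    assert (Hvt : 0 <= v * t ^ 2 / 2).
    { assert (0 <= v * t ^ 2) by (apply Rmult_le_pos; [lra|apply pow2_ge_0]); lra. }
    assert (Hpow := pow_ge_1_minus (1 - v * t ^ 2 / 2) (v * t ^ 2 / 2) n Hvt Ha (Rle_refl _)).
    assert (INR n * (v * t ^ 2 / 2) <= / 2).
    { rewrite <- Hsn2; replace (sn * sn * (v * t ^ 2 / 2)) with ((t * sn) ^ 2 * v / 2) by field.
      assert ((t * sn) ^ 2 <= al ^ 2) by (apply pow_incr; lra).
      assert ((t * sn) ^ 2 * v <= al ^ 2 * v) by (apply Rmult_le_compat_r; lra).
      lra. }
    lra. }
  assert (I2 : - sg * (A / sn - al / sn) <= RInt f (al / sn) (A / sn)).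
  { apply RInt_ge_const; auto.
    intros t Ht; assert (0 <= al / sn) by (unfold Rdiv; nra).
    destruct (Hsmall t ltac:(lra)) as [Ha Hl].
    assert (0 <= (1 - v * t ^ 2 / 2) ^ n) by (apply pow_le, Ha); lra. }
  assert (I3 : - (/ (2 * c * A) / sn) <= RInt f (A / sn) b).
  (* On this range sn t / A >= 1; inserting this factor makes the Gaussian tail integrable in closed
     form. *)
  { set (g := fun t => sn / A * (t * exp (- (c * INR n * t ^ 2)))).
    assert (Hg : forall t, continuous g t).
    { intros t; apply (ex_derive_continuous (V := R_NormedModule)); unfold g; auto_derive; auto. }
    assert (H : Rabs (RInt f (A / sn) b) <= RInt g (A / sn) b).
    { apply Rabs_RInt_le; auto; intros t Ht.
      assert (0 < A / sn) by (apply Rdiv_lt_0_compat; lra).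
      assert (H1 : Rabs (f t) <= exp (- (c * INR n * t ^ 2))).
      { eapply Rle_trans; [apply re_le_Cmod|]; rewrite Cmod_mult, Cmod_cis, Cmod_pow, Rmult_1_r.
        apply Hgauss; [lia|lra]. }
      eapply Rle_trans; [exact H1|]; unfold g.
      assert (1 <= sn / A * t).
      { apply Rle_trans with (sn / A * (A / sn)); [right; field; lra|].
        apply Rmult_le_compat_l; [|lra]; left; apply Rdiv_lt_0_compat; lra. }
      rewrite <- Rmult_assoc; assert (He0 := exp_pos (- (c * INR n * t ^ 2))).
      rewrite <- (Rmult_1_l (exp _)) at 1; apply Rmult_le_compat_r; lra. }
    assert (H2 : RInt g (A / sn) b <= / (2 * c * A) / sn).
    { unfold g; rewrite (RInt_scal (V := R_CompleteNormedModule)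
        (fun t => t * exp (- (c * INR n * t ^ 2)))) by (apply ex_RInt_cont, continuous_gauss).
      change (sn / A * RInt (fun t => t * exp (- (c * INR n * t ^ 2))) (A / sn) b <= / (2 * c * A) / sn).
      assert (HG := RInt_gauss_le (c * INR n) (A / sn) b ltac:(nra)).
      apply (Rmult_le_compat_l (sn / A)) in HG; [|left; apply Rdiv_lt_0_compat; lra].
      eapply Rle_trans; [exact HG|right]; rewrite <- Hsn2; field; lra. }
    apply Rabs_le_between in H; lra. }
  assert (HF : RInt f 0 b = b * conv p n (n - 1)).
  { apply (fourier_conv p v d); auto; [lia|rewrite minus_INR by lia; simpl; ring]. }
  rewrite <- (RInt_Chasles f 0 (al / sn) b) in HF by (apply ex_RInt_cont, Hf).
  rewrite <- (RInt_Chasles f (al / sn) (A / sn) b) in HF by (apply ex_RInt_cont, Hf).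
  unfold plus in HF; simpl in HF.
  apply (Rmult_le_reg_l b); [lra|]; rewrite <- HF.
  replace (b * (al / (4 * b) / sn)) with (al / 4 * / sn) by (field; lra).
  assert (Hfin : al / 4 * / sn <= (/ 2 - sg) * (al / sn - 0) + (- sg * (A / sn - al / sn)
    + - (/ (2 * c * A) / sn))).
  { replace ((/ 2 - sg) * (al / sn - 0) + (- sg * (A / sn - al / sn) + - (/ (2 * c * A) / sn))) with
      ((al / 2 - A * sg - / (2 * c * A)) * / sn) by (field; lra).
    apply Rmult_le_compat_r; lra. }
  lra.
Qed.

Lemma conv_ratio p v d del : critical_law p v -> is_span p d -> 0 < del ->
  exists eta N, 0 < eta /\ forall n m, (N <= n)%nat -> (1 <= m)%nat -> INR m <= eta * INR n ->
    Nat.divide d (n - 1) -> Nat.divide d (n - m) ->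
    0 < conv p n (n - 1) /\ (1 - del) * conv p n (n - 1) <= conv p (n - m) (n - m).
Proof.
  intros Hlaw Hd Hdel.
  destruct (conv_time_regularity p v d Hlaw Hd) as (C & HC & Hreg).
  destruct (conv_lower p v d Hlaw Hd) as (c1 & N1 & Hc1 & Hlow).
  (* 1/2 gives 2 m <= n; the other bound makes the term in m at most half of del c1 n^{-1/2}, and
     the choice of [N2] handles the term 1 / n. *)
  set (eta := Rmin (/ 2) (del * c1 / (2 * C))).
  assert (Heta : 0 < eta).
  { apply Rmin_glb_lt; [lra|apply Rdiv_lt_0_compat; nra]. }
  destruct (sqrt_unbounded (1 + 2 * C / (del * c1))) as [N2 HN2].
  exists eta, (N1 + N2)%nat; split; auto; intros n m Hn Hm Hmn Hdn Hdm.
  specialize (HN2 n ltac:(lia)); specialize (Hlow n ltac:(lia) Hdn).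
  set (sn := sqrt (INR n)) in *.
  assert (T : 0 < 2 * C / (del * c1)) by (apply Rdiv_lt_0_compat; nra).
  assert (Hm' : 1 <= INR m) by (apply (le_INR 1); exact Hm).
  assert (Hn0 : 0 < INR n) by nra.
  assert (Hsn2 : sn * sn = INR n) by (apply sqrt_sqrt; lra).
  assert (Hmn2 : (2 * m <= n)%nat).
  { apply INR_le; rewrite mult_INR; simpl (INR 2).
    assert (eta <= / 2) by apply Rmin_l; nra. }
  specialize (Hreg n m Hm Hmn2 Hdn Hdm); fold sn in Hreg.
  apply Rabs_le_between in Hreg.
  assert (Hpos : 0 < c1 / sn) by (apply Rdiv_lt_0_compat; lra).
  split; [lra|].
  assert (Hmain : C * (INR m / (INR n * sn) + / INR n) <= del * (c1 / sn)).
  { assert (Q1 : C * (INR m / (INR n * sn)) <= del * c1 / 2 * / sn).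
    { replace (C * (INR m / (INR n * sn))) with (C * INR m / INR n * / sn) by (field; lra).
      apply Rmult_le_compat_r; [left; apply Rinv_0_lt_compat; lra|].
      apply (Rmult_le_reg_r (INR n)); [lra|].
      replace (C * INR m / INR n * INR n) with (C * INR m) by (field; lra).
      assert (H := Rmin_r (/ 2) (del * c1 / (2 * C))); fold eta in H.
      apply Rle_trans with (C * (del * c1 / (2 * C) * INR n)).
      - apply Rmult_le_compat_l; [lra|]; eapply Rle_trans; [exact Hmn|].
        apply Rmult_le_compat_r; lra.
      - right; field; lra. }
    assert (Q2 : C * / INR n <= del * c1 / 2 * / sn).
    { rewrite <- Hsn2, Rinv_mult, <- Rmult_assoc.
      apply Rmult_le_compat_r; [left; apply Rinv_0_lt_compat; lra|].
      apply (Rmult_le_reg_r (2 * sn / (del * c1))); [apply Rdiv_lt_0_compat; nra|].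
      replace (C * / sn * (2 * sn / (del * c1))) with (2 * C / (del * c1)) by (field; lra).
      replace (del * c1 / 2 * (2 * sn / (del * c1))) with sn by (field; lra); lra. }
    replace (del * (c1 / sn)) with (del * c1 / 2 * / sn + del * c1 / 2 * / sn) by (field; lra).
    lra. }
  assert (del * (c1 / sn) <= del * conv p n (n - 1)) by (apply Rmult_le_compat_l; lra).
  lra.
Qed.

(** * Comparison of the two laws *)

Lemma infinite_sum_scal_ext (f g : nat -> R) c l l' :
  infinite_sum f l -> (forall k, g k = c * f k) -> l' = c * l -> infinite_sum g l'.
Proof.
  intros Hf Hg ->; apply is_series_Reals.
  apply is_series_ext with (fun k => scal c (f k)); [intros; symmetry; apply Hg|].
  apply (is_series_scal (V := R_NormedModule)), is_series_Reals, Hf.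
Qed.

Lemma is_tau_Phi_pos w tau Phi : is_weight_seq w -> is_tau w tau Phi -> 0 < Phi.
Proof.
  intros (Hw & Hw0 & _) (Ht & HP & _).
  assert (H : lsum (fun k => w k * tau ^ k) (seq 0 1) <= Phi).
  { apply infinite_sum_partial_le; auto.
    intros k; apply Rmult_le_pos; auto; apply pow_le; lra. }
  simpl seq in H; rewrite lsum_cons, lsum_nil in H; simpl in H; lra.
Qed.

Lemma pxi_pos_iff w tau Phi k : 0 < tau -> 0 < Phi -> 0 < pxi w tau Phi k <-> 0 < w k.
Proof.
  intros Ht HP; unfold pxi, Rdiv; assert (Hk := pow_lt tau k Ht).
  assert (Hi := Rinv_0_lt_compat Phi HP); split; intros H.
  - apply (Rmult_lt_reg_l (tau ^ k)); auto; rewrite Rmult_0_r.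
    apply (Rmult_lt_reg_r (/ Phi)); auto; rewrite Rmult_0_l; exact H.
  - repeat apply Rmult_lt_0_compat; auto.
Qed.

Lemma pxi_critical w tau Phi v : is_weight_seq w -> is_tau w tau Phi ->
  infinite_sum (fun k => (INR k - 1) ^ 2 * pxi w tau Phi k) v ->
  critical_law (pxi w tau Phi) v.
Proof.
  intros Hw Htau Hv; assert (HP := is_tau_Phi_pos w tau Phi Hw Htau).
  destruct Hw as (Hw & Hw0 & k2 & Hk2 & Hwk2), Htau as (Ht & H1 & H2); split; auto.
  - intros k; unfold pxi; repeat apply Rmult_le_pos; auto.
    + apply pow_le; lra.
    + left; apply Rinv_0_lt_compat, HP.
  - apply pxi_pos_iff; auto.
  - exists k2; split; auto; apply pxi_pos_iff; auto.
  - apply (infinite_sum_scal_ext _ _ (/ Phi) _ _ H1); [intros k; unfold pxi|]; field; lra.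
  - apply (infinite_sum_scal_ext _ _ (/ Phi) _ _ H2); [intros k; unfold pxi|]; field; lra.
Qed.

Lemma pxi_span w tau Phi d : 0 < tau -> 0 < Phi -> is_span w d -> is_span (pxi w tau Phi) d.
Proof.
  intros Ht HP [H1 H2]; split.
  - intros i Hi; apply H1, (pxi_pos_iff w tau Phi); auto.
  - intros d' Hd'; apply H2; intros i Hi; apply Hd', pxi_pos_iff; auto.
Qed.

(** The vertices other than the root are counted by the sum of the outdegrees, each of which has
    positive weight and is therefore a multiple of [d]. *)
Lemma tsize_mod_span p d t : (forall k, 0 <= p k) -> is_span p d -> tprod p t <> 0 ->
  exists m, tsize t = S (m * d).
Proof.
  intros Hp [Hd _]; induction t as [ts IH] using tree_forall_ind.
  rewrite tprod_Node, tsize_Node; intros H.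
  assert (Hl : p (length ts) <> 0) by (intros E; apply H; rewrite E; ring).
  assert (Hf : fprod p ts <> 0) by (intros E; apply H; rewrite E; ring).
  destruct (Hd (length ts)) as [a Ha]; [specialize (Hp (length ts)); lra|].
  assert (Hm : exists m, fsize ts = (length ts + m * d)%nat).
  { clear H Hl Ha; induction IH as [|u l Hu Hl IHl]; [exists 0%nat; reflexivity|].
    change (fprod p (u :: l)) with (tprod p u * fprod p l) in Hf.
    destruct Hu as [m1 Hm1]; [intros E; apply Hf; rewrite E; ring|].
    destruct IHl as [m2 Hm2]; [intros E; apply Hf; rewrite E; ring|].
    exists (m1 + m2)%nat; change (fsize (u :: l)) with (tsize u + fsize l)%nat.
    simpl length; lia. }
  destruct Hm as [m Hm]; exists (a + m)%nat; lia.
Qed.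

Lemma mod_one_divide n d : (1 <= n)%nat -> Nat.modulo n d = Nat.modulo 1 d -> Nat.divide d (n - 1).
Proof.
  intros Hn H; exists (n / d - 1 / d)%nat.
  assert (H1 := Nat.div_mod_eq n d); assert (H2 := Nat.div_mod_eq 1 d).
  rewrite Nat.mul_sub_distr_r, !(Nat.mul_comm _ d); lia.
Qed.

(** If [s] has weight zero the left side vanishes. Otherwise its size is 1 modulo [d], like n, so
    the divisibility required by the local estimate holds. *)
Lemma laws_ratio w tau Phi v d n k s x del :
  critical_law (pxi w tau Phi) v -> is_span (pxi w tau Phi) d -> 0 < tau -> 0 < Phi ->
  In x (vertices s) -> length x = k -> (tsize s <= n)%nat -> Nat.divide d (n - 1) ->
  0 < conv (pxi w tau Phi) n (n - 1) ->
  (Nat.divide d (n - tsize s) -> (1 - del) * conv (pxi w tau Phi) n (n - 1) <=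
     conv (pxi w tau Phi) (n - tsize s) (n - tsize s)) ->
  (1 - del) * law_Tstar w tau Phi k (Some (s, x)) <= law_Tn w n k (Some (s, x)).
Proof.
  intros Hlaw Hd Ht HP Hx Hk Hs Hn Hpos Hratio.
  set (p := pxi w tau Phi) in *; assert (Hp : forall j, 0 <= p j) by apply (law_nonneg p v Hlaw).
  rewrite (law_Tn_rescale w tau Phi) by auto; fold p.
  simpl; rewrite Hk, Nat.eqb_refl, star_prob_eq, (ind_true _ Hx), Rmult_1_l.
  change (gw_prob w tau Phi s) with (tprod p s).
  destruct (Req_dec (tprod p s) 0) as [E|E].
  - rewrite E, Rmult_0_r; apply law_Tn_nonneg, Hp.
  - rewrite law_Tn_Some by (auto; lra).
    destruct (tsize_mod_span p d s Hp Hd E) as [m Hm], Hn as [a Ha].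
    specialize (Hratio ltac:(exists (a - m)%nat; rewrite Nat.mul_sub_distr_r; lia)).
    assert (Hs0 : 0 <= tprod p s) by (apply tprod_nonneg, Hp).
    apply (Rmult_le_reg_r (conv p n (n - 1))); auto.
    unfold Rdiv; rewrite (Rmult_assoc _ (/ _)), Rinv_l, Rmult_1_r by lra.
    apply (Rmult_le_compat_l (tprod p s)) in Hratio; lra.
Qed.

Theorem theorem5p2 (w : nat -> R) (d : nat) (tau Phi : R) (kn : nat -> nat) :
  is_weight_seq w ->
  is_span w d ->
  typeI w ->
  is_tau w tau Phi ->
  finite_variance w tau Phi ->
  Un_cv (fun n => INR (kn n) / sqrt (INR n)) 0 ->
  forall eps : R, 0 < eps ->
  exists N : nat, forall n : nat, (N <= n)%nat -> Nat.modulo n d = Nat.modulo 1 d ->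
    tv_le (law_Tn w n (kn n)) (law_Tstar w tau Phi (kn n)) eps.
Proof.
  intros Hw Hspan _ Htau [v Hv] Hkn eps Heps.
  assert (HP := is_tau_Phi_pos w tau Phi Hw Htau).
  assert (Ht : 0 < tau) by apply Htau.
  assert (Hlaw := pxi_critical w tau Phi v Hw Htau Hv).
  assert (Hd := pxi_span w tau Phi d Ht HP Hspan).
  set (p := pxi w tau Phi) in *; assert (Hp := law_nonneg p v Hlaw).
  set (del := eps / 2); assert (Hdel : 0 < del) by (unfold del; lra).
  replace eps with (2 * del) by (unfold del; field).
  destruct (conv_ratio p v d del Hlaw Hd Hdel) as (eta & N1 & Heta & Hratio).
  destruct (generation_mass_lower p v Hlaw) as (C & HC & Hmass).
  destruct (INR_unbounded (/ eta)) as [q0 Hq0].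
  (* The size threshold will be M = n / q; as 1 / q <= eta, trees of size at most M fall under the
     local estimate. *)
  set (q := S q0).
  assert (Hq : 1 <= INR q) by (apply (le_INR 1); unfold q; lia).
  assert (Hqe : 1 <= eta * INR q).
  { assert (Hqq : / eta <= INR q) by (unfold q; rewrite S_INR; lra).
    apply (Rmult_le_compat_l eta) in Hqq; [|lra]; rewrite Rinv_r in Hqq; lra. }
  (* From n < q (M + 1) <= 2 q M one gets sn <= sq M^{1/2}. Hence (k + 1) / sn <= 2 e turns into C
     (k + 1) / M^{1/2} <= del, which dictates [e]. *)
  set (sq := sqrt (2 * INR q)).
  assert (Hsq : 0 < sq) by (apply sqrt_lt_R0; lra).
  set (e := del / (2 * C * sq)).
  assert (He : 0 < e) by (unfold e; apply Rdiv_lt_0_compat; nra).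
  destruct (Hkn e He) as [N2 HN2].
  destruct (sqrt_unbounded (1 + / e)) as [N3 HN3].
  exists (N1 + N2 + N3 + 2 * q + 1)%nat; intros n Hn Hmod.
  assert (Hdn := mod_one_divide n d ltac:(lia) Hmod).
  specialize (HN2 n ltac:(lia)); specialize (HN3 n ltac:(lia)).
  set (k := kn n) in *; set (sn := sqrt (INR n)) in *.
  assert (Hie : 0 < / e) by (apply Rinv_0_lt_compat, He).
  assert (Hk : (INR k + 1) / sn <= 2 * e).
  { unfold Rdist in HN2; rewrite Rminus_0_r in HN2; apply Rabs_def2 in HN2.
    assert (/ sn <= e).
    { apply (Rmult_le_reg_l sn); [lra|]; rewrite Rinv_r by lra.
      apply (Rmult_le_reg_r (/ e)); [lra|]; rewrite Rmult_assoc, Rinv_r by lra; lra. }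
    unfold Rdiv in *; lra. }
  set (M := (n / q)%nat).
  assert (Hq0' : q <> 0%nat) by (unfold q; lia).
  assert (HM1 : (q * M <= n)%nat) by (apply Nat.Div0.mul_div_le).
  assert (HM2 : (2 <= M)%nat) by (apply Nat.div_le_lower_bound; lia).
  assert (HM3 : (n <= 2 * q * M)%nat).
  { assert (H := Nat.mul_succ_div_gt n q Hq0'); fold M in H; nia. }
  assert (HMeta : INR M <= eta * INR n).
  { apply le_INR in HM1; rewrite mult_INR in HM1; assert (H0 := pos_INR M).
    apply Rle_trans with (eta * (INR q * INR M)); [nra|apply Rmult_le_compat_l; lra]. }
  assert (HMs : sn <= sq * sqrt (INR M)).
  { unfold sn, sq; rewrite <- sqrt_mult by (assert (H0 := pos_INR M); lra).
    apply sqrt_le_1_alt; apply le_INR in HM3; rewrite !mult_INR in HM3; simpl (INR 2) in HM3; lra. }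
  assert (HM0 : 0 < sqrt (INR M)) by (apply sqrt_lt_R0, lt_0_INR; lia).
  destruct (Hmass M k HM2) as (L & HL & HLM & HLmass).
  assert (Hsmall : C * (INR k + 1) / sqrt (INR M) <= del).
  { assert (Hk0 := pos_INR k).
    apply (Rmult_le_reg_r (sqrt (INR M))); [exact HM0|].
    replace (C * (INR k + 1) / sqrt (INR M) * sqrt (INR M)) with (C * (INR k + 1)) by (field; lra).
    apply (Rmult_le_compat_r sn) in Hk; [|lra].
    replace ((INR k + 1) / sn * sn) with (INR k + 1) in Hk by (field; lra).
    apply Rle_trans with (C * (2 * e * (sq * sqrt (INR M)))).
    - apply Rmult_le_compat_l; [lra|]; eapply Rle_trans; [exact Hk|].
      apply Rmult_le_compat_l; lra.
    - unfold e; right; field; lra. }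
  apply (tv_le_of_good_set _ _ (pointings k L)).
  - intros x; rewrite (law_Tn_rescale w tau Phi) by auto; apply law_Tn_nonneg, Hp.
  - intros x; apply law_Tstar_nonneg, Hp.
  - intros L0 HL0; rewrite (lsum_ext _ (law_Tn p n k))
      by (intros; apply law_Tn_rescale; auto).
    apply law_Tn_mass_le_1; auto.
  - intros L0 HL0; apply (law_Tstar_mass_le_1 w tau Phi v); auto.
  - apply NoDup_pointings, HL.
  - rewrite law_Tstar_pointings; fold p; lra.
  - intros [[s x]|] Hx.
    + apply in_pointings in Hx; destruct Hx as (Hs & Hx & Hlen).
      specialize (HLM s Hs).
      assert (Hsn : (tsize s <= n)%nat) by nia.
      assert (Hse : INR (tsize s) <= eta * INR n) by (apply le_INR in HLM; lra).
      apply (laws_ratio w tau Phi v d); auto; fold p.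
      (* Positivity at time n does not depend on [s], so m = 1 is used, for which the divisibility
         is already known. *)
      * destruct (Hratio n 1%nat) as [H _]; auto; try lia.
        assert (H1 := le_INR _ _ (tsize_pos s)); lra.
      * intros Hdiv; apply (Hratio n (tsize s)); auto; [lia|apply tsize_pos].
    + exfalso; unfold pointings in Hx; apply in_flat_map in Hx.
      destruct Hx as (t & _ & Hx); apply in_map_iff in Hx; destruct Hx as (? & E & _); discriminate.
  - lra.
Qed.
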